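(* Let $\lambda\in\{1,-1\}$, let $m\ge1$ and $n\ge1$ be integers, and let $u:[0,\infty)\to\mathbb{R}$ satisfy $$u\in C^{m+1}([0,\infty)),\qquad (1+x)^n\partial^iu(x)\in L^1([0,\infty)),\quad i=0,1,\dots,m+1.$$ Then the spectral functions $a(k)$ and $b(k)$ associated with $u$ (defined in the context) have the following properties: (a) $a(k)$ and $b(k)$ are continuous for $\operatorname{Im}k\le0$ and analytic for $\operatorname{Im}k<0$. (b) There exist complex constants $\{a_j,b_j\}_{j=1}^m$ such that $$a(k)=1+\frac{a_1}{k}+\cdots+\frac{a_m}{k^m}+O\Big(\frac1{k^{m+1}}\Big),\qquad b(k)=\frac{b_1}{k}+\cdots+\frac{b_m}{k^m}+O\Big(\frac1{k^{m+1}}\Big),$$ uniformly as $k\to\infty$ with $\operatorname{Im}k\le0$. (c) For $j=1,\dots,n$, the derivatives $a^{(j)}(k)$ and $b^{(j)}(k)$ have continuous extensions to $\operatorname{Im}k\le0$ and, with the same constants, $$a^{(j)}(k)=\frac{d^j}{dk^j}\Big(1+\frac{a_1}{k}+\cdots+\frac{a_m}{k^m}\Big)+O\Big(\frac1{k^{m+1}}\Big),\qquad b^{(j)}(k)=\frac{d^j}{dk^j}\Big(\frac{b_1}{k}+\cdots+\frac{b_m}{k^m}\Big)+O\Big(\frac1{k^{m+1}}\Big),$$ uniformly as $k\to\infty$ with $\operatorname{Im}k\le0$. (d) $a(k)=\overline{a(-\bar k)}$ and $b(k)=\overline{b(-\bar k)}$ for $\operatorname{Im}k\le0$. (e) $|a(k)|^2-\lambda|b(k)|^2=1$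 for $k\in\mathbb{R}$. (f) If $\lambda=1$, then $a(k)\ne0$ for $\operatorname{Im}k\le0$.
   Context: $\sigma_3=\begin{pmatrix}1&0\\0&-1\end{pmatrix}$ and $\hat\sigma_3$ acts on a $2\times2$ matrix $A$ by $\hat\sigma_3A=[\sigma_3,A]$, so $e^{c\hat\sigma_3}A=e^{c\sigma_3}Ae^{-c\sigma_3}$. $\bar{\mathbb{C}}_+=\{\operatorname{Im}k\ge0\}$, $\bar{\mathbb{C}}_-=\{\operatorname{Im}k\le0\}$; ''$k\in(S_1,S_2)$'' means that the first column of a $2\times2$ matrix is considered for $k\in S_1$ and the second column for $k\in S_2$. Let $\mathsf{U}(x)=\begin{pmatrix}0&u(x)\\ \lambda u(x)&0\end{pmatrix}$ and let $X(x,k)$, $x\ge0$, $k\in(\bar{\mathbb{C}}_+,\bar{\mathbb{C}}_-)$, be the $2\times2$-matrix valued solution of the Volterra integral equation $$X(x,k)=I+\int_\infty^xe^{-ik(x'-x)\hat\sigma_3}(\mathsf{U}X)(x',k)\,dx',$$ which solves $X_x-ik[\sigma_3,X]=\mathsf{U}X$. Let $s(k)=X(0,k)$. By the symmetries of $X$ under $k\mapsto\bar k$, the spectral functions $a(k)$ and $b(k)$ may be defined for $\operatorname{Im}k\le0$ by $$s(k)=\begin{pmatrix}\overline{a(\bar k)}&b(k)\\ \lambda\overline{b(\bar k)}&a(k)\end{pmatrix},\qquad k\in(\bar{\mathbb{C}}_+,\bar{\mathbb{C}}_-),$$ i.e. $(b(k),a(k))^T$ is the second column of $X(0,k)$. 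*)

(* Defs.v *)
From Stdlib Require Import Reals Lra Lia.
From Coquelicot Require Import Coquelicot.

Open Scope R_scope.

Definition Cexp (z : C) : C :=
  (exp (Re z) * cos (Im z), exp (Re z) * sin (Im z)).

Definition M2 : Type := @matrix C 2 2.

(* Entries are indexed from 0: the second column is column 1. *)
Definition entry (A : M2) (i j : nat) : C := coeff_mat (RtoC 0) A i j.

Definition mat2 (a11 a12 a21 a22 : C) : M2 :=
  [[a11, a12], [a21, a22]].

Definition Mmul (A B : M2) : M2 := @Mmult C_Ring 2 2 2 A B.

Definition I2 : M2 := @Mone C_Ring 2.

(* e^{c sigma3}, where sigma3 = diag(1,-1). *)
Definition exp_sigma3 (c : C) : M2 :=
  mat2 (Cexp c) (RtoC 0) (RtoC 0) (Cexp (- c)%C).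

(* e^{c \hat\sigma_3} A = e^{c sigma3} A e^{-c sigma3}. *)
Definition exp_hat_sigma3 (c : C) (A : M2) : M2 :=
  Mmul (Mmul (exp_sigma3 c) A) (exp_sigma3 (- c)%C).

Definition Umat (lambda : R) (u : R -> R) (x : R) : M2 :=
  mat2 (RtoC 0) (RtoC (u x)) (RtoC (lambda * u x)) (RtoC 0).

(* The set of k for which column j of X(x,k) is considered. *)
Definition col_domain (j : nat) (k : C) : Prop :=
  match j with
  | O => 0 <= Im k
  | _ => Im k <= 0
  end.

(* The Volterra equation
     X(x,k) = I + \int_\infty^x e^{-ik(x'-x) \hat\sigma_3} (U X)(x',k) dx',
   entry by entry.  Column j of the integrand involves only column j of X, so
   the values of X(x,k) in column j for k outside [col_domain j] play no role. *)
Definition volterra_solution (lambda : R) (u : R -> R) (X : R -> C -> M2) : Prop :=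
  forall (x : R) (k : C) (i j : nat),
    0 <= x -> (i < 2)%nat -> (j < 2)%nat -> col_domain j k ->
    @is_RInt_gen C_R_NormedModule
      (fun x' : R =>
         entry (exp_hat_sigma3 (- Ci * k * RtoC (x' - x))%C
                  (Mmul (Umat lambda u x') (X x' k))) i j)
      (Rbar_locally p_infty) (at_point x)
      (entry (X x k) i j - entry I2 i j)%C.

(* Only the values of a and b on Im k <= 0 are prescribed. *)
Definition spectral_functions (lambda : R) (u : R -> R) (a b : C -> C) : Prop :=
  exists X : R -> C -> M2,
    volterra_solution lambda u X /\
    forall k : C, Im k <= 0 ->
      b k = entry (X 0 k) 0 1 /\ a k = entry (X 0 k) 1 1.

(* Derivative relative to [0,\infty): one-sided at x = 0. *)
Definition is_derive_halfline (f : R -> R) (x l : R) : Prop :=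
  filterlim (fun y => (f y - f x) / (y - x))
    (within (fun y => 0 <= y) (locally' x)) (locally l).

(* u is of class C^p on [0,\infty), with successive derivatives
   Du 0 = u, Du 1, ..., Du p there. *)
Definition Cp_halfline (p : nat) (u : R -> R) (Du : nat -> R -> R) : Prop :=
  (forall x, 0 <= x -> Du O x = u x) /\
  (forall i x, (i < p)%nat -> 0 <= x -> is_derive_halfline (Du i) x (Du (S i) x)) /\
  (forall i, (i <= p)%nat -> continuous_on (fun x => 0 <= x) (Du i)).

(* For functions that are continuous on [0,\infty), as all those to which this
   is applied, this is membership in L^1([0,\infty)). *)
Definition L1_halfline (f : R -> R) : Prop :=
  ex_RInt_gen (fun x => Rabs (f x)) (at_point 0) (Rbar_locally p_infty).

Definition closed_lower (k : C) : Prop := Im k <= 0.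

Definition C_continuous_on (D : C -> Prop) (f : C -> C) : Prop :=
  @continuous_on C_UniformSpace C_UniformSpace D f.

Definition is_C_derive (f : C -> C) (z l : C) : Prop :=
  @is_derive C_AbsRing C_NormedModule f z l.

(* Complex analogues of [Derive_n] and [is_derive_n]. *)
Fixpoint C_derive_n (f : C -> C) (j : nat) (z : C) : C :=
  match j with
  | O => f z
  | S i => C_derive (C_derive_n f i) z
  end.

Definition is_C_derive_n (f : C -> C) (j : nat) (z l : C) : Prop :=
  match j with
  | O => f z = l
  | S i => is_C_derive (C_derive_n f i) z l
  end.

(* On an open set D; complex differentiability at every point of D. *)
Definition C_analytic_on (D : C -> Prop) (f : C -> C) : Prop :=
  forall z : C, D z -> exists l : C, is_C_derive f z l.

(* c0 + c_1/k + ... + c_m/k^m *)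
Definition inv_poly (c0 : C) (c : nat -> C) (m : nat) (k : C) : C :=
  (c0 + @sum_n_m C_AbelianMonoid (fun l => c l / k ^ l) 1 m)%C.

(* f(k) = O(1/k^p) uniformly as k -> \infty with Im k <= 0. *)
Definition O_inv_pow (p : nat) (f : C -> C) : Prop :=
  exists K M : R, 0 < K /\
    forall k : C, Im k <= 0 -> K <= Cmod k -> Cmod (f k) <= M / Cmod k ^ p.

(* The j-th derivative of f on Im k < 0 extends continuously to Im k <= 0, and
   the extension is g^{(j)}(k) + O(1/k^p) there. *)
Definition derivative_asymptotics (f g : C -> C) (j p : nat) : Prop :=
  exists fj : C -> C,
    (forall k : C, Im k < 0 -> is_C_derive_n f j k (fj k)) /\
    C_continuous_on closed_lower fj /\
    O_inv_pow p (fun k => fj k - C_derive_n g j k)%C.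

(* Main.v *)
Require Import Defs.
From Stdlib Require Import Reals Lra Lia.
From Coquelicot Require Import Coquelicot.

(** The second column of [X] is [(f, 1 + g)], where [f] and [g] vanish at infinity
    and solve
      [f' = 2ik f - w + u g],   [g' = lambda u f]   with [w = - u],
    after an extension of [u] to the whole line. Everything follows from the study
    of this system for a general source [w] and [Im k <= 0].

    Existence, bounds, uniqueness. The solution of [f' = 2ik f - h] that vanishes at
    infinity is the integral of [exp (-2ik(y - x)) h y] over [y >= x], whose kernel
    has modulus at most 1. Hence successive approximations converge uniformly in
    [k], with a bound of [f] and [g] by a multiple of the integral of [|w|] over
    [x, infinity) ([solve_spec]). Uniqueness follows from a differential inequality
    for [|f|^2 + |g|^2] ([system_zero]).

    Dependence on [k]. Differentiation in [k] adds the source [-2if]: the derivative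
    of order [j] solves the system with source [-2ij] times the derivative of order
    [j - 1] of [f]. Each order therefore costs one more integration over
    [x, infinity), and [n] moments of [w] bound [n] derivatives. Differences between
    two values of [k] and remainders of first-order Taylor formulas solve systems of
    the same kind, with one and two more integrations. A source with exactly [n]
    moments is split into a truncated part, for which these extra integrations are
    available, and a part which is small in the weighted norm; this gives [n]
    derivatives on the closed half-plane, the last one being continuous
    ([trace_cont], [trace_deriv]).

    Expansion in [1/k]. One integration by parts ([expansion_step]) shows that the
    solution with source [w] is [(w, gam) / (2ik)] plus [1 / (2ik)] times the
    solution with source [w' - u gam], where [gam] is the decaying primitive of
    [lambda u w]. After [m + 1] steps the remainder is [(2ik)^(-m-1)] times a
    solution whose source still has [n] moments, and whose derivatives in [k] are
    thus bounded. The derivatives of the expansion are controlled by the same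
    remainder ([expansion_derivatives]).

    Symmetry and zeros. Complex conjugation turns the solution at [k] into the
    solution at the opposite of the conjugate of [k]. The quantity
    [|1 + g|^2 - lambda |f|^2] has derivative [4 lambda Im k |f|^2] in [x] and limit
    1 at infinity, which gives the determinant relation on the real axis and, for
    [lambda = 1], the absence of zeros of [a] ([jost_energy]). *)

Open Scope R_scope.

(** * Complex functions of a real variable *)

(** Componentwise, so that real differentiation rules, continuity and the
    fundamental theorem of calculus apply directly. *)
Definition derivC (f : R -> C) (x : R) (l : C) : Prop :=
  is_derive (fun t => Re (f t)) x (Re l) /\
  is_derive (fun t => Im (f t)) x (Im l).

Definition contC (f : R -> C) : Prop :=
  forall x, continuous (fun t => Re (f t)) x /\ continuous (fun t => Im (f t)) x.

Definition vanish (f : R -> C) : Prop :=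
  is_lim (fun x => Cmod (f x)) p_infty 0.

Lemma is_derive_eq (f : R -> R) (x l l' : R) :
  is_derive f x l -> l = l' -> is_derive f x l'.
Proof. now intros H <-. Qed.

Lemma is_derive_Rmult (f g : R -> R) (x df dg : R) :
  is_derive f x df -> is_derive g x dg ->
  is_derive (fun t => f t * g t) x (df * g x + f x * dg).
Proof.
  intros Hf Hg.
  exact (is_derive_mult f g x df dg Hf Hg Rmult_comm).
Qed.

Lemma is_derive_continuous (f : R -> R) (x l : R) :
  is_derive f x l -> continuous f x.
Proof.
  intros H; apply (ex_derive_continuous (K := R_AbsRing) (V := R_NormedModule) f x).
  now exists l.
Qed.

Lemma is_derive_sqr (f : R -> R) (x l : R) :
  is_derive f x l -> is_derive (fun t => f t ^ 2) x (2 * f x * l).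
Proof.
  intros H; eapply is_derive_eq; [exact (is_derive_pow f 2 x l H) | simpl; ring].
Qed.

Lemma derivC_eq (f : R -> C) (x : R) (l l' : C) :
  derivC f x l -> l = l' -> derivC f x l'.
Proof. now intros H <-. Qed.

Lemma derivC_ext (f g : R -> C) (x : R) (l : C) :
  (forall t, f t = g t) -> derivC f x l -> derivC g x l.
Proof.
  intros E [H1 H2]; split.
  - apply is_derive_ext with (2 := H1); intros t; now rewrite E.
  - apply is_derive_ext with (2 := H2); intros t; now rewrite E.
Qed.

Lemma derivC_const (c : C) (x : R) : derivC (fun _ => c) x (RtoC 0).
Proof.
  split; [exact (is_derive_const (Re c : R_NormedModule) x)
         |exact (is_derive_const (Im c : R_NormedModule) x)].
Qed.

Lemma derivC_RtoC (f : R -> R) (x l : R) :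
  is_derive f x l -> derivC (fun t => RtoC (f t)) x (RtoC l).
Proof.
  intros H; split; [exact H | exact (is_derive_const (0 : R_NormedModule) x)].
Qed.

Lemma derivC_plus (f g : R -> C) (x : R) (df dg : C) :
  derivC f x df -> derivC g x dg ->
  derivC (fun t => f t + g t)%C x (df + dg)%C.
Proof.
  intros [F1 F2] [G1 G2]; split.
  - exact (is_derive_plus _ _ _ _ _ F1 G1).
  - exact (is_derive_plus _ _ _ _ _ F2 G2).
Qed.

Lemma derivC_opp (f : R -> C) (x : R) (df : C) :
  derivC f x df -> derivC (fun t => - f t)%C x (- df)%C.
Proof.
  intros [F1 F2]; split.
  - exact (is_derive_opp _ _ _ F1).
  - exact (is_derive_opp _ _ _ F2).
Qed.

Lemma derivC_minus (f g : R -> C) (x : R) (df dg : C) :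
  derivC f x df -> derivC g x dg ->
  derivC (fun t => f t - g t)%C x (df - dg)%C.
Proof.
  intros F G; apply derivC_plus; [exact F | now apply derivC_opp].
Qed.

Lemma derivC_conj (f : R -> C) (x : R) (df : C) :
  derivC f x df -> derivC (fun t => Cconj (f t)) x (Cconj df).
Proof.
  intros [F1 F2]; split; [exact F1|].
  exact (is_derive_opp _ _ _ F2).
Qed.

Lemma derivC_mult (f g : R -> C) (x : R) (df dg : C) :
  derivC f x df -> derivC g x dg ->
  derivC (fun t => f t * g t)%C x (df * g x + f x * dg)%C.
Proof.
  intros [F1 F2] [G1 G2]; split.
  - eapply is_derive_eq.
    + exact (is_derive_minus _ _ _ _ _ (is_derive_Rmult _ _ _ _ _ F1 G1)
               (is_derive_Rmult _ _ _ _ _ F2 G2)).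
    + unfold Re, Im, minus, plus, opp; simpl; ring.
  - eapply is_derive_eq.
    + exact (is_derive_plus _ _ _ _ _ (is_derive_Rmult _ _ _ _ _ F1 G2)
               (is_derive_Rmult _ _ _ _ _ F2 G1)).
    + unfold Re, Im, plus; simpl; ring.
Qed.

Lemma derivC_scal (c : C) (f : R -> C) (x : R) (df : C) :
  derivC f x df -> derivC (fun t => c * f t)%C x (c * df)%C.
Proof.
  intros F; eapply derivC_eq.
  - exact (derivC_mult _ _ _ _ _ (derivC_const c x) F).
  - cbv beta; ring.
Qed.

Lemma derivC_Cexp (c : C) (x : R) :
  derivC (fun t => Cexp (c * RtoC t)%C) x (c * Cexp (c * RtoC x))%C.
Proof.
  destruct c as [a b]; unfold derivC, Cexp, Re, Im; simpl; split.
  - auto_derive; [exact I|]. unfold Rminus; ring.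
  - auto_derive; [exact I|]. unfold Rminus; ring.
Qed.

Lemma derivC_contC (f df : R -> C) :
  (forall x, derivC f x (df x)) -> contC f.
Proof.
  intros H x; destruct (H x) as [H1 H2]; split.
  - exact (is_derive_continuous _ _ _ H1).
  - exact (is_derive_continuous _ _ _ H2).
Qed.

Lemma contC_const (c : C) : contC (fun _ => c).
Proof. intros x; split; apply continuous_const. Qed.

Lemma contC_RtoC (f : R -> R) :
  (forall x, continuous f x) -> contC (fun t => RtoC (f t)).
Proof. intros H x; split; [apply H | apply continuous_const]. Qed.

Lemma contC_ext (f g : R -> C) : (forall x, f x = g x) -> contC f -> contC g.
Proof.
  intros E H x; destruct (H x) as [H1 H2]; split.
  - apply continuous_ext with (2 := H1); intros t; now rewrite E.
  - apply continuous_ext with (2 := H2); intros t; now rewrite E.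
Qed.

Lemma contC_plus (f g : R -> C) :
  contC f -> contC g -> contC (fun t => f t + g t)%C.
Proof.
  intros F G x; destruct (F x), (G x); split;
    apply (continuous_plus (V := R_NormedModule)); assumption.
Qed.

Lemma contC_opp (f : R -> C) : contC f -> contC (fun t => - f t)%C.
Proof.
  intros F x; destruct (F x); split;
    apply (continuous_opp (V := R_NormedModule)); assumption.
Qed.

Lemma contC_minus (f g : R -> C) :
  contC f -> contC g -> contC (fun t => f t - g t)%C.
Proof. intros F G; apply contC_plus; [exact F | now apply contC_opp]. Qed.

Lemma contC_mult (f g : R -> C) :
  contC f -> contC g -> contC (fun t => f t * g t)%C.
Proof.
  intros F G x; destruct (F x) as [F1 F2], (G x) as [G1 G2]; split.
  - apply (continuous_minus (V := R_NormedModule));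
      apply (continuous_mult (K := R_AbsRing)); assumption.
  - apply (continuous_plus (V := R_NormedModule));
      apply (continuous_mult (K := R_AbsRing)); assumption.
Qed.

Lemma contC_Cexp (c : C) : contC (fun t => Cexp (c * RtoC t)%C).
Proof. apply derivC_contC with (df := fun x => (c * Cexp (c * RtoC x))%C), derivC_Cexp. Qed.

Lemma Cexp_add (z w : C) : Cexp (z + w) = (Cexp z * Cexp w)%C.
Proof.
  unfold Cexp, Re, Im; destruct z as [a b], w as [c d]; simpl.
  rewrite exp_plus, cos_plus, sin_plus.
  unfold Cmult; simpl; f_equal; ring.
Qed.

Lemma Cexp_0 : Cexp (RtoC 0) = RtoC 1.
Proof.
  unfold Cexp, RtoC, Re, Im; simpl. rewrite exp_0, cos_0, sin_0.
  f_equal; ring.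
Qed.

Lemma Cexp_conj (z : C) : Cexp (Cconj z) = Cconj (Cexp z).
Proof.
  unfold Cexp, Cconj, Re, Im; destruct z as [a b]; simpl.
  rewrite cos_neg, sin_neg; f_equal; ring.
Qed.

Lemma Cmod_Cexp (z : C) : Cmod (Cexp z) = exp (Re z).
Proof.
  unfold Cmod, Cexp; simpl.
  replace (_ + _) with (Rsqr (exp (Re z)) * (Rsqr (sin (Im z)) + Rsqr (cos (Im z))))
    by (unfold Rsqr; ring).
  rewrite sin2_cos2, Rmult_1_r.
  apply sqrt_Rsqr, Rlt_le, exp_pos.
Qed.

Lemma Rabs_Im_le (z : C) : Rabs (Im z) <= Cmod z.
Proof.
  apply Rle_trans with (2 := Rmax_Cmod z); apply Rmax_r.
Qed.

Lemma Cmod_le_Re_Im (z : C) : Cmod z <= Rabs (Re z) + Rabs (Im z).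
Proof.
  destruct z as [a b].
  replace (a, b) with (RtoC a + (Ci * RtoC b))%C
    by (unfold Ci, RtoC, Cplus, Cmult; simpl; f_equal; ring).
  eapply Rle_trans; [apply Cmod_triangle|].
  rewrite Cmod_mult, !Cmod_R, Cmod_Ci.
  unfold Re, Im, Ci, RtoC, Cplus, Cmult; simpl.
  apply Req_le; f_equal; [f_equal|rewrite Rmult_1_l; f_equal]; ring.
Qed.

Lemma Cmod_minus_sym (z w : C) : Cmod (z - w) = Cmod (w - z).
Proof. rewrite <- Cmod_opp; f_equal; ring. Qed.

Lemma exp_monotone (x y : R) : x <= y -> exp x <= exp y.
Proof.
  intros [L | ->]; [now apply Rlt_le, exp_increasing | apply Rle_refl].
Qed.

Lemma mult_div_succ_le (c e : R) : 0 <= c -> 0 <= e -> c * (e / (c + 1)) <= e.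
Proof.
  intros Hc He; apply Rmult_le_reg_r with (c + 1); [lra|].
  replace (c * (e / (c + 1)) * (c + 1)) with (c * e) by (field; lra); nra.
Qed.

Lemma nonincreasing (phi dphi : R -> R) (x y : R) :
  x <= y ->
  (forall t, x <= t <= y -> is_derive phi t (dphi t)) ->
  (forall t, x <= t <= y -> dphi t <= 0) ->
  phi y <= phi x.
Proof.
  intros Hxy Hd Hneg.
  destruct (MVT_gen phi x y dphi) as [c [Hc E]];
    rewrite Rmin_left, Rmax_right in * by assumption.
  - intros t Ht; apply Hd; lra.
  - intros t Ht; apply continuity_pt_filterlim.
    exact (is_derive_continuous _ _ _ (Hd t Ht)).
  - specialize (Hneg c Hc); nra.
Qed.

Lemma vanish_le (f : R -> C) (b : R -> R) (x0 : R) :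
  (forall x, x0 <= x -> Cmod (f x) <= b x) -> is_lim b p_infty 0 -> vanish f.
Proof.
  intros H Hb.
  apply is_lim_le_le_loc with (f := fun _ => 0) (g := b).
  - exists x0; intros x Hx; split; [apply Cmod_ge_0 | apply H; lra].
  - apply is_lim_const.
  - exact Hb.
Qed.

Lemma is_lim_0_plus (f g : R -> R) :
  is_lim f p_infty 0 -> is_lim g p_infty 0 -> is_lim (fun x => f x + g x) p_infty 0.
Proof.
  intros F G; replace (Finite 0) with (Finite (0 + 0)) by (f_equal; ring).
  now apply is_lim_plus with (1 := F) (2 := G).
Qed.

Lemma is_lim_0_scal (c : R) (f : R -> R) :
  is_lim f p_infty 0 -> is_lim (fun x => c * f x) p_infty 0.
Proof.
  intros F; replace (Finite 0) with (Rbar_mult c 0) by (simpl; f_equal; ring).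
  now apply is_lim_scal_l.
Qed.

Lemma vanish_plus (f g : R -> C) :
  vanish f -> vanish g -> vanish (fun x => f x + g x)%C.
Proof.
  intros F G; eapply vanish_le with (x0 := 0).
  - intros x _; apply Cmod_triangle.
  - now apply is_lim_0_plus.
Qed.

Lemma vanish_scal (c : C) (f : R -> C) :
  vanish f -> vanish (fun x => c * f x)%C.
Proof.
  intros F; eapply vanish_le with (x0 := 0).
  - intros x _; rewrite Cmod_mult; apply Rle_refl.
  - now apply is_lim_0_scal.
Qed.

Lemma vanish_ext (f g : R -> C) :
  (forall x, f x = g x) -> vanish f -> vanish g.
Proof.
  intros E; apply is_lim_ext; intros x; now rewrite E.
Qed.

Lemma vanish_minus (f g : R -> C) :
  vanish f -> vanish g -> vanish (fun x => f x - g x)%C.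
Proof.
  intros F G; apply vanish_ext with (fun x => f x + (RtoC (-1)) * g x)%C.
  - intros x; ring.
  - apply vanish_plus; [exact F | now apply vanish_scal].
Qed.

Lemma vanish_conj (f : R -> C) : vanish f -> vanish (fun x => Cconj (f x)).
Proof.
  apply is_lim_ext; intros x; now rewrite Cmod_conj.
Qed.

Lemma is_lim_0_eps (f : R -> R) :
  is_lim f p_infty 0 ->
  forall eps, 0 < eps -> exists B, forall x, B < x -> Rabs (f x) < eps.
Proof.
  intros H eps Heps.
  apply is_lim_spec in H; destruct (H (mkposreal eps Heps)) as [B HB].
  exists B; intros x Hx; specialize (HB x Hx); simpl in HB.
  now rewrite Rminus_0_r in HB.
Qed.

Lemma eps_is_lim_0 (f : R -> R) :
  (forall eps, 0 < eps -> exists B, forall x, B < x -> Rabs (f x) < eps) ->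
  is_lim f p_infty 0.
Proof.
  intros H; apply is_lim_spec; intros [eps Heps].
  destruct (H eps Heps) as [B HB]; exists B; intros x Hx; simpl.
  rewrite Rminus_0_r; now apply HB.
Qed.

Lemma le_of_lim_0 (a b : R) (e : R -> R) (x0 : R) :
  (forall y, x0 <= y -> a <= b + e y) -> is_lim e p_infty 0 -> a <= b.
Proof.
  intros H He; apply Rnot_lt_le; intros Hab.
  destruct (is_lim_0_eps e He (a - b)) as [B HB]; [lra|].
  set (y := Rmax x0 (B + 1)).
  assert (x0 <= y) by apply Rmax_l.
  assert (B + 1 <= y) by apply Rmax_r.
  specialize (H y ltac:(assumption)); specialize (HB y ltac:(lra)).
  apply Rabs_def2 in HB; lra.
Qed.

Lemma nonneg_of_decreasing_to_0 (Om dOm : R -> R) (x0 : R) :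
  (forall x, x0 <= x -> is_derive Om x (dOm x)) ->
  (forall x, x0 <= x -> dOm x <= 0) ->
  is_lim Om p_infty 0 ->
  forall x, x0 <= x -> 0 <= Om x.
Proof.
  intros Hd Hn Hl x Hx.
  assert (- Om x <= 0); [|lra].
  apply le_of_lim_0 with (e := fun y => (-1) * Om y) (x0 := x).
  - intros y Hy.
    enough (Om y <= Om x) by lra.
    apply nonincreasing with (dphi := dOm); [exact Hy | |];
      intros t Ht; [apply Hd | apply Hn]; lra.
  - now apply is_lim_0_scal.
Qed.

(** * Integrals up to infinity *)

(** A certificate for the bound of the integral of [|h|] over [x, infinity) by
    [Om x]. Only a differential inequality is asked of [Om], so that products of
    decreasing functions are majorants as soon as one factor is. *)
Definition majorant (x0 : R) (h : R -> C) (Om : R -> R) : Prop :=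
  (exists dOm : R -> R, forall x, x0 <= x ->
     is_derive Om x (dOm x) /\ Cmod (h x) <= - dOm x) /\
  is_lim Om p_infty 0.

Lemma majorant_le (x0 : R) (h g : R -> C) (Om : R -> R) :
  (forall x, x0 <= x -> Cmod (g x) <= Cmod (h x)) ->
  majorant x0 h Om -> majorant x0 g Om.
Proof.
  intros L [[dOm H] Hl]; split; [|exact Hl].
  exists dOm; intros x Hx; destruct (H x Hx) as [H1 H2]; split; [exact H1|].
  specialize (L x Hx); lra.
Qed.

Lemma majorant_from (x0 x1 : R) (h : R -> C) (Om : R -> R) :
  x0 <= x1 -> majorant x0 h Om -> majorant x1 h Om.
Proof.
  intros L [[dOm H] Hl]; split; [|exact Hl].
  exists dOm; intros x Hx; apply H; lra.
Qed.

Lemma majorant_plus (x0 : R) (h g : R -> C) (Om Th : R -> R) :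
  majorant x0 h Om -> majorant x0 g Th ->
  majorant x0 (fun x => h x + g x)%C (fun x => Om x + Th x).
Proof.
  intros [[dOm H] Hl] [[dTh H'] Hl']; split; [|now apply is_lim_0_plus].
  exists (fun x => dOm x + dTh x); intros x Hx.
  destruct (H x Hx) as [H1 H2], (H' x Hx) as [H3 H4]; split.
  - exact (is_derive_plus _ _ _ _ _ H1 H3).
  - eapply Rle_trans; [apply Cmod_triangle | lra].
Qed.

Lemma majorant_scal (x0 c : R) (h g : R -> C) (Om : R -> R) :
  0 <= c ->
  (forall x, x0 <= x -> Cmod (g x) <= c * Cmod (h x)) ->
  majorant x0 h Om -> majorant x0 g (fun x => c * Om x).
Proof.
  intros Hc L [[dOm H] Hl]; split; [|now apply is_lim_0_scal].
  exists (fun x => c * dOm x); intros x Hx.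
  destruct (H x Hx) as [H1 H2]; split.
  - exact (is_derive_scal _ _ _ _ H1).
  - specialize (L x Hx); nra.
Qed.

Lemma majorant_nonneg (x0 : R) (h : R -> C) (Om : R -> R) :
  majorant x0 h Om -> forall x, x0 <= x -> 0 <= Om x.
Proof.
  intros [[dOm H] Hl]; apply nonneg_of_decreasing_to_0 with dOm; [| |exact Hl];
    intros x Hx; destruct (H x Hx) as [H1 H2]; [exact H1|].
  generalize (Cmod_ge_0 (h x)); lra.
Qed.

Lemma majorant_decr (x0 : R) (h : R -> C) (Om : R -> R) :
  majorant x0 h Om -> forall x y, x0 <= x -> x <= y -> Om y <= Om x.
Proof.
  intros [[dOm H] Hl] x y Hx Hxy; apply nonincreasing with dOm; [exact Hxy| |];
    intros t Ht; destruct (H t ltac:(lra)) as [H1 H2]; [exact H1|].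
  generalize (Cmod_ge_0 (h t)); lra.
Qed.

(** The projection of [P] on the direction of its own increment reduces this
    to a monotone real function. *)
Lemma Cmod_increment_le (P p : R -> C) (Om dOm : R -> R) (x y : R) :
  x <= y ->
  (forall t, x <= t <= y -> derivC P t (p t)) ->
  (forall t, x <= t <= y -> is_derive Om t (dOm t)) ->
  (forall t, x <= t <= y -> Cmod (p t) <= - dOm t) ->
  Cmod (P y - P x) <= Om x - Om y.
Proof.
  intros Hxy HP HO Hb.
  set (z := (P y - P x)%C).
  assert (HOm : Om y <= Om x).
  { apply nonincreasing with dOm; [exact Hxy | exact HO |].
    intros t Ht; generalize (Cmod_ge_0 (p t)) (Hb t Ht); lra. }
  assert (Hz : Cmod z * (Cmod z + Om y - Om x) <= 0).
  { set (phi := fun t => Re z * Re (P t) + Im z * Im (P t) + Cmod z * Om t).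
    assert (H : phi y <= phi x).
    { apply nonincreasing with
        (fun t => Re z * Re (p t) + Im z * Im (p t) + Cmod z * dOm t);
        [exact Hxy | |]; intros t Ht.
      - destruct (HP t Ht) as [H1 H2].
        exact (is_derive_plus _ _ _ _ _
                 (is_derive_plus _ _ _ _ _ (is_derive_scal _ _ _ _ H1)
                    (is_derive_scal _ _ _ _ H2))
                 (is_derive_scal _ _ _ _ (HO t Ht))).
      - specialize (Hb t Ht).
        assert (H : Re z * Re (p t) + Im z * Im (p t) <= Cmod z * Cmod (p t)).
        { rewrite <- (Cmod_conj z), <- Cmod_mult.
          eapply Rle_trans; [|apply re_le_Cmod].
          eapply Rle_trans; [|apply Rle_abs].
          unfold Re, Im, Cconj, Cmult; simpl; lra. }
        generalize (Cmod_ge_0 z); nra. }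
    unfold phi in H.
    assert (E : Cmod z ^ 2 = Re z * (Re (P y) - Re (P x)) + Im z * (Im (P y) - Im (P x))).
    { rewrite Cmod2_alt; unfold z; unfold Re, Im, Cminus, Cplus, Copp; simpl; ring. }
    nra. }
  generalize (Cmod_ge_0 z); intros Hz0.
  destruct (Rle_lt_or_eq_dec _ _ Hz0) as [Hp | E]; nra.
Qed.

(** The integral of [h] over [x, infinity). *)
Definition tail (h : R -> C) (x : R) : C :=
  (real (Lim (fun b => RInt (fun t => Re (h t)) x b) p_infty),
   real (Lim (fun b => RInt (fun t => Im (h t)) x b) p_infty)).

Lemma is_lim_of_cauchy_bound (f Om : R -> R) (x0 : R) :
  (forall x y, x0 <= x -> x <= y -> Rabs (f y - f x) <= Om x) ->
  is_lim Om p_infty 0 ->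
  exists l : R, is_lim f p_infty l.
Proof.
  intros H HO.
  apply (proj1 (filterlim_locally_cauchy (F := Rbar_locally' p_infty) (U := R_CompleteSpace) f)).
  intros [eps Heps].
  destruct (is_lim_0_eps _ HO eps Heps) as [B HB].
  exists (fun x => Rmax x0 B < x); split; [now exists (Rmax x0 B)|].
  assert (A : forall u v, Rmax x0 B < u -> u <= v -> Rabs (f v - f u) < eps).
  { intros u v Hu Huv.
    pose proof (Rmax_l x0 B); pose proof (Rmax_r x0 B).
    apply Rle_lt_trans with (Om u); [apply H; lra|].
    apply Rle_lt_trans with (2 := HB u ltac:(lra)), Rle_abs. }
  intros u v Hu Hv; change (Rabs (f v - f u) < eps).
  destruct (Rle_lt_dec u v) as [L | L]; [now apply A|].
  rewrite Rabs_minus_sym; apply A; lra.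
Qed.

Lemma is_derive_primitive (f : R -> R) (x : R) :
  (forall t, continuous f t) -> is_derive (fun b => RInt f 0 b) x (f x).
Proof.
  intros H; apply (is_derive_RInt (V := R_NormedModule)) with 0; [|apply H].
  exists (mkposreal 1 Rlt_0_1); intros b _.
  apply (RInt_correct (V := R_CompleteNormedModule)).
  apply ex_RInt_continuous; intros; apply H.
Qed.

Lemma Lim_RInt_primitive (f : R -> R) (x l : R) :
  (forall t, continuous f t) -> is_lim (fun b => RInt f 0 b) p_infty l ->
  real (Lim (fun b => RInt f x b) p_infty) = l - RInt f 0 x.
Proof.
  intros Hc Hl.
  assert (Hex : forall a b, ex_RInt f a b)
    by (intros; apply (ex_RInt_continuous (V := R_CompleteNormedModule)); intros; apply Hc).
  rewrite (Lim_ext (fun b => RInt f 0 b - RInt f 0 x)).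
  - replace (l - RInt f 0 x) with (real (Finite (l - RInt f 0 x))) by reflexivity.
    f_equal; apply is_lim_unique.
    apply is_lim_minus with (1 := Hl) (2 := is_lim_const _ _).
    reflexivity.
  - intros b.
    rewrite <- (RInt_Chasles f 0 x b) by apply Hex.
    unfold plus; simpl; ring.
Qed.

Lemma is_lim_Rabs_sub (f : R -> R) (l : R) :
  is_lim f p_infty l -> is_lim (fun x => Rabs (l - f x)) p_infty 0.
Proof.
  intros H; apply is_lim_spec in H; apply eps_is_lim_0; intros eps Heps.
  destruct (H (mkposreal eps Heps)) as [B HB]; exists B; intros x Hx.
  rewrite Rabs_Rabsolu, Rabs_minus_sym; exact (HB x Hx).
Qed.

Lemma tail_spec (h : R -> C) (Om : R -> R) (x0 : R) :
  contC h -> majorant x0 h Om ->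
  (forall x, derivC (tail h) x (- h x)%C) /\ vanish (tail h).
Proof.
  intros Hc HM.
  set (P := fun b => (RInt (fun t => Re (h t)) 0 b, RInt (fun t => Im (h t)) 0 b) : C).
  assert (dP : forall b, derivC P b (h b)).
  { intros b; split; apply is_derive_primitive; intros t; apply Hc. }
  assert (HP : forall x y, x0 <= x -> x <= y -> Cmod (P y - P x) <= Om x).
  { intros x y Hx Hxy.
    apply Rle_trans with (Om x - Om y).
    - destruct HM as [[dOm H] _].
      apply Cmod_increment_le with h dOm; try assumption; intros t Ht;
        [apply dP | apply H; lra | apply H; lra].
    - generalize (majorant_nonneg _ _ _ HM y ltac:(lra)); lra. }
  destruct (is_lim_of_cauchy_bound (fun x => Re (P x)) Om x0) as [l1 H1].
  { intros x y Hx Hxy; apply Rle_trans with (2 := HP x y Hx Hxy).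
    exact (re_le_Cmod (P y - P x)%C). }
  { apply HM. }
  destruct (is_lim_of_cauchy_bound (fun x => Im (P x)) Om x0) as [l2 H2].
  { intros x y Hx Hxy; apply Rle_trans with (2 := HP x y Hx Hxy).
    exact (Rabs_Im_le (P y - P x)%C). }
  { apply HM. }
  assert (E : forall x, ((l1, l2) - P x)%C = tail h x).
  { intros x; unfold tail.
    rewrite (Lim_RInt_primitive _ x l1), (Lim_RInt_primitive _ x l2);
      try assumption; try (intros t; apply Hc).
    reflexivity. }
  split.
  - intros x; apply derivC_ext with (1 := E).
    eapply derivC_eq.
    + exact (derivC_minus _ _ _ _ _ (derivC_const (l1, l2) x) (dP x)).
    + ring.
  - apply vanish_ext with (1 := E).
    apply vanish_le with (fun x => Rabs (l1 - Re (P x)) + Rabs (l2 - Im (P x))) 0.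
    + intros x _; apply Cmod_le_Re_Im.
    + apply is_lim_0_plus.
      * now apply is_lim_Rabs_sub.
      * now apply is_lim_Rabs_sub.
Qed.

(** The integral of [exp (-2ik(y - x)) h y] over [y >= x], which is the only
    solution of [f' = 2ik f - h] that vanishes at infinity. *)
Definition green (k : C) (h : R -> C) (x : R) : C :=
  (Cexp (2 * Ci * k * RtoC x) *
   tail (fun y => Cexp (- (2 * Ci * k) * RtoC y) * h y) x)%C.

Lemma Cmod_Cexp_line (k : C) (x : R) :
  Cmod (Cexp (2 * Ci * k * RtoC x)) = exp (- (2 * Im k) * x).
Proof.
  rewrite Cmod_Cexp; f_equal.
  unfold Re, Im, Ci, RtoC, Cmult; simpl; ring.
Qed.

Lemma Cmod_Cexp_line_opp (k : C) (x : R) :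
  Cmod (Cexp (- (2 * Ci * k) * RtoC x)) = exp (2 * Im k * x).
Proof.
  rewrite Cmod_Cexp; f_equal.
  unfold Re, Im, Ci, RtoC, Cmult, Copp; simpl; ring.
Qed.

Lemma exp_line_decr (k : C) (x y : R) :
  Im k <= 0 -> x <= y -> exp (2 * Im k * y) <= exp (2 * Im k * x).
Proof.
  intros Hk Hxy; apply exp_monotone; nra.
Qed.

Lemma majorant_exp (k : C) (x0 : R) (h : R -> C) (Om : R -> R) :
  Im k <= 0 -> majorant x0 h Om ->
  majorant x0 (fun y => Cexp (- (2 * Ci * k) * RtoC y) * h y)%C
    (fun y => exp (2 * Im k * y) * Om y).
Proof.
  intros Hk HM; pose proof (majorant_nonneg _ _ _ HM) as HO.
  destruct HM as [[dOm H] Hl]; split.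
  - exists (fun y => 2 * Im k * exp (2 * Im k * y) * Om y + exp (2 * Im k * y) * dOm y).
    intros x Hx; destruct (H x Hx) as [H1 H2]; split.
    + apply (is_derive_Rmult (fun y => exp (2 * Im k * y)) Om); [|exact H1].
      auto_derive; [exact I | ring].
    + rewrite Cmod_mult, Cmod_Cexp_line_opp.
      pose proof (exp_pos (2 * Im k * x)); specialize (HO x Hx).
      assert (0 <= exp (2 * Im k * x) * Om x) by nra.
      assert (exp (2 * Im k * x) * Cmod (h x) <= exp (2 * Im k * x) * - dOm x) by nra.
      nra.
  - apply is_lim_le_le_loc with (f := fun _ => 0) (g := fun y => exp (2 * Im k * x0) * Om y).
    + exists x0; intros y Hy.
      pose proof (exp_pos (2 * Im k * y)); specialize (HO y ltac:(lra)).
      pose proof (exp_line_decr k x0 y Hk ltac:(lra)); nra.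
    + apply is_lim_const.
    + now apply is_lim_0_scal.
Qed.

(** For [Im k <= 0] the kernel of [green] has modulus at most 1, so that the
    bound on the solution does not see [k]. With [k = 0] this bounds [tail]. *)
Lemma green_bound (k : C) (f h : R -> C) (Om : R -> R) (x0 : R) :
  Im k <= 0 ->
  (forall x, x0 <= x -> derivC f x (2 * Ci * k * f x - h x)%C) ->
  vanish f -> majorant x0 h Om ->
  forall x, x0 <= x -> Cmod (f x) <= Om x.
Proof.
  intros Hk Hf Hv HM x Hx.
  pose proof (majorant_exp k x0 h Om Hk HM) as HM'.
  set (q := fun y => (Cexp (- (2 * Ci * k) * RtoC y) * h y)%C) in HM'.
  set (Th := fun y => exp (2 * Im k * y) * Om y) in HM'.
  set (H := fun y => (Cexp (- (2 * Ci * k) * RtoC y) * f y)%C).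
  assert (dH : forall y, x0 <= y -> derivC H y (- q y)%C).
  { intros y Hy; eapply derivC_eq.
    - exact (derivC_mult _ _ _ _ _ (derivC_Cexp _ y) (Hf y Hy)).
    - unfold q; ring. }
  assert (EH : forall y, Cmod (H y) = exp (2 * Im k * y) * Cmod (f y))
    by (intros y; unfold H; now rewrite Cmod_mult, Cmod_Cexp_line_opp).
  apply le_of_lim_0 with (e := fun y => Cmod (f y)) (x0 := x); [|exact Hv].
  intros y Hy.
  assert (A : Cmod (H y - H x) <= Th x - Th y).
  { destruct HM' as [[dTh HT] _].
    apply Cmod_increment_le with (fun t => (- q t)%C) dTh; [exact Hy | | |];
      intros t Ht.
    - apply dH; lra.
    - apply HT; lra.
    - rewrite Cmod_opp; apply HT; lra. }
  pose proof (majorant_nonneg _ _ _ HM' y ltac:(lra)) as HT.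
  assert (B : Cmod (H x) <= Th x + Cmod (H y)).
  { replace (H x) with ((- (H y - H x)) + H y)%C by ring.
    eapply Rle_trans; [apply Cmod_triangle|]; rewrite Cmod_opp; lra. }
  rewrite !EH in B; unfold Th in B.
  pose proof (exp_line_decr k x y Hk Hy); pose proof (exp_pos (2 * Im k * x)).
  pose proof (Cmod_ge_0 (f y)).
  apply Rmult_le_reg_l with (exp (2 * Im k * x)); nra.
Qed.

Lemma green_spec (k : C) (h : R -> C) (Om : R -> R) (x0 : R) :
  Im k <= 0 -> contC h -> majorant x0 h Om ->
  (forall x, derivC (green k h) x (2 * Ci * k * green k h x - h x)%C) /\
  vanish (green k h).
Proof.
  intros Hk Hc HM.
  set (q := fun y => (Cexp (- (2 * Ci * k) * RtoC y) * h y)%C).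
  pose proof (majorant_exp k x0 h Om Hk HM) as HM'; fold q in HM'.
  destruct (tail_spec q (fun y => exp (2 * Im k * y) * Om y) x0)
    as [dT vT]; [| exact HM' |].
  { apply contC_mult; [apply contC_Cexp | exact Hc]. }
  split.
  - intros x; eapply derivC_eq.
    + exact (derivC_mult _ _ _ _ _ (derivC_Cexp _ x) (dT x)).
    + unfold green; fold q; cbv beta.
      assert (E : (Cexp (2 * Ci * k * x) * Cexp (- (2 * Ci * k) * x))%C = RtoC 1)
        by (rewrite <- Cexp_add, <- Cexp_0; f_equal; ring).
      replace (Cexp (2 * Ci * k * x) * - q x)%C
        with (- (Cexp (2 * Ci * k * x) * Cexp (- (2 * Ci * k) * x) * h x))%C
        by (unfold q; ring).
      rewrite E; ring.
  - apply vanish_le with Om x0; [|apply HM].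
    intros x Hx; unfold green; fold q.
    rewrite Cmod_mult, Cmod_Cexp_line.
    assert (B : Cmod (tail q x) <= exp (2 * Im k * x) * Om x).
    { apply green_bound with (k := RtoC 0) (h := q) (x0 := x0)
        (Om := fun x => exp (2 * Im k * x) * Om x); try assumption.
      - unfold Im, RtoC; simpl; lra.
      - intros y _; eapply derivC_eq; [apply dT | ring]. }
    pose proof (exp_pos (- (2 * Im k) * x)).
    apply Rle_trans with (exp (- (2 * Im k) * x) * (exp (2 * Im k * x) * Om x)); [nra|].
    rewrite <- Rmult_assoc, <- exp_plus.
    replace (- (2 * Im k) * x + 2 * Im k * x) with 0 by ring.
    rewrite exp_0; lra.
Qed.

(** * Existence for the system with a source *)

Definition Clim (z : nat -> C) : C :=
  (real (Lim_seq (fun p => Re (z p))), real (Lim_seq (fun p => Im (z p)))).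

Lemma half_pow_pos (p : nat) : 0 < (/ 2) ^ p.
Proof. apply pow_lt; lra. Qed.

Lemma half_pow_small (b eps : R) :
  0 < eps -> exists p, b * (/ 2) ^ p < eps.
Proof.
  intros He.
  destruct (pow_lt_1_zero (/ 2) ltac:(rewrite Rabs_pos_eq; lra)
              (eps / (Rabs b + 1))) as [p Hp].
  { apply Rdiv_lt_0_compat; [exact He | generalize (Rabs_pos b); lra]. }
  exists p; specialize (Hp p (le_n p)).
  pose proof (half_pow_pos p); rewrite Rabs_pos_eq in Hp by lra.
  pose proof (Rabs_pos b); pose proof (Rle_abs b).
  apply Rle_lt_trans with ((Rabs b + 1) * (/ 2) ^ p); [nra|].
  apply (Rmult_lt_compat_l (Rabs b + 1)) in Hp; [|lra].
  replace ((Rabs b + 1) * (eps / (Rabs b + 1))) with eps in Hp by (field; lra).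
  exact Hp.
Qed.

Lemma le_of_half_pow (a b c : R) :
  (forall p, a <= b + c * (/ 2) ^ p) -> a <= b.
Proof.
  intros H; apply Rnot_lt_le; intros L.
  destruct (half_pow_small c (a - b)) as [p Hp]; [lra|].
  specialize (H p); lra.
Qed.

Lemma geometric_increments (z : nat -> C) (b : R) :
  0 <= b ->
  (forall p, Cmod (z (S p) - z p) <= b * (/ 2) ^ p) ->
  forall p q, (p <= q)%nat -> Cmod (z q - z p) <= 2 * b * (/ 2) ^ p.
Proof.
  intros Hb H p q Hpq.
  enough (Cmod (z q - z p) <= 2 * b * ((/ 2) ^ p - (/ 2) ^ q))
    by (pose proof (half_pow_pos q); nra).
  induction Hpq as [|q Hpq IH].
  - replace (z p - z p)%C with (RtoC 0) by ring; rewrite Cmod_0; lra.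
  - replace (z (S q) - z p)%C with ((z (S q) - z q) + (z q - z p))%C by ring.
    eapply Rle_trans; [apply Cmod_triangle|].
    specialize (H q); simpl pow; lra.
Qed.

Lemma Clim_geometric (z : nat -> C) (b : R) :
  0 <= b ->
  (forall p, Cmod (z (S p) - z p) <= b * (/ 2) ^ p) ->
  forall p, Cmod (Clim z - z p) <= 2 * b * (/ 2) ^ p.
Proof.
  intros Hb H; pose proof (geometric_increments z b Hb H) as G.
  assert (A : forall f : nat -> R,
      (forall p q, (p <= q)%nat -> Rabs (f q - f p) <= 2 * b * (/ 2) ^ p) ->
      is_lim_seq f (real (Lim_seq f))).
  { intros f Hf; apply Lim_seq_correct', ex_lim_seq_cauchy_corr.
    intros [eps Heps].
    destruct (half_pow_small (4 * b) eps Heps) as [N HN].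
    exists N; intros p q Hp Hq; simpl.
    pose proof (Hf N p Hp); pose proof (Hf N q Hq).
    replace (f p - f q) with ((f p - f N) - (f q - f N)) by ring.
    eapply Rle_lt_trans; [apply Rabs_triang|].
    rewrite Rabs_Ropp; lra. }
  assert (L1 := A (fun p => Re (z p))
    (fun p q L => Rle_trans _ _ _ (re_le_Cmod (z q - z p)%C) (G p q L))).
  assert (L2 := A (fun p => Im (z p))
    (fun p q L => Rle_trans _ _ _ (Rabs_Im_le (z q - z p)%C) (G p q L))).
  apply is_lim_seq_spec in L1; apply is_lim_seq_spec in L2.
  intros p; apply Rnot_lt_le; intros L.
  set (d := (Cmod (Clim z - z p) - 2 * b * (/ 2) ^ p) / 2).
  assert (Hd : 0 < d) by (unfold d; lra).
  destruct (L1 (mkposreal d Hd)) as [N1 H1], (L2 (mkposreal d Hd)) as [N2 H2].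
  set (q := (p + N1 + N2)%nat).
  specialize (H1 q ltac:(unfold q; lia)); specialize (H2 q ltac:(unfold q; lia)).
  simpl in H1, H2.
  pose proof (G p q ltac:(unfold q; lia)) as H3.
  assert (H4 : Cmod (Clim z - z q) < 2 * d).
  { eapply Rle_lt_trans; [apply Cmod_le_Re_Im|].
    change (Re (Clim z - z q)%C) with (real (Lim_seq (fun p => Re (z p))) - Re (z q)).
    change (Im (Clim z - z q)%C) with (real (Lim_seq (fun p => Im (z p))) - Im (z q)).
    rewrite Rabs_minus_sym in H1, H2; lra. }
  assert (H5 : Cmod (Clim z - z p) <= Cmod (Clim z - z q) + Cmod (z q - z p)).
  { replace (Clim z - z p)%C with ((Clim z - z q) + (z q - z p))%C by ring.
    apply Cmod_triangle. }
  unfold d in H4; lra.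
Qed.

Lemma contC_eps (f : R -> C) :
  (forall x eps, 0 < eps ->
     exists d, 0 < d /\ forall y, Rabs (y - x) < d -> Cmod (f y - f x) < eps) ->
  contC f.
Proof.
  intros H x; split; apply continuity_pt_filterlim, continuity_pt_locally;
    intros [eps Heps]; destruct (H x eps Heps) as [d [Hd HH]];
    exists (mkposreal d Hd); intros y Hy; simpl.
  - eapply Rle_lt_trans; [exact (re_le_Cmod (f y - f x)%C) | now apply HH].
  - eapply Rle_lt_trans; [exact (Rabs_Im_le (f y - f x)%C) | now apply HH].
Qed.

Lemma eps_contC (f : R -> C) (x eps : R) :
  contC f -> 0 < eps ->
  exists d, 0 < d /\ forall y, Rabs (y - x) < d -> Cmod (f y - f x) < eps.
Proof.
  intros H He; destruct (H x) as [H1 H2].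
  apply continuity_pt_filterlim in H1; pose proof (proj1 (continuity_pt_locally _ _) H1) as LH1.
  apply continuity_pt_filterlim in H2; pose proof (proj1 (continuity_pt_locally _ _) H2) as LH2.
  assert (He2 : 0 < eps / 2) by lra.
  destruct (LH1 (mkposreal _ He2)) as [[d1 Hd1] A1], (LH2 (mkposreal _ He2)) as [[d2 Hd2] A2].
  exists (Rmin d1 d2); split; [now apply Rmin_glb_lt|].
  intros y Hy; eapply Rle_lt_trans; [apply Cmod_le_Re_Im|].
  pose proof (Rmin_l d1 d2); pose proof (Rmin_r d1 d2).
  specialize (A1 y ltac:(change (Rabs (y - x) < d1); lra)).
  specialize (A2 y ltac:(change (Rabs (y - x) < d2); lra)).
  simpl in A1, A2.
  change (Re (f y - f x)%C) with (Re (f y) - Re (f x)).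
  change (Im (f y - f x)%C) with (Im (f y) - Im (f x)); lra.
Qed.

Lemma contC_limit (F : nat -> R -> C) (f : R -> C) (K : R -> R) :
  (forall p, contC (F p)) ->
  (forall x y, x <= y -> K y <= K x) ->
  (forall p x, Cmod (f x - F p x) <= K x * (/ 2) ^ p) ->
  contC f.
Proof.
  intros HF HK H; apply contC_eps; intros x eps He.
  destruct (half_pow_small (3 * K (x - 1)) eps He) as [p Hp].
  destruct (eps_contC (F p) x ((eps - 2 * K (x - 1) * (/ 2) ^ p)) (HF p))
    as [d [Hd HH]].
  { pose proof (half_pow_pos p); pose proof (H p (x - 1)).
    pose proof (Cmod_ge_0 (f (x - 1) - F p (x - 1))); lra. }
  exists (Rmin d 1); split; [apply Rmin_glb_lt; lra|].
  intros y Hy; pose proof (Rmin_l d 1); pose proof (Rmin_r d 1).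
  specialize (HH y ltac:(lra)).
  assert (L : x - 1 <= y) by (apply Rlt_le; assert (Rabs (y - x) < 1) as A by lra;
    apply Rabs_def2 in A; lra).
  pose proof (H p x) as E1; pose proof (H p y) as E2; pose proof (half_pow_pos p).
  pose proof (HK (x - 1) x ltac:(lra)); pose proof (HK (x - 1) y L).
  rewrite Cmod_minus_sym in E1.
  replace (f y - f x)%C with ((f y - F p y) + ((F p y - F p x) + (F p x - f x)))%C by ring.
  eapply Rle_lt_trans; [apply Cmod_triangle|].
  eapply Rle_lt_trans; [apply Rplus_le_compat_l, Cmod_triangle|]; nra.
Qed.

Section System.

Context (lambda : R) (u mu : R -> R).
Context (Hlam : Rabs lambda <= 1)
        (Hu : forall x, continuous u x)
        (Hmu : forall x, is_derive mu x (- Rabs (u x)))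
        (Hmu0 : is_lim mu p_infty 0).

(** For [w = - u] the pair [(f, 1 + g)] is the second column of [X]. General
    sources are needed because the derivatives in [k] and the remainders of the
    expansion in powers of [1/k] solve the same system with other sources. *)
Definition sol (k : C) (w f g : R -> C) : Prop :=
  (forall x, derivC f x (2 * Ci * k * f x - w x + RtoC (u x) * g x)%C) /\
  (forall x, derivC g x (RtoC (lambda * u x) * f x)%C) /\
  vanish f /\ vanish g.

(** Weight that makes the integral operators contractions for every integrable
    potential: [|u| amp] integrates to half the growth of [amp]. *)
Definition amp (x : R) : R := exp (2 * mu x).

Lemma mu_nonneg (x : R) : 0 <= mu x.
Proof.
  apply nonneg_of_decreasing_to_0 with (dOm := fun x => - Rabs (u x)) (x0 := x);
    [intros; apply Hmu | | exact Hmu0 | apply Rle_refl].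
  intros t _; generalize (Rabs_pos (u t)); lra.
Qed.

Lemma mu_decr (x y : R) : x <= y -> mu y <= mu x.
Proof.
  intros H; apply nonincreasing with (fun x => - Rabs (u x)); [exact H | |];
    intros t _; [apply Hmu | generalize (Rabs_pos (u t)); lra].
Qed.

Lemma amp_ge_1 (x : R) : 1 <= amp x.
Proof.
  unfold amp; rewrite <- exp_0; apply exp_monotone.
  generalize (mu_nonneg x); lra.
Qed.

Lemma amp_decr (x y : R) : x <= y -> amp y <= amp x.
Proof.
  intros H; unfold amp; apply exp_monotone.
  generalize (mu_decr x y H); lra.
Qed.

Lemma is_derive_amp (x : R) : is_derive amp x (- (2 * Rabs (u x) * amp x)).
Proof.
  eapply is_derive_eq.
  - apply (is_derive_comp exp (fun t => 2 * mu t)).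
    + apply is_derive_Reals, derivable_pt_lim_exp.
    + apply (is_derive_scal mu x 2), Hmu.
  - unfold amp, scal; simpl; unfold mult; simpl; ring.
Qed.

Lemma majorant_amp (x0 c : R) (w h : R -> C) (Om : R -> R) :
  0 <= c ->
  (forall x, x0 <= x -> Cmod (h x) <= 2 * c * Rabs (u x) * (amp x * Om x)) ->
  majorant x0 w Om ->
  majorant x0 h (fun x => c * (amp x * Om x)).
Proof.
  intros Hc L HM; pose proof (majorant_nonneg _ _ _ HM) as HO.
  destruct HM as [[dOm H] Hl]; split.
  - exists (fun x => c * (- (2 * Rabs (u x) * amp x) * Om x + amp x * dOm x)).
    intros x Hx; destruct (H x Hx) as [H1 H2]; split.
    + apply (is_derive_scal (fun x => amp x * Om x)).
      apply is_derive_Rmult; [apply is_derive_amp | exact H1].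
    + specialize (L x Hx); pose proof (Cmod_ge_0 (w x)); pose proof (amp_ge_1 x).
      assert (0 <= amp x * - dOm x) by (apply Rmult_le_pos; lra).
      assert (0 <= c * (amp x * - dOm x)) by (apply Rmult_le_pos; lra).
      lra.
  - apply is_lim_0_scal.
    apply is_lim_le_le_loc with (f := fun _ => 0) (g := fun y => amp x0 * Om y).
    + exists x0; intros y Hy; specialize (HO y ltac:(lra)).
      pose proof (amp_ge_1 y); pose proof (amp_decr x0 y ltac:(lra)); nra.
    + apply is_lim_const.
    + now apply is_lim_0_scal.
Qed.

Lemma contC_u : contC (fun x => RtoC (u x)).
Proof. now apply contC_RtoC. Qed.

Lemma contC_lam_u : contC (fun x => RtoC (lambda * u x)).
Proof.
  apply contC_ext with (fun x => RtoC lambda * RtoC (u x))%C.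
  - intros x; now rewrite RtoC_mult.
  - apply contC_mult; [apply contC_const | apply contC_u].
Qed.

Fixpoint picard (k : C) (w : R -> C) (p : nat) : (R -> C) * (R -> C) :=
  match p with
  | O => (fun _ => RtoC 0, fun _ => RtoC 0)
  | S q =>
      (green k (fun x => w x - RtoC (u x) * snd (picard k w q) x)%C,
       green (RtoC 0) (fun x => - (RtoC (lambda * u x) * fst (picard k w q) x))%C)
  end.

Definition solve (k : C) (w : R -> C) : (R -> C) * (R -> C) :=
  (fun x => Clim (fun p => fst (picard k w p) x),
   fun x => Clim (fun p => snd (picard k w p) x)).

Lemma Cmod_lam_u (x : R) (z : C) :
  Cmod (- (RtoC (lambda * u x) * z)) <= Rabs (u x) * Cmod z.
Proof.
  rewrite Cmod_opp, Cmod_mult, Cmod_R, Rabs_mult.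
  apply Rmult_le_compat_r; [apply Cmod_ge_0|].
  generalize (Rabs_pos (u x)) (Rabs_pos lambda); nra.
Qed.

Lemma Im_0_le : Im (RtoC 0) <= 0.
Proof. unfold Im, RtoC; simpl; lra. Qed.

(** The gain of a factor 2 is that of [majorant_amp]. *)
Lemma green_step (k : C) (w F G : R -> C) (Om : R -> R) (x0 c : R) :
  Im k <= 0 -> 0 <= c -> contC w -> majorant x0 w Om ->
  contC F -> contC G ->
  (forall x, x0 <= x -> Cmod (F x) <= 2 * c * (amp x * Om x)) ->
  (forall x, x0 <= x -> Cmod (G x) <= 2 * c * (amp x * Om x)) ->
  let F' := green k (fun x => w x - RtoC (u x) * G x)%C in
  let G' := green (RtoC 0) (fun x => - (RtoC (lambda * u x) * F x))%C in
  (forall x, derivC F' x (2 * Ci * k * F' x - (w x - RtoC (u x) * G x))%C) /\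
  (forall x, derivC G' x (2 * Ci * RtoC 0 * G' x - - (RtoC (lambda * u x) * F x))%C) /\
  vanish F' /\ vanish G' /\
  (forall x, x0 <= x -> Cmod (F' x) <= Om x + c * (amp x * Om x)) /\
  (forall x, x0 <= x -> Cmod (G' x) <= c * (amp x * Om x)).
Proof.
  intros Hk Hc Cw HM CF CG BF BG F' G'.
  assert (M1 : majorant x0 (fun x => w x - RtoC (u x) * G x)%C
                 (fun x => Om x + c * (amp x * Om x))).
  { apply majorant_plus; [exact HM|].
    apply majorant_amp with w; [exact Hc | | exact HM].
    intros x Hx; rewrite Cmod_opp, Cmod_mult, Cmod_R.
    generalize (Rabs_pos (u x)) (BG x Hx); nra. }
  assert (M2 : majorant x0 (fun x => - (RtoC (lambda * u x) * F x))%C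
                 (fun x => c * (amp x * Om x))).
  { apply majorant_amp with w; [exact Hc | | exact HM].
    intros x Hx; eapply Rle_trans; [apply Cmod_lam_u|].
    generalize (Rabs_pos (u x)) (BF x Hx); nra. }
  destruct (fun C0 => green_spec k _ _ x0 Hk C0 M1) as [D1 V1].
  { apply contC_minus; [exact Cw|]; apply contC_mult; [apply contC_u | exact CG]. }
  destruct (fun C0 => green_spec (RtoC 0) _ _ x0 Im_0_le C0 M2) as [D2 V2].
  { apply contC_opp, contC_mult; [apply contC_lam_u | exact CF]. }
  split; [exact D1|]; split; [exact D2|]; split; [exact V1|]; split; [exact V2|].
  split.
  - exact (green_bound k _ _ _ x0 Hk (fun x _ => D1 x) V1 M1).
  - exact (green_bound (RtoC 0) _ _ _ x0 Im_0_le (fun x _ => D2 x) V2 M2).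
Qed.

Lemma majorant_tick (x0 x : R) (w : R -> C) (Om : R -> R) :
  majorant x0 w Om -> x0 <= x -> 0 <= Om x <= amp x * Om x.
Proof.
  intros HM Hx; pose proof (majorant_nonneg _ _ _ HM x Hx).
  pose proof (amp_ge_1 x); split; [assumption | nra].
Qed.

Lemma picard_bound (k : C) (w : R -> C) (Om : R -> R) (x0 : R) (p : nat) :
  Im k <= 0 -> contC w -> majorant x0 w Om ->
  contC (fst (picard k w p)) /\ contC (snd (picard k w p)) /\
  (forall x, x0 <= x -> Cmod (fst (picard k w p) x) <= 2 * 1 * (amp x * Om x)) /\
  (forall x, x0 <= x -> Cmod (snd (picard k w p) x) <= 2 * 1 * (amp x * Om x)).
Proof.
  intros Hk Cw HM; induction p as [|p IH].
  - repeat split; try apply contC_const; simpl; intros x Hx; rewrite Cmod_0;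
      pose proof (majorant_tick _ _ _ _ HM Hx); lra.
  - destruct IH as [CF [CG [BF BG]]].
    destruct (green_step k w _ _ Om x0 1 Hk Rle_0_1 Cw HM CF CG BF BG)
      as [D1 [D2 [_ [_ [B1 B2]]]]].
    split; [exact (derivC_contC _ _ D1)|]; split; [exact (derivC_contC _ _ D2)|].
    split; intros x Hx; [specialize (B1 x Hx) | specialize (B2 x Hx)];
      simpl; pose proof (majorant_tick _ _ _ _ HM Hx); lra.
Qed.

Lemma picard_step (k : C) (w : R -> C) (Om : R -> R) (x0 : R) (p : nat) :
  Im k <= 0 -> contC w -> majorant x0 w Om ->
  let F := fst (picard k w p) in let G := snd (picard k w p) in
  let F' := fst (picard k w (S p)) in let G' := snd (picard k w (S p)) in
  (forall x, derivC F' x (2 * Ci * k * F' x - (w x - RtoC (u x) * G x))%C) /\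
  (forall x, derivC G' x (2 * Ci * RtoC 0 * G' x - - (RtoC (lambda * u x) * F x))%C) /\
  vanish F' /\ vanish G'.
Proof.
  intros Hk Cw HM.
  destruct (picard_bound k w Om x0 p Hk Cw HM) as [CF [CG [BF BG]]].
  destruct (green_step k w _ _ Om x0 1 Hk Rle_0_1 Cw HM CF CG BF BG)
      as [D1 [D2 [V1 [V2 _]]]].
  exact (conj D1 (conj D2 (conj V1 V2))).
Qed.

(** Stated for a coefficient [s] dominated by [u] in order to serve both for the
    first equation, where it is [u], and for the second one, where [k = 0] and it
    is [lambda u]. *)
Lemma contraction (k : C) (w F G1 G2 F1 F2 : R -> C) (Om : R -> R) (x0 c : R)
  (s : R -> R) :
  Im k <= 0 -> 0 <= c -> majorant x0 w Om ->
  (forall x, Rabs (s x) <= Rabs (u x)) ->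
  (forall x, x0 <= x -> derivC F1 x (2 * Ci * k * F1 x - (F x - RtoC (s x) * G1 x))%C) ->
  (forall x, x0 <= x -> derivC F2 x (2 * Ci * k * F2 x - (F x - RtoC (s x) * G2 x))%C) ->
  vanish F1 -> vanish F2 ->
  (forall x, x0 <= x -> Cmod (G1 x - G2 x) <= 2 * c * (amp x * Om x)) ->
  forall x, x0 <= x -> Cmod (F1 x - F2 x) <= c * (amp x * Om x).
Proof.
  intros Hk Hc HM Hs D1 D2 V1 V2 HG.
  apply green_bound with (k := k) (h := fun x => (- (RtoC (s x) * (G1 x - G2 x)))%C)
    (f := fun x => (F1 x - F2 x)%C) (Om := fun x => c * (amp x * Om x)).
  - exact Hk.
  - intros x Hx; eapply derivC_eq.
    + exact (derivC_minus _ _ _ _ _ (D1 x Hx) (D2 x Hx)).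
    + ring.
  - now apply vanish_minus.
  - apply majorant_amp with w; [exact Hc | | exact HM].
    intros x Hx; rewrite Cmod_opp, Cmod_mult, Cmod_R.
    generalize (Rabs_pos (s x)) (Hs x) (HG x Hx) (Cmod_ge_0 (G1 x - G2 x)).
    pose proof (majorant_tick _ _ _ _ HM Hx).
    intros; apply Rle_trans with (Rabs (u x) * (2 * c * (amp x * Om x))); [|lra].
    apply Rmult_le_compat; lra.
Qed.

Lemma derivC_lam (g f : R -> C) (x : R) :
  derivC g x (2 * Ci * RtoC 0 * g x - - (RtoC (lambda * u x) * f x))%C ->
  derivC g x (2 * Ci * RtoC 0 * g x - (RtoC 0 - RtoC (lambda * u x) * f x))%C.
Proof. intros H; eapply derivC_eq; [exact H | ring]. Qed.

Lemma lam_u_le (x : R) : Rabs (lambda * u x) <= Rabs (u x).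
Proof.
  rewrite Rabs_mult; generalize (Rabs_pos (u x)) (Rabs_pos lambda); nra.
Qed.

Lemma picard_increment (k : C) (w : R -> C) (Om : R -> R) (x0 : R) (p : nat) :
  Im k <= 0 -> contC w -> majorant x0 w Om ->
  forall x, x0 <= x ->
  Cmod (fst (picard k w (S p)) x - fst (picard k w p) x) <= 2 * (amp x * Om x) * (/ 2) ^ p /\
  Cmod (snd (picard k w (S p)) x - snd (picard k w p) x) <= 2 * (amp x * Om x) * (/ 2) ^ p.
Proof.
  intros Hk Cw HM; induction p as [|p IH].
  - intros x Hx.
    destruct (picard_bound k w Om x0 1 Hk Cw HM) as [_ [_ [B1 B2]]].
    split; [specialize (B1 x Hx); set (z := fst _ x) in * | specialize (B2 x Hx); set (z := snd _ x) in *];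
      replace (z - _)%C with z by (simpl; ring); simpl pow; lra.
  - destruct (picard_step k w Om x0 p Hk Cw HM) as [D1 [D2 [V1 V2]]].
    destruct (picard_step k w Om x0 (S p) Hk Cw HM) as [D3 [D4 [V3 V4]]].
    assert (Hc : 0 <= (/ 2) ^ p) by apply Rlt_le, half_pow_pos.
    intros x Hx; simpl pow; split.
    + apply Rle_trans with ((/ 2) ^ p * (amp x * Om x)); [|lra].
      apply contraction with (k := k) (w := w) (F := w) (s := u)
        (G1 := snd (picard k w (S p))) (G2 := snd (picard k w p)) (x0 := x0); auto.
      * intros; apply Rle_refl.
      * intros y Hy; destruct (IH y Hy) as [_ H]; lra.
    + apply Rle_trans with ((/ 2) ^ p * (amp x * Om x)); [|lra].
      apply contraction with (k := RtoC 0) (w := w) (F := fun _ => RtoC 0)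
        (s := fun x => lambda * u x)
        (G1 := fst (picard k w (S p))) (G2 := fst (picard k w p)) (x0 := x0); auto.
      * apply Im_0_le.
      * apply lam_u_le.
      * intros y Hy; apply derivC_lam, D4.
      * intros y Hy; apply derivC_lam, D2.
      * intros y Hy; destruct (IH y Hy) as [H _]; lra.
Qed.

(** The limit of the iterates is continuous, hence the operators apply to it; by
    contraction their result is again at distance [O(2^-p)] from the iterates,
    so it is the limit itself, which is therefore differentiable. *)
Lemma solve_spec (k : C) (w : R -> C) (Om : R -> R) :
  Im k <= 0 -> contC w -> (forall x0, majorant x0 w Om) ->
  sol k w (fst (solve k w)) (snd (solve k w)) /\
  (forall x, Cmod (fst (solve k w) x) <= 4 * amp x * Om x) /\
  (forall x, Cmod (snd (solve k w) x) <= 4 * amp x * Om x).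
Proof.
  intros Hk Cw HM.
  set (F := fst (solve k w)); set (G := snd (solve k w)).
  set (K := fun x => 4 * (amp x * Om x)).
  assert (HK : forall x, 0 <= Om x <= amp x * Om x)
    by (intros x; apply majorant_tick with x w; [apply HM | apply Rle_refl]).
  assert (AF : forall p x, Cmod (F x - fst (picard k w p) x) <= K x * (/ 2) ^ p).
  { intros p x; unfold K; replace (4 * (amp x * Om x)) with (2 * (2 * (amp x * Om x))) by ring.
    apply (Clim_geometric (fun p => fst (picard k w p) x)).
    - specialize (HK x); lra.
    - intros q; now apply picard_increment with (x0 := x); [| | |apply Rle_refl]. }
  assert (AG : forall p x, Cmod (G x - snd (picard k w p) x) <= K x * (/ 2) ^ p).
  { intros p x; unfold K; replace (4 * (amp x * Om x)) with (2 * (2 * (amp x * Om x))) by ring.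
    apply (Clim_geometric (fun p => snd (picard k w p) x)).
    - specialize (HK x); lra.
    - intros q; now apply picard_increment with (x0 := x); [| | |apply Rle_refl]. }
  assert (BF : forall x, Cmod (F x) <= K x).
  { intros x; specialize (AF O x); simpl in AF.
    replace (F x - 0)%C with (F x) in AF by ring; lra. }
  assert (BG : forall x, Cmod (G x) <= K x).
  { intros x; specialize (AG O x); simpl in AG.
    replace (G x - 0)%C with (G x) in AG by ring; lra. }
  assert (DK : forall x y, x <= y -> K y <= K x).
  { intros x y L; unfold K.
    pose proof (majorant_decr x w Om (HM x) x y (Rle_refl x) L).
    pose proof (amp_decr x y L); pose proof (amp_ge_1 y).
    pose proof (HK x); pose proof (HK y).
    enough (amp y * Om y <= amp x * Om x) by lra.
    apply Rmult_le_compat; lra. }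
  assert (CF : contC F).
  { apply contC_limit with (2 := DK) (3 := AF).
    intros p; apply (picard_bound k w Om 0 p Hk Cw (HM 0)). }
  assert (CG : contC G).
  { apply contC_limit with (2 := DK) (3 := AG).
    intros p; apply (picard_bound k w Om 0 p Hk Cw (HM 0)). }
  assert (BF' : forall x, 0 <= x -> Cmod (F x) <= 2 * 2 * (amp x * Om x))
    by (intros x _; specialize (BF x); unfold K in BF; lra).
  assert (BG' : forall x, 0 <= x -> Cmod (G x) <= 2 * 2 * (amp x * Om x))
    by (intros x _; specialize (BG x); unfold K in BG; lra).
  destruct (green_step k w F G Om 0 2 Hk ltac:(lra) Cw (HM 0) CF CG BF' BG')
    as [D1 [D2 [V1 [V2 _]]]].
  set (F' := green k _) in *; set (G' := green (RtoC 0) _) in *.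
  assert (half : forall p, 0 <= 2 * (/ 2) ^ p)
    by (intros p; pose proof (half_pow_pos p); lra).
  assert (EF : forall x, F' x = F x).
  { intros x; enough (Cmod (F' x - F x) <= 0) as H.
    { assert (F' x - F x = 0)%C as E
        by (apply Cmod_eq_0; generalize (Cmod_ge_0 (F' x - F x)); lra).
      replace (F' x) with (F' x - F x + F x)%C by ring; rewrite E; ring. }
    apply le_of_half_pow with (c := K x); intros p.
    destruct (picard_step k w Om 0 p Hk Cw (HM 0)) as [D3 [D4 [V3 V4]]].
    assert (H := contraction k w w G (snd (picard k w p)) F' (fst (picard k w (S p)))
       Om x (2 * (/ 2) ^ p) u Hk (half p) (HM x) (fun _ => Rle_refl _)
       (fun y _ => D1 y) (fun y _ => D3 y) V1 V3).
    specialize (H ltac:(intros y _; eapply Rle_trans;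
      [apply AG | unfold K; apply Req_le; ring]) x (Rle_refl x)).
    pose proof (AF (S p) x) as H'; rewrite Cmod_minus_sym in H'; simpl pow in H'.
    replace (F' x - F x)%C with ((F' x - fst (picard k w (S p)) x) +
      (fst (picard k w (S p)) x - F x))%C by ring.
    eapply Rle_trans; [apply Cmod_triangle|]; unfold K in *; lra. }
  assert (EG : forall x, G' x = G x).
  { intros x; enough (Cmod (G' x - G x) <= 0) as H.
    { assert (G' x - G x = 0)%C as E
        by (apply Cmod_eq_0; generalize (Cmod_ge_0 (G' x - G x)); lra).
      replace (G' x) with (G' x - G x + G x)%C by ring; rewrite E; ring. }
    apply le_of_half_pow with (c := K x); intros p.
    destruct (picard_step k w Om 0 p Hk Cw (HM 0)) as [D3 [D4 [V3 V4]]].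
    assert (H := contraction (RtoC 0) w (fun _ => RtoC 0) F (fst (picard k w p)) G' (snd (picard k w (S p)))
       Om x (2 * (/ 2) ^ p) (fun x => lambda * u x) Im_0_le (half p) (HM x) lam_u_le
       (fun y _ => derivC_lam _ _ _ (D2 y)) (fun y _ => derivC_lam _ _ _ (D4 y)) V2 V4).
    specialize (H ltac:(intros y _; eapply Rle_trans;
      [apply AF | unfold K; apply Req_le; ring]) x (Rle_refl x)).
    pose proof (AG (S p) x) as H'; rewrite Cmod_minus_sym in H'; simpl pow in H'.
    replace (G' x - G x)%C with ((G' x - snd (picard k w (S p)) x) +
      (snd (picard k w (S p)) x - G x))%C by ring.
    eapply Rle_trans; [apply Cmod_triangle|]; unfold K in *; lra. }
  split; [|split; intros x; [specialize (BF x) | specialize (BG x)]; unfold K in *; lra].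
  split; [intros x|split; [intros x|split]].
  - apply derivC_ext with (1 := EF).
    eapply derivC_eq; [apply D1 | rewrite EF; ring].
  - apply derivC_ext with (1 := EG).
    eapply derivC_eq; [apply D2 | ring].
  - now apply vanish_ext with (1 := EF).
  - now apply vanish_ext with (1 := EG).
Qed.

End System.

(** * Uniqueness and linearity *)

Section Jets.

Context (lambda : R) (u mu : R -> R).
Context (Hlam : Rabs lambda <= 1)
        (Hu : forall x, continuous u x)
        (Hmu : forall x, is_derive mu x (- Rabs (u x)))
        (Hmu0 : is_lim mu p_infty 0).

Local Notation sol := (sol lambda u).
Local Notation solve := (solve lambda u).
Local Notation amp := (amp mu).

Lemma is_lim_0_sqr (f : R -> R) :
  is_lim f p_infty 0 -> is_lim (fun x => f x ^ 2) p_infty 0.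
Proof.
  intros H; apply is_lim_ext with (fun x => f x * f x); [intros; ring|].
  replace (Finite 0) with (Rbar_mult 0 0) by (simpl; f_equal; ring).
  apply is_lim_mult; [exact H | exact H | exact I].
Qed.

(** [|f|^2 + |g|^2] may only decrease at relative rate [2|u|], because the term
    [2ik f] pushes [|f|] up when [Im k <= 0]. After correction by the integrable
    factor [exp (-2 mu)] it is nondecreasing, nonnegative and has limit 0. *)
Lemma system_zero (k : C) (f g : R -> C) (x0 : R) :
  Im k <= 0 ->
  (forall x, x0 <= x -> derivC f x (2 * Ci * k * f x + RtoC (u x) * g x)%C) ->
  (forall x, x0 <= x -> derivC g x (RtoC (lambda * u x) * f x)%C) ->
  vanish f -> vanish g ->
  forall x, x0 <= x -> f x = RtoC 0 /\ g x = RtoC 0.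
Proof.
  intros Hk Df Dg Vf Vg x Hx.
  set (N := fun t => Re (f t) ^ 2 + Im (f t) ^ 2 + (Re (g t) ^ 2 + Im (g t) ^ 2)).
  assert (EN : forall t, N t = Cmod (f t) ^ 2 + Cmod (g t) ^ 2)
    by (intros t; unfold N; now rewrite !Cmod2_alt).
  set (E := fun t => exp (- 2 * mu t)).
  set (dN := fun t => - 4 * Im k * (Re (f t) ^ 2 + Im (f t) ^ 2) +
    2 * (1 + lambda) * u t * (Re (f t) * Re (g t) + Im (f t) * Im (g t))).
  assert (DN : forall t, x0 <= t -> is_derive N t (dN t)).
  { intros t Ht; destruct (Df t Ht) as [F1 F2], (Dg t Ht) as [G1 G2].
    eapply is_derive_eq.
    - exact (is_derive_plus _ _ _ _ _
               (is_derive_plus _ _ _ _ _ (is_derive_sqr _ _ _ F1) (is_derive_sqr _ _ _ F2))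
               (is_derive_plus _ _ _ _ _ (is_derive_sqr _ _ _ G1) (is_derive_sqr _ _ _ G2))).
    - unfold dN, plus; simpl; unfold Re, Im, Ci, RtoC, Cmult, Cplus; simpl; ring. }
  assert (HN : forall t, Rabs (dN t + 4 * Im k * (Re (f t) ^ 2 + Im (f t) ^ 2)) <= 2 * Rabs (u t) * N t).
  { intros t.
    replace (dN t + _) with ((1 + lambda) * (u t * (2 * (Re (f t) * Re (g t) + Im (f t) * Im (g t)))))
      by (unfold dN; ring).
    rewrite !Rabs_mult, (Rabs_pos_eq 2) by lra.
    assert (A1 : Rabs (1 + lambda) <= 2)
      by (eapply Rle_trans; [apply Rabs_triang|]; rewrite Rabs_R1; lra).
    assert (A2 : 2 * Rabs (Re (f t) * Re (g t) + Im (f t) * Im (g t)) <= N t).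
    { unfold N; set (a := Re (f t)); set (b := Im (f t)); set (c := Re (g t)); set (d := Im (g t)).
      pose proof (pow2_ge_0 (a - c)); pose proof (pow2_ge_0 (a + c)).
      pose proof (pow2_ge_0 (b - d)); pose proof (pow2_ge_0 (b + d)).
      assert (Rabs (a * c + b * d) <= (a ^ 2 + b ^ 2 + (c ^ 2 + d ^ 2)) / 2); [|lra].
      apply Rabs_le; lra. }
    pose proof (Rabs_pos (1 + lambda)); pose proof (Rabs_pos (u t)).
    set (S := Rabs (Re (f t) * Re (g t) + Im (f t) * Im (g t))) in *.
    assert (0 <= S) by apply Rabs_pos.
    apply Rle_trans with (2 * (Rabs (u t) * (2 * S))); [|nra].
    apply Rmult_le_compat_r; [|exact A1].
    apply Rmult_le_pos; lra. }
  assert (HE : forall t, 0 < E t <= 1).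
  { intros t; unfold E; split; [apply exp_pos|].
    rewrite <- exp_0; apply exp_monotone.
    pose proof (mu_nonneg u mu Hmu Hmu0 t); lra. }
  assert (DE : forall t, is_derive E t (2 * Rabs (u t) * E t)).
  { intros t; eapply is_derive_eq.
    - apply (is_derive_comp exp (fun t => -2 * mu t)).
      + apply is_derive_Reals, derivable_pt_lim_exp.
      + apply (is_derive_scal mu t (-2)), Hmu.
    - unfold E, scal; simpl; unfold mult; simpl; ring. }
  assert (HNx : N x * E x <= 0).
  { apply le_of_lim_0 with (x0 := x) (e := N).
    - intros y Hy.
      enough (- (N y * E y) <= - (N x * E x)).
      { pose proof (HE y).
        assert (0 <= N y) by (rewrite EN; pose proof (pow2_ge_0 (Cmod (f y)));
          pose proof (pow2_ge_0 (Cmod (g y))); lra).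
        nra. }
      apply nonincreasing with (phi := fun t => - (N t * E t))
        (dphi := fun t => - (dN t * E t + N t * (2 * Rabs (u t) * E t))); [exact Hy| |].
      + intros t Ht.
        apply (is_derive_opp (fun t => N t * E t)).
        apply is_derive_Rmult; [apply DN; lra | apply DE].
      + intros t Ht; specialize (HN t); apply Rabs_le_between in HN.
        pose proof (HE t); pose proof (pow2_ge_0 (Re (f t))); pose proof (pow2_ge_0 (Im (f t))).
        assert (0 <= dN t + 2 * Rabs (u t) * N t) by nra.
        nra.
    - apply is_lim_ext with (1 := fun t => eq_sym (EN t)).
      apply is_lim_0_plus; now apply is_lim_0_sqr. }
  assert (HN0 : N x <= 0) by (pose proof (HE x); nra).
  rewrite EN in HN0.
  pose proof (Cmod_ge_0 (f x)); pose proof (Cmod_ge_0 (g x)).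
  split; apply Cmod_eq_0; nra.
Qed.

Lemma sol_ext (k : C) (w w' f g : R -> C) :
  (forall x, w x = w' x) -> sol k w f g -> sol k w' f g.
Proof.
  intros E [D1 H]; split; [|exact H].
  intros x; rewrite <- E; apply D1.
Qed.

Lemma sol_minus (k : C) (w1 f1 g1 w2 f2 g2 : R -> C) :
  sol k w1 f1 g1 -> sol k w2 f2 g2 ->
  sol k (fun x => w1 x - w2 x)%C (fun x => f1 x - f2 x)%C (fun x => g1 x - g2 x)%C.
Proof.
  intros [D1 [E1 [V1 U1]]] [D2 [E2 [V2 U2]]].
  split; [|split; [|split; now apply vanish_minus]]; intros x; eapply derivC_eq.
  - exact (derivC_minus _ _ _ _ _ (D1 x) (D2 x)).
  - ring.
  - exact (derivC_minus _ _ _ _ _ (E1 x) (E2 x)).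
  - ring.
Qed.

Lemma sol_plus (k : C) (w1 f1 g1 w2 f2 g2 : R -> C) :
  sol k w1 f1 g1 -> sol k w2 f2 g2 ->
  sol k (fun x => w1 x + w2 x)%C (fun x => f1 x + f2 x)%C (fun x => g1 x + g2 x)%C.
Proof.
  intros [D1 [E1 [V1 U1]]] [D2 [E2 [V2 U2]]].
  split; [|split; [|split; now apply vanish_plus]]; intros x; eapply derivC_eq.
  - exact (derivC_plus _ _ _ _ _ (D1 x) (D2 x)).
  - ring.
  - exact (derivC_plus _ _ _ _ _ (E1 x) (E2 x)).
  - ring.
Qed.

Lemma sol_scal (k c : C) (w f g : R -> C) :
  sol k w f g ->
  sol k (fun x => c * w x)%C (fun x => c * f x)%C (fun x => c * g x)%C.
Proof.
  intros [D1 [E1 [V1 U1]]].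
  split; [|split; [|split; now apply vanish_scal]]; intros x; eapply derivC_eq.
  - exact (derivC_scal c _ _ _ (D1 x)).
  - ring.
  - exact (derivC_scal c _ _ _ (E1 x)).
  - ring.
Qed.

Lemma sol_unique (k : C) (w f1 g1 f2 g2 : R -> C) :
  Im k <= 0 -> sol k w f1 g1 -> sol k w f2 g2 ->
  forall x, f1 x = f2 x /\ g1 x = g2 x.
Proof.
  intros Hk S1 S2 x.
  destruct (sol_minus _ _ _ _ _ _ _ S1 S2) as [D [E [V U]]].
  destruct (system_zero k (fun x => f1 x - f2 x)%C (fun x => g1 x - g2 x)%C x) with x
    as [A B]; try assumption.
  - intros y _; eapply derivC_eq; [apply D | ring].
  - intros y _; apply E.
  - apply Rle_refl.
  - split; [replace (f1 x) with (f1 x - f2 x + f2 x)%C by ring; rewrite A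
           |replace (g1 x) with (g1 x - g2 x + g2 x)%C by ring; rewrite B]; ring.
Qed.

(** * Chains of iterated tails *)

(** [W l] stands for the integral of [(y - x)^(l-1) / (l-1)! W_0(y)] over
    [y >= x]: a chain of length [N] encodes [N - 1] finite moments of [W O] in a
    form that survives multiplication by decreasing factors. *)
Definition chain (N : nat) (W : nat -> R -> R) : Prop :=
  (forall x, 0 <= W O x) /\
  forall l, (l < N)%nat ->
    (forall x, is_derive (W (S l)) x (- W l x)) /\ is_lim (W (S l)) p_infty 0.

Lemma chain_nonneg (N : nat) (W : nat -> R -> R) :
  chain N W -> forall l x, (l <= N)%nat -> 0 <= W l x.
Proof.
  intros [H0 H] l; induction l as [|l IH]; intros x Hl; [apply H0|].
  destruct (H l Hl) as [D L].
  apply nonneg_of_decreasing_to_0 with (fun x => - W l x) x;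
    [intros; apply D | | exact L | apply Rle_refl].
  intros t _; specialize (IH t ltac:(lia)); lra.
Qed.

Definition bigamp (x : R) : R := 4 * amp x.

Lemma bigamp_ge_1 (x : R) : 1 <= bigamp x.
Proof. unfold bigamp; pose proof (amp_ge_1 u mu Hmu Hmu0 x); lra. Qed.

Lemma bigamp_pow_pos (j : nat) (x : R) : 0 < bigamp x ^ j.
Proof. apply pow_lt; pose proof (bigamp_ge_1 x); lra. Qed.

Lemma bigamp_pow_decr (j : nat) (x y : R) : x <= y -> bigamp y ^ j <= bigamp x ^ j.
Proof.
  intros L; apply pow_incr; pose proof (bigamp_ge_1 y); split; [lra|].
  unfold bigamp; pose proof (amp_decr u mu Hmu x y L); lra.
Qed.

Lemma is_derive_bigamp_pow (j : nat) (x : R) :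
  is_derive (fun t => bigamp t ^ j) x (- (2 * INR j * Rabs (u x)) * bigamp x ^ j).
Proof.
  eapply is_derive_eq.
  - apply (is_derive_pow bigamp j x).
    apply (is_derive_scal amp x 4), is_derive_amp, Hmu.
  - destruct j as [|j]; [simpl; ring|].
    replace (pred (S j)) with j by reflexivity.
    unfold bigamp; rewrite <- (tech_pow_Rmult _ j); ring.
Qed.

Lemma chain_majorant (w : R -> C) (N q j : nat) (W : nat -> R -> R) (c : R) :
  0 <= c -> chain N W -> (q < N)%nat ->
  (forall x, Cmod (w x) <= c * (bigamp x ^ j * W q x)) ->
  forall x0, majorant x0 w (fun x => c * (bigamp x ^ j * W (S q) x)).
Proof.
  intros Hc HW Hq Hw x0.
  pose proof (chain_nonneg N W HW) as W0.
  destruct HW as [_ HW]; destruct (HW q Hq) as [D L]; clear HW.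
  split.
  - exists (fun x => c * (- (2 * INR j * Rabs (u x)) * bigamp x ^ j * W (S q) x
                          + bigamp x ^ j * - W q x)).
    intros x _; split.
    + apply (is_derive_scal (fun x => bigamp x ^ j * W (S q) x)).
      apply (is_derive_Rmult (fun x => bigamp x ^ j)); [apply is_derive_bigamp_pow | apply D].
    + eapply Rle_trans; [apply Hw|].
      pose proof (bigamp_pow_pos j x); pose proof (W0 (S q) x Hq).
      pose proof (pos_INR j); pose proof (Rabs_pos (u x)).
      assert (0 <= c * (2 * INR j * Rabs (u x) * (bigamp x ^ j * W (S q) x)))
        by (repeat apply Rmult_le_pos; lra).
      lra.
  - apply is_lim_0_scal.
    apply is_lim_le_le_loc with (f := fun _ => 0)
      (g := fun y => bigamp 0 ^ j * W (S q) y).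
    + exists 0; intros y Hy; pose proof (W0 (S q) y Hq).
      pose proof (bigamp_pow_pos j y).
      pose proof (bigamp_pow_decr j 0 y ltac:(lra)); nra.
    + apply is_lim_const.
    + now apply is_lim_0_scal.
Qed.

Lemma sol_exists_chain (k : C) (w : R -> C) (N q j : nat) (W : nat -> R -> R) (c : R) :
  Im k <= 0 -> contC w -> 0 <= c -> chain N W -> (q < N)%nat ->
  (forall x, Cmod (w x) <= c * (bigamp x ^ j * W q x)) ->
  sol k w (fst (solve k w)) (snd (solve k w)).
Proof.
  intros Hk Cw Hc HW Hq Hw.
  apply (solve_spec lambda u mu Hlam Hu Hmu Hmu0 k w _ Hk Cw
    (chain_majorant w N q j W c Hc HW Hq Hw)).
Qed.

(** Each resolution of the system costs one tail and one factor [bigamp], with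
    constants that do not depend on [k]. *)
Lemma sol_bound_chain (k : C) (w f g : R -> C) (N q j : nat) (W : nat -> R -> R) (c : R) :
  Im k <= 0 -> contC w -> 0 <= c -> chain N W -> (q < N)%nat ->
  (forall x, Cmod (w x) <= c * (bigamp x ^ j * W q x)) ->
  sol k w f g ->
  forall x, Cmod (f x) <= c * (bigamp x ^ S j * W (S q) x) /\
            Cmod (g x) <= c * (bigamp x ^ S j * W (S q) x).
Proof.
  intros Hk Cw Hc HW Hq Hw Hs x.
  destruct (solve_spec lambda u mu Hlam Hu Hmu Hmu0 k w _ Hk Cw
    (chain_majorant w N q j W c Hc HW Hq Hw)) as [S1 [B1 B2]].
  destruct (sol_unique k w _ _ _ _ Hk Hs S1 x) as [-> ->].
  specialize (B1 x); specialize (B2 x).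
  replace (bigamp x ^ S j) with (4 * amp x * bigamp x ^ j) by reflexivity.
  split; lra.
Qed.

(** * Derivatives of the solution in the spectral parameter *)

(** Differentiating [f' = 2ik f - w + u g] [j] times in [k] gives the same system
    for the [j]-th derivatives, with the source [- 2ij] times the derivative of
    [f] of order [j - 1]. *)
Fixpoint jet (k : C) (w : R -> C) (j : nat) : (R -> C) * (R -> C) :=
  match j with
  | O => solve k w
  | S i => solve k (fun x => - (2 * Ci * RtoC (INR (S i)) * fst (jet k w i) x))%C
  end.

Fixpoint ladder_const (e : nat -> R) (j : nat) : R :=
  match j with
  | O => e O
  | S i => e (S i) + 2 * INR (S i) * ladder_const e i
  end.

Lemma ladder_const_nonneg (e : nat -> R) (j : nat) :
  (forall j, 0 <= e j) -> 0 <= ladder_const e j.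
Proof.
  intros He; induction j as [|i IH]; [apply He|].
  cbn [ladder_const]; specialize (He (S i)); pose proof (pos_INR (S i)); nra.
Qed.

Lemma Cmod_2CiINR (j : nat) (z : C) :
  Cmod (2 * Ci * RtoC (INR j) * z) = 2 * INR j * Cmod z.
Proof.
  rewrite !Cmod_mult, Cmod_Ci, !Cmod_R, (Rabs_pos_eq 2), (Rabs_pos_eq (INR j));
    [ring | apply pos_INR | lra].
Qed.

(** The derivatives in [k], their first differences and the remainders of their
    first-order Taylor formulas all solve systems of this triangular form, with
    [p = 0, 1, 2]. *)
Lemma ladder (k : C) (N p J : nat) (W : nat -> R -> R) (d : R)
  (s h g : nat -> R -> C) (e : nat -> R) :
  Im k <= 0 -> 0 <= d -> (forall j, 0 <= e j) -> chain N W -> (J + p < N)%nat ->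
  (forall j, (j <= J)%nat -> contC (s j)) ->
  (forall j x, (j <= J)%nat ->
     Cmod (s j x) <= e j * d * (bigamp x ^ (j + p) * W (j + p)%nat x)) ->
  (forall j, (j <= J)%nat ->
     sol k (fun x => s j x - 2 * Ci * RtoC (INR j) * h (pred j) x)%C (h j) (g j)) ->
  forall j x, (j <= J)%nat ->
    Cmod (h j x) <= ladder_const e j * d * (bigamp x ^ S (j + p) * W (S (j + p)) x) /\
    Cmod (g j x) <= ladder_const e j * d * (bigamp x ^ S (j + p) * W (S (j + p)) x).
Proof.
  intros Hk Hd He HW HN Cs Bs Hs j.
  induction j as [|i IH]; intros x Hj.
  - apply sol_bound_chain with (4 := HW) (7 := Hs O Hj); try assumption.
    + apply contC_ext with (2 := Cs O Hj); intros y; simpl INR; ring.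
    + simpl; specialize (He O); nra.
    + simpl; lia.
    + intros y; replace (s O y - _)%C with (s O y) by (simpl INR; ring).
      apply Bs, Hj.
  - assert (Ch : contC (h i))
      by (destruct (Hs i ltac:(lia)) as [D _]; exact (derivC_contC _ _ D)).
    apply sol_bound_chain with (4 := HW) (7 := Hs (S i) Hj); try assumption.
    + apply contC_minus; [now apply Cs|].
      apply contC_mult; [apply contC_const | exact Ch].
    + apply Rmult_le_pos; [now apply ladder_const_nonneg | exact Hd].
    + lia.
    + intros y; unfold Cminus.
      eapply Rle_trans; [apply Cmod_triangle|]; rewrite Cmod_opp, Cmod_2CiINR.
      pose proof (Bs (S i) y Hj) as B1; destruct (IH y ltac:(lia)) as [B2 _].
      change (S i + p)%nat with (S (i + p)) in *; simpl pred; cbn [ladder_const].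
      pose proof (pos_INR (S i)).
      apply (Rmult_le_compat_l (2 * INR (S i))) in B2; [|lra].
      lra.
Qed.

Definition source (w : R -> C) (j : nat) : R -> C :=
  match j with O => w | S _ => fun _ => RtoC 0 end.

Definition jet_const : nat -> R :=
  ladder_const (fun j => match j with O => 1 | S _ => 0 end).

Lemma jet_const_nonneg (j : nat) : 0 <= jet_const j.
Proof. apply ladder_const_nonneg; intros [|i]; lra. Qed.

Lemma jet_spec (k : C) (w : R -> C) (N : nat) (W : nat -> R -> R) :
  Im k <= 0 -> contC w -> chain N W -> (forall x, Cmod (w x) <= W O x) ->
  forall j, (j < N)%nat ->
    sol k (fun x => source w j x - 2 * Ci * RtoC (INR j) * fst (jet k w (pred j)) x)%C
      (fst (jet k w j)) (snd (jet k w j)) /\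
    forall x, Cmod (fst (jet k w j) x) <= jet_const j * (bigamp x ^ S j * W (S j) x) /\
              Cmod (snd (jet k w j) x) <= jet_const j * (bigamp x ^ S j * W (S j) x).
Proof.
  intros Hk Cw HW Hw j; induction j as [|i IH]; intros Hj.
  - assert (B : forall x, Cmod (w x) <= 1 * (bigamp x ^ 0 * W O x))
      by (intros x; simpl; specialize (Hw x); lra).
    assert (S0 := sol_exists_chain k w N O O W 1 Hk Cw Rle_0_1 HW Hj B).
    split.
    + apply sol_ext with (2 := S0); intros x; simpl INR; simpl source; ring.
    + exact (sol_bound_chain k w _ _ N O O W 1 Hk Cw Rle_0_1 HW Hj B S0).
  - destruct (IH ltac:(lia)) as [Si Bi].
    (* The source of the next derivative is bounded by the next tail. *)
    set (w' := fun x => (- (2 * Ci * RtoC (INR (S i)) * fst (jet k w i) x))%C).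
    assert (Cw' : contC w').
    { apply contC_opp, contC_mult; [apply contC_const|].
      destruct Si as [D _]; exact (derivC_contC _ _ D). }
    assert (Hc : 0 <= jet_const (S i)) by apply jet_const_nonneg.
    assert (B : forall x, Cmod (w' x) <= jet_const (S i) * (bigamp x ^ S i * W (S i) x)).
    { intros x; unfold w'; rewrite Cmod_opp, Cmod_2CiINR.
      destruct (Bi x) as [B _].
      unfold jet_const in *; cbn [ladder_const].
      pose proof (pos_INR (S i)).
      apply (Rmult_le_compat_l (2 * INR (S i))) in B; [|lra].
      lra. }
    assert (S0 := sol_exists_chain k w' N (S i) (S i) W _ Hk Cw' Hc HW Hj B).
    split.
    + apply sol_ext with (2 := S0); intros x; unfold w'; simpl pred; simpl source; ring.
    + exact (sol_bound_chain k w' _ _ N (S i) (S i) W _ Hk Cw' Hc HW Hj B S0).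
Qed.

Lemma jet_contC (k : C) (w : R -> C) (N : nat) (W : nat -> R -> R) :
  Im k <= 0 -> contC w -> chain N W -> (forall x, Cmod (w x) <= W O x) ->
  forall j, (j < N)%nat -> contC (fst (jet k w j)).
Proof.
  intros Hk Cw HW Hw j Hj.
  destruct (jet_spec k w N W Hk Cw HW Hw j Hj) as [[D _] _].
  exact (derivC_contC _ _ D).
Qed.

Lemma jet_plus (k : C) (w1 w2 w : R -> C) (N : nat) (W1 W2 W : nat -> R -> R) :
  Im k <= 0 -> contC w1 -> contC w2 -> contC w -> chain N W1 -> chain N W2 -> chain N W ->
  (forall x, Cmod (w1 x) <= W1 O x) -> (forall x, Cmod (w2 x) <= W2 O x) ->
  (forall x, Cmod (w x) <= W O x) -> (forall x, w x = w1 x + w2 x)%C ->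
  forall j, (j < N)%nat -> forall x,
    fst (jet k w j) x = (fst (jet k w1 j) x + fst (jet k w2 j) x)%C /\
    snd (jet k w j) x = (snd (jet k w1 j) x + snd (jet k w2 j) x)%C.
Proof.
  intros Hk C1 C2 C0 H1 H2 H0 B1 B2 B0 E j; induction j as [|i IH]; intros Hj.
  - destruct (jet_spec k w1 N W1 Hk C1 H1 B1 O Hj) as [S1 _].
    destruct (jet_spec k w2 N W2 Hk C2 H2 B2 O Hj) as [S2 _].
    destruct (jet_spec k w N W Hk C0 H0 B0 O Hj) as [S0 _].
    apply sol_unique with (1 := Hk) (2 := S0).
    apply sol_ext with (2 := sol_plus _ _ _ _ _ _ _ S1 S2).
    intros x; simpl source; simpl INR; rewrite E; ring.
  - destruct (jet_spec k w1 N W1 Hk C1 H1 B1 (S i) Hj) as [S1 _].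
    destruct (jet_spec k w2 N W2 Hk C2 H2 B2 (S i) Hj) as [S2 _].
    destruct (jet_spec k w N W Hk C0 H0 B0 (S i) Hj) as [S0 _].
    apply sol_unique with (1 := Hk) (2 := S0).
    apply sol_ext with (2 := sol_plus _ _ _ _ _ _ _ S1 S2).
    intros x; destruct (IH ltac:(lia) x) as [IH1 _].
    simpl source; simpl pred; rewrite IH1; ring.
Qed.

Definition first_const : nat -> R := ladder_const (fun j => 2 * jet_const j).
Definition second_const : nat -> R := ladder_const (fun j => 2 * first_const j).

Lemma first_const_nonneg (j : nat) : 0 <= first_const j.
Proof.
  apply ladder_const_nonneg; intros i; pose proof (jet_const_nonneg i); lra.
Qed.

(** A resolvent identity: moving [k] to [k'] amounts to one more source,
    proportional to [k' - k]. *)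
Lemma jet_difference_sol (k k' : C) (w : R -> C) (N : nat) (W : nat -> R -> R) :
  Im k <= 0 -> Im k' <= 0 -> contC w -> chain N W -> (forall x, Cmod (w x) <= W O x) ->
  forall j, (j < N)%nat ->
  sol k (fun x => - (2 * Ci * (k' - k) * fst (jet k' w j) x) - 2 * Ci * RtoC (INR j) *
                  (fst (jet k' w (pred j)) x - fst (jet k w (pred j)) x))%C
    (fun x => fst (jet k' w j) x - fst (jet k w j) x)%C
    (fun x => snd (jet k' w j) x - snd (jet k w j) x)%C.
Proof.
  intros Hk Hk' Cw HW Hw j Hj.
  destruct (jet_spec k w N W Hk Cw HW Hw j Hj) as [[D1 [E1 [V1 U1]]] _].
  destruct (jet_spec k' w N W Hk' Cw HW Hw j Hj) as [[D2 [E2 [V2 U2]]] _].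
  split; [|split; [|split; now apply vanish_minus]]; intros x; eapply derivC_eq.
  - exact (derivC_minus _ _ _ _ _ (D2 x) (D1 x)).
  - ring.
  - exact (derivC_minus _ _ _ _ _ (E2 x) (E1 x)).
  - ring.
Qed.

Lemma jet_difference_bound (k k' : C) (w : R -> C) (N : nat) (W : nat -> R -> R) :
  Im k <= 0 -> Im k' <= 0 -> contC w -> chain N W -> (forall x, Cmod (w x) <= W O x) ->
  forall j, (S j < N)%nat -> forall x,
  Cmod (fst (jet k' w j) x - fst (jet k w j) x)
    <= first_const j * Cmod (k' - k) * (bigamp x ^ S (j + 1) * W (S (j + 1)) x) /\
  Cmod (snd (jet k' w j) x - snd (jet k w j) x)
    <= first_const j * Cmod (k' - k) * (bigamp x ^ S (j + 1) * W (S (j + 1)) x).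
Proof.
  intros Hk Hk' Cw HW Hw j Hj x.
  apply ladder with (J := j) (N := N) (k := k)
    (s := fun j x => (- (2 * Ci * (k' - k) * fst (jet k' w j) x))%C)
    (h := fun j x => (fst (jet k' w j) x - fst (jet k w j) x)%C)
    (g := fun j x => (snd (jet k' w j) x - snd (jet k w j) x)%C).
  - exact Hk.
  - apply Cmod_ge_0.
  - intros i; pose proof (jet_const_nonneg i); lra.
  - exact HW.
  - lia.
  - intros i Hi; apply contC_opp, contC_mult; [apply contC_const|].
    apply jet_contC with (3 := HW); auto; lia.
  - intros i y Hi.
    rewrite Cmod_opp, !Cmod_mult, Cmod_Ci, Cmod_R, (Rabs_pos_eq 2) by lra.
    destruct (jet_spec k' w N W Hk' Cw HW Hw i ltac:(lia)) as [_ B].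
    destruct (B y) as [B1 _].
    replace (i + 1)%nat with (S i) by lia.
    pose proof (Cmod_ge_0 (k' - k)).
    apply (Rmult_le_compat_l (2 * Cmod (k' - k))) in B1; [|lra].
    lra.
  - intros i Hi; apply jet_difference_sol with (4 := HW); auto; lia.
  - lia.
Qed.

Lemma jet_second_difference_bound (k k' : C) (w : R -> C) (N : nat) (W : nat -> R -> R) :
  Im k <= 0 -> Im k' <= 0 -> contC w -> chain N W -> (forall x, Cmod (w x) <= W O x) ->
  forall j, (S (S j) < N)%nat -> forall x,
  Cmod (fst (jet k' w j) x - fst (jet k w j) x - (k' - k) * fst (jet k w (S j)) x)
    <= second_const j * Cmod (k' - k) ^ 2 * (bigamp x ^ S (j + 2) * W (S (j + 2)) x) /\
  Cmod (snd (jet k' w j) x - snd (jet k w j) x - (k' - k) * snd (jet k w (S j)) x)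
    <= second_const j * Cmod (k' - k) ^ 2 * (bigamp x ^ S (j + 2) * W (S (j + 2)) x).
Proof.
  intros Hk Hk' Cw HW Hw j Hj x.
  apply ladder with (J := j) (N := N) (k := k)
    (s := fun j x => (- (2 * Ci * (k' - k) * (fst (jet k' w j) x - fst (jet k w j) x)))%C)
    (h := fun j x => (fst (jet k' w j) x - fst (jet k w j) x - (k' - k) * fst (jet k w (S j)) x)%C)
    (g := fun j x => (snd (jet k' w j) x - snd (jet k w j) x - (k' - k) * snd (jet k w (S j)) x)%C).
  - exact Hk.
  - apply pow2_ge_0.
  - intros i; pose proof (first_const_nonneg i); lra.
  - exact HW.
  - lia.
  - intros i Hi; apply contC_opp, contC_mult; [apply contC_const|].
    apply contC_minus; apply jet_contC with (3 := HW); auto; lia.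
  - intros i y Hi.
    rewrite Cmod_opp, !Cmod_mult, Cmod_Ci, Cmod_R, (Rabs_pos_eq 2) by lra.
    destruct (jet_difference_bound k k' w N W Hk Hk' Cw HW Hw i ltac:(lia) y) as [B _].
    replace (i + 2)%nat with (S (i + 1)) by lia.
    pose proof (Cmod_ge_0 (k' - k)).
    apply (Rmult_le_compat_l (2 * Cmod (k' - k))) in B; [|lra].
    lra.
  - intros i Hi.
    assert (S1 := jet_difference_sol k k' w N W Hk Hk' Cw HW Hw i ltac:(lia)).
    destruct (jet_spec k w N W Hk Cw HW Hw (S i) ltac:(lia)) as [S2 _].
    apply sol_scal with (c := (k' - k)%C) in S2.
    apply sol_ext with (2 := sol_minus _ _ _ _ _ _ _ S1 S2).
    intros y; simpl source; simpl pred; rewrite S_INR, RtoC_plus.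
    destruct i as [|i]; simpl pred; [simpl INR|]; ring.
  - lia.
Qed.

End Jets.

(** * Moments and approximation by sources of fast decay *)

Lemma chain_weaken (N N' : nat) (W : nat -> R -> R) :
  (N <= N')%nat -> chain N' W -> chain N W.
Proof. intros L [H0 H]; split; [exact H0|]; intros l Hl; apply H; lia. Qed.

Lemma tail_bound (h : R -> C) (Om : R -> R) (x0 : R) :
  contC h -> majorant x0 h Om ->
  forall x, x0 <= x -> Cmod (tail h x) <= Om x.
Proof.
  intros Hc HM.
  destruct (tail_spec h Om x0 Hc HM) as [D V].
  apply green_bound with (k := RtoC 0) (h := h); auto.
  - apply Im_0_le.
  - intros x _; eapply derivC_eq; [apply D | ring].
Qed.

Lemma vanish_Re (f : R -> C) : vanish f -> is_lim (fun x => Re (f x)) p_infty 0.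
Proof.
  intros V; apply eps_is_lim_0; intros eps He.
  destruct (is_lim_0_eps _ V eps He) as [B HB]; exists B; intros x Hx.
  eapply Rle_lt_trans; [apply re_le_Cmod|].
  specialize (HB x Hx); rewrite Rabs_pos_eq in HB; [exact HB | apply Cmod_ge_0].
Qed.

Definition Rtail (phi : R -> R) (x : R) : R := Re (tail (fun t => RtoC (phi t)) x).

Lemma Rtail_spec (phi Om : R -> R) (x0 : R) :
  (forall x, continuous phi x) -> majorant x0 (fun t => RtoC (phi t)) Om ->
  (forall x, is_derive (Rtail phi) x (- phi x)) /\
  is_lim (Rtail phi) p_infty 0 /\
  (forall x, x0 <= x -> Rtail phi x <= Om x).
Proof.
  intros Hc HM.
  destruct (tail_spec _ Om x0 (contC_RtoC phi Hc) HM) as [D V].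
  split; [intros x; apply (D x) | split; [now apply vanish_Re|]].
  intros x Hx; eapply Rle_trans; [apply Rle_abs|].
  eapply Rle_trans; [apply re_le_Cmod|].
  now apply tail_bound with x0; [apply contC_RtoC | |].
Qed.

Lemma pow_1x_pos (n : nat) (x : R) : 0 <= x -> 1 <= (1 + x) ^ n.
Proof. intros H; apply pow_R1_Rle; lra. Qed.

Lemma is_derive_1x_pow (n : nat) (x : R) :
  is_derive (fun t => (1 + t) ^ S n) x (INR (S n) * (1 + x) ^ n).
Proof.
  eapply is_derive_eq.
  - apply (is_derive_pow (fun t => 1 + t) (S n) x 1); auto_derive; [exact I | ring].
  - simpl pred; ring.
Qed.

(** Restricted to [x >= 0], where the weight is at least 1. *)
Definition weighted (n : nat) (w : R -> R) (Om : R -> R) : Prop :=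
  majorant 0 (fun x => RtoC ((1 + x) ^ n * w x)) Om.

Lemma weighted_le (n : nat) (c : R) (v w Om : R -> R) :
  0 <= c -> (forall x, 0 <= x -> Rabs (w x) <= c * Rabs (v x)) ->
  weighted n v Om -> weighted n w (fun x => c * Om x).
Proof.
  intros Hc L; apply majorant_scal; [exact Hc|].
  intros x Hx; rewrite !Cmod_R, !Rabs_mult.
  specialize (L x Hx); pose proof (Rabs_pos ((1 + x) ^ n)); nra.
Qed.

(** Integration by parts: [(1 + x)^n] times the tail of [phi] has an explicit
    majorant, built from that of [(1 + x)^(n+1) phi]; hence one power of the
    weight is traded for one more tail. *)
Lemma chain_of_weight (n : nat) : forall (phi Om : R -> R),
  (forall x, continuous phi x) -> (forall x, 0 <= phi x) -> weighted n phi Om ->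
  exists W, chain (S n) W /\ (forall x, W O x = phi x) /\
    forall l, (1 <= l <= S n)%nat -> W l 0 <= Om 0.
Proof.
  induction n as [|n IH]; intros phi Om Hc Hp HM.
  - destruct (Rtail_spec phi Om 0 Hc) as [D [L B]].
    { apply majorant_le with (2 := HM); intros x _; simpl; rewrite Rmult_1_l; apply Rle_refl. }
    exists (fun l => match l with O => phi | S _ => Rtail phi end).
    split; [|split; [reflexivity|]].
    + split; [exact Hp|]; intros l Hl; replace l with O by lia; now split.
    + intros [|l] Hl; [lia|]; apply B, Rle_refl.
  - assert (HM' : forall x, 0 <= x ->
        majorant x (fun t => RtoC (phi t)) (fun t => / (1 + x) ^ S n * Om t)).
    { intros x Hx; pose proof (pow_1x_pos (S n) x Hx).
      apply majorant_scal with (3 := majorant_from 0 x _ _ Hx HM).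
      - apply Rlt_le, Rinv_0_lt_compat; lra.
      - intros t Ht; rewrite !Cmod_R, Rabs_mult.
        pose proof (pow_1x_pos (S n) t ltac:(lra)).
        rewrite (Rabs_pos_eq ((1 + t) ^ S n)) by lra.
        assert ((1 + x) ^ S n <= (1 + t) ^ S n) by (apply pow_incr; lra).
        apply Rmult_le_reg_l with ((1 + x) ^ S n); [lra|].
        rewrite <- Rmult_assoc, Rinv_r, Rmult_1_l by lra.
        apply Rmult_le_compat_r; [apply Rabs_pos | assumption]. }
    set (Phi := Rtail phi).
    destruct (Rtail_spec phi _ 0 Hc (HM' 0 (Rle_refl 0))) as [D [L _]].
    assert (P0 : forall x, 0 <= Phi x).
    { intros x; apply nonneg_of_decreasing_to_0 with (fun x => - phi x) x;
        [intros; apply D | intros t _; specialize (Hp t); lra | exact L | apply Rle_refl]. }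
    assert (B : forall x, 0 <= x -> (1 + x) ^ S n * Phi x <= Om x).
    { intros x Hx; pose proof (pow_1x_pos (S n) x Hx).
      destruct (Rtail_spec phi _ x Hc (HM' x Hx)) as [_ [_ B]].
      specialize (B x (Rle_refl x)); fold Phi in B.
      apply Rmult_le_reg_l with (/ (1 + x) ^ S n); [apply Rinv_0_lt_compat; lra|].
      rewrite <- Rmult_assoc, Rinv_l, Rmult_1_l by lra; exact B. }
    pose proof (lt_0_INR (S n) ltac:(lia)) as HS.
    assert (HMW : weighted n Phi (fun x => / INR (S n) * (Om x + -1 * ((1 + x) ^ S n * Phi x)))).
    { pose proof HM as [[dOm H] HL]; split.
      - exists (fun x => / INR (S n) * (dOm x + -1 * (INR (S n) * (1 + x) ^ n * Phi x + (1 + x) ^ S n * - phi x))).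
        intros x Hx; destruct (H x Hx) as [H1 H2]; split.
        + apply (is_derive_scal (fun x => Om x + -1 * ((1 + x) ^ S n * Phi x))).
          apply (is_derive_plus (V := R_NormedModule) Om); [exact H1|].
          apply (is_derive_scal (fun x => (1 + x) ^ S n * Phi x)).
          apply (is_derive_Rmult (fun x => (1 + x) ^ S n)); [apply is_derive_1x_pow | apply D].
        + pose proof (pow_1x_pos n x Hx); pose proof (pow_1x_pos (S n) x Hx).
          rewrite Cmod_R in *; rewrite Rabs_pos_eq in H2 by (apply Rmult_le_pos; [lra | apply Hp]).
          rewrite Rabs_pos_eq by (apply Rmult_le_pos; [lra | apply P0]).
          apply Rmult_le_reg_l with (INR (S n)); [exact HS|].
          replace (INR (S n) * - (/ INR (S n) * (dOm x + -1 * (INR (S n) * (1 + x) ^ n * Phi x + (1 + x) ^ S n * - phi x))))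
            with (- dOm x + INR (S n) * ((1 + x) ^ n * Phi x) - (1 + x) ^ S n * phi x)
            by (field; lra).
          lra.
      - apply is_lim_0_scal, is_lim_0_plus; [exact HL|]; apply is_lim_0_scal.
        apply is_lim_le_le_loc with (f := fun _ => 0) (g := Om).
        + exists 0; intros x Hx; split; [|apply B; lra].
          pose proof (pow_1x_pos (S n) x ltac:(lra)).
          apply Rmult_le_pos; [lra | apply P0].
        + apply is_lim_const.
        + exact HL. }
    destruct (IH Phi _ (fun x => is_derive_continuous _ _ _ (D x)) P0 HMW)
      as [W [[W0 HW] [EW BW]]].
    assert (HOm : 0 <= Phi 0 <= Om 0).
    { split; [apply P0|]; specialize (B 0 (Rle_refl 0)); rewrite Rplus_0_r, pow1 in B; lra. }
    exists (fun l => match l with O => phi | S i => W i end).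
    split; [split; [exact Hp|]|split; [reflexivity|]].
    + intros [|l] Hl; [|apply HW; lia].
      split; [|apply is_lim_ext with Phi; [intros; now rewrite EW | exact L]].
      intros x; apply is_derive_ext with Phi; [intros; now rewrite EW | apply D].
    + intros [|[|l]] Hl; [lia | rewrite EW; lra |].
      eapply Rle_trans; [apply BW; lia|].
      rewrite Rplus_0_r, pow1.
      assert (1 <= INR (S n)) by (rewrite S_INR; pose proof (pos_INR n); lra).
      assert (/ INR (S n) <= 1) by (rewrite <- Rinv_1; apply Rinv_le_contravar; lra).
      pose proof (Rinv_0_lt_compat _ HS); nra.
Qed.

(** Equal to 1 up to [r], to 0 from [r + 1] on, and affine in between. *)
Definition cutoff (r x : R) : R := (1 + Rabs (r + 1 - x) - Rabs (r - x)) / 2.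

Lemma cutoff_range (r x : R) : 0 <= cutoff r x <= 1.
Proof. unfold cutoff, Rabs; destruct (Rcase_abs _), (Rcase_abs _); lra. Qed.

Lemma cutoff_left (r x : R) : x <= r -> cutoff r x = 1.
Proof. intros H; unfold cutoff; rewrite !Rabs_pos_eq by lra; lra. Qed.

Lemma cutoff_right (r x : R) : r + 1 <= x -> cutoff r x = 0.
Proof. intros H; unfold cutoff; rewrite !Rabs_left1 by lra; lra. Qed.

Lemma continuous_Rmult (f g : R -> R) (x : R) :
  continuous f x -> continuous g x -> continuous (fun t => f t * g t) x.
Proof. exact (continuous_mult (K := R_AbsRing) f g x). Qed.

Lemma continuous_Rabs_comp (f : R -> R) (x : R) :
  continuous f x -> continuous (fun t => Rabs (f t)) x.
Proof. intros H; exact (continuous_comp f Rabs x H (continuous_Rabs _)). Qed.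

Lemma continuous_affine (a x : R) : continuous (fun t => a - t) x.
Proof.
  exact (continuous_minus (V := R_NormedModule) (fun _ => a) (fun t => t) x
    (continuous_const a x) (continuous_id x)).
Qed.

Lemma continuous_cutoff (r x : R) : continuous (cutoff r) x.
Proof.
  apply continuous_Rmult; [|apply continuous_const].
  apply (continuous_minus (V := R_NormedModule) (fun t => 1 + Rabs (r + 1 - t)) (fun t => Rabs (r - t))).
  - apply (continuous_plus (V := R_NormedModule) (fun _ => 1) (fun t => Rabs (r + 1 - t)));
      [apply continuous_const | apply continuous_Rabs_comp, continuous_affine].
  - apply continuous_Rabs_comp, continuous_affine.
Qed.

Lemma continuous_1x_pow (n : nat) (x : R) : continuous (fun t => (1 + t) ^ n) x.
Proof.
  destruct n as [|n]; [apply continuous_const|].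
  exact (is_derive_continuous _ _ _ (is_derive_1x_pow n x)).
Qed.

(** The truncated part has two moments more than [w], which is what quadratic
    estimates require; the rest is small in the norm for which linear estimates
    are available. *)
Lemma cutoff_split (n : nat) (w Om : R -> R) (eps : R) :
  (forall x, continuous w x) -> weighted n w Om -> 0 < eps ->
  exists w1 w2 W1 W2,
    (forall x, continuous w1 x) /\ (forall x, continuous w2 x) /\
    (forall x, w x = w1 x + w2 x) /\
    chain (S (S (S n))) W1 /\ (forall x, W1 O x = Rabs (w1 x)) /\
    chain (S n) W2 /\ (forall x, W2 O x = Rabs (w2 x)) /\
    forall l, (1 <= l <= S n)%nat -> W2 l 0 <= eps.
Proof.
  intros Hc HM He.
  destruct (is_lim_0_eps Om (proj2 HM) eps He) as [B HB].
  (* Beyond [r] the weighted norm of [w] is below [eps]. *)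
  set (r := Rmax 0 (B + 1)).
  assert (Hr : 0 <= r) by apply Rmax_l.
  assert (HrB : Om r <= eps).
  { eapply Rle_trans; [apply Rle_abs|]; apply Rlt_le, HB.
    pose proof (Rmax_r 0 (B + 1)); fold r in H; lra. }
  set (w1 := fun x => w x * cutoff r x).
  set (w2 := fun x => w x * (1 - cutoff r x)).
  assert (C1 : forall x, continuous w1 x)
    by (intros x; apply continuous_Rmult; [apply Hc | apply continuous_cutoff]).
  assert (C2 : forall x, continuous w2 x).
  { intros x; apply continuous_Rmult; [apply Hc|].
    apply (continuous_minus (V := R_NormedModule) (fun _ => 1) (cutoff r));
      [apply continuous_const | apply continuous_cutoff]. }
  assert (M1 : weighted (S (S n)) (fun x => Rabs (w1 x)) (fun x => (2 + r) ^ 2 * Om x)).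
  { apply majorant_scal with (3 := HM); [apply pow2_ge_0|].
    intros x Hx; rewrite !Cmod_R, !Rabs_mult, Rabs_Rabsolu; unfold w1.
    rewrite Rabs_mult, (Rabs_pos_eq (cutoff r x)) by apply cutoff_range.
    pose proof (pow_1x_pos n x Hx); pose proof (pow_1x_pos (S (S n)) x Hx).
    rewrite (Rabs_pos_eq ((1 + x) ^ n)), (Rabs_pos_eq ((1 + x) ^ S (S n))) by lra.
    pose proof (Rabs_pos (w x)) as Hw.
    assert (0 <= (1 + x) ^ n * Rabs (w x)) by (apply Rmult_le_pos; lra).
    destruct (Rle_lt_dec (r + 1) x) as [L | L].
    - rewrite (cutoff_right r x L), Rmult_0_r, Rmult_0_r.
      apply Rmult_le_pos; [apply pow2_ge_0 | assumption].
    - pose proof (cutoff_range r x) as Hcut.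
      replace ((1 + x) ^ S (S n) * (Rabs (w x) * cutoff r x))
        with (((1 + x) ^ 2 * cutoff r x) * ((1 + x) ^ n * Rabs (w x))) by (simpl; ring).
      apply Rmult_le_compat_r; [assumption|].
      assert ((1 + x) ^ 2 <= (2 + r) ^ 2) by (apply pow_incr; lra).
      pose proof (pow2_ge_0 (1 + x)); nra. }
  set (h2 := fun x => (1 + x) ^ n * Rabs (w2 x)).
  assert (Ch2 : forall x, continuous h2 x)
    by (intros x; apply continuous_Rmult;
        [apply continuous_1x_pow | apply continuous_Rabs_comp, C2]).
  assert (M2 : majorant 0 (fun x => RtoC (h2 x)) Om).
  { apply majorant_le with (2 := HM); intros x Hx.
    unfold h2, w2; rewrite !Cmod_R, !Rabs_mult, !Rabs_Rabsolu.
    apply Rmult_le_compat_l; [apply Rabs_pos|].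
    rewrite (Rabs_pos_eq (1 - cutoff r x)) by (pose proof (cutoff_range r x); lra).
    pose proof (cutoff_range r x); pose proof (Rabs_pos (w x)); nra. }
  destruct (Rtail_spec h2 Om 0 Ch2 M2) as [D2 [L2 B2]].
  assert (Hh2 : forall x, 0 <= x -> 0 <= h2 x).
  { intros x Hx; pose proof (pow_1x_pos n x Hx).
    apply Rmult_le_pos; [lra | apply Rabs_pos]. }
  assert (HT : Rtail h2 0 <= eps).
  { apply Rle_trans with (Rtail h2 r); [|eapply Rle_trans; [now apply B2 | exact HrB]].
    apply Ropp_le_cancel.
    apply nonincreasing with (phi := fun x => - Rtail h2 x) (dphi := fun x => - - h2 x);
      [exact Hr | |].
    - intros t _; apply (is_derive_opp (Rtail h2)), D2.
    - intros t Ht; unfold h2, w2; rewrite (cutoff_left r t) by lra.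
      rewrite Rminus_diag, Rmult_0_r, Rabs_R0; lra. }
  assert (M3 : weighted n (fun x => Rabs (w2 x)) (Rtail h2)).
  { split; [|exact L2]; exists (fun x => - h2 x); intros x Hx; split; [apply D2|].
    rewrite Cmod_R; fold (h2 x); rewrite Rabs_pos_eq by (now apply Hh2); lra. }
  destruct (chain_of_weight _ _ _ (fun x => continuous_Rabs_comp _ _ (C1 x))
    (fun x => Rabs_pos _) M1) as [W1 [K1 [E1 _]]].
  destruct (chain_of_weight _ _ _ (fun x => continuous_Rabs_comp _ _ (C2 x))
    (fun x => Rabs_pos _) M3) as [W2 [K2 [E2 B3]]].
  exists w1, w2, W1, W2; split; [exact C1|]; split; [exact C2|].
  split; [intros x; unfold w1, w2; ring|].
  repeat (split; [assumption|]).
  intros l Hl; eapply Rle_trans; [now apply B3 | exact HT].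
Qed.

(** * Regularity of the traces up to the real axis *)

Definition cont_on (D : C -> Prop) (F : C -> C) (k : C) : Prop :=
  forall eps, 0 < eps -> exists d, 0 < d /\
    forall k', D k' -> Cmod (k' - k) < d -> Cmod (F k' - F k) <= eps.

(** Taken along the closed half-plane this makes sense on the real axis too, and
    spares any passage to the limit from the open half-plane. *)
Definition deriv_on (D : C -> Prop) (F : C -> C) (k l : C) : Prop :=
  forall eps, 0 < eps -> exists d, 0 < d /\
    forall k', D k' -> Cmod (k' - k) < d ->
      Cmod (F k' - F k - (k' - k) * l) <= eps * Cmod (k' - k).

Definition pick {T : Type} (b : bool) (p : T * T) : T := if b then fst p else snd p.

Section Regularity.

Context (lambda : R) (u mu : R -> R).
Context (Hlam : Rabs lambda <= 1)
        (Hu : forall x, continuous u x)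
        (Hmu : forall x, is_derive mu x (- Rabs (u x)))
        (Hmu0 : is_lim mu p_infty 0).

(** For [w = - u], [trace w true 0] is [b] and [trace w false 0] is [a - 1]. *)
Definition trace (w : R -> R) (b : bool) (j : nat) (k : C) : C :=
  pick b (jet lambda u k (fun x => RtoC (w x)) j) 0.

Local Notation A := (bigamp mu 0).

Lemma Cmod_chain (w : R -> R) (W : nat -> R -> R) :
  (forall x, W O x = Rabs (w x)) -> forall x, Cmod (RtoC (w x)) <= W O x.
Proof. intros E x; rewrite Cmod_R, E; apply Rle_refl. Qed.

Lemma trace_bound (w : R -> R) (N : nat) (W : nat -> R -> R) :
  (forall x, continuous w x) -> chain N W -> (forall x, W O x = Rabs (w x)) ->
  forall b j k, (j < N)%nat -> Im k <= 0 ->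
  Cmod (trace w b j k) <= jet_const j * (A ^ S j * W (S j) 0).
Proof.
  intros Hc HW E b j k Hj Hk.
  destruct (jet_spec lambda u mu Hlam Hu Hmu Hmu0 k _ N W Hk (contC_RtoC w Hc) HW
    (Cmod_chain w W E) j Hj) as [_ B].
  destruct (B 0); destruct b; assumption.
Qed.

Lemma trace_difference (w : R -> R) (N : nat) (W : nat -> R -> R) :
  (forall x, continuous w x) -> chain N W -> (forall x, W O x = Rabs (w x)) ->
  forall b j k k', (S j < N)%nat -> Im k <= 0 -> Im k' <= 0 ->
  Cmod (trace w b j k' - trace w b j k)
    <= first_const j * Cmod (k' - k) * (A ^ S (S j) * W (S (S j)) 0).
Proof.
  intros Hc HW E b j k k' Hj Hk Hk'.
  pose proof (jet_difference_bound lambda u mu Hlam Hu Hmu Hmu0 k k' _ N W Hk Hk'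
    (contC_RtoC w Hc) HW (Cmod_chain w W E) j Hj 0) as B.
  rewrite Nat.add_1_r in B.
  destruct b; apply B.
Qed.

Lemma trace_second_difference (w : R -> R) (N : nat) (W : nat -> R -> R) :
  (forall x, continuous w x) -> chain N W -> (forall x, W O x = Rabs (w x)) ->
  forall b j k k', (S (S j) < N)%nat -> Im k <= 0 -> Im k' <= 0 ->
  Cmod (trace w b j k' - trace w b j k - (k' - k) * trace w b (S j) k)
    <= second_const j * Cmod (k' - k) ^ 2 * (A ^ S (S (S j)) * W (S (S (S j))) 0).
Proof.
  intros Hc HW E b j k k' Hj Hk Hk'.
  pose proof (jet_second_difference_bound lambda u mu Hlam Hu Hmu Hmu0 k k' _ N W Hk Hk'
    (contC_RtoC w Hc) HW (Cmod_chain w W E) j Hj 0) as B.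
  replace (j + 2)%nat with (S (S j)) in B by lia.
  destruct b; apply B.
Qed.

Lemma trace_plus (w1 w2 w : R -> R) (N : nat) (W1 W2 W : nat -> R -> R) :
  (forall x, continuous w1 x) -> (forall x, continuous w2 x) -> (forall x, continuous w x) ->
  chain N W1 -> chain N W2 -> chain N W ->
  (forall x, W1 O x = Rabs (w1 x)) -> (forall x, W2 O x = Rabs (w2 x)) ->
  (forall x, W O x = Rabs (w x)) -> (forall x, w x = w1 x + w2 x) ->
  forall b j k, (j < N)%nat -> Im k <= 0 ->
    trace w b j k = (trace w1 b j k + trace w2 b j k)%C.
Proof.
  intros C1 C2 C0 H1 H2 H0 B1 B2 B0 E b j k Hj Hk.
  destruct (jet_plus lambda u mu Hlam Hu Hmu Hmu0 k
    (fun x => RtoC (w1 x)) (fun x => RtoC (w2 x)) (fun x => RtoC (w x)) N W1 W2 W Hk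
    (contC_RtoC _ C1) (contC_RtoC _ C2) (contC_RtoC _ C0) H1 H2 H0
    (Cmod_chain _ _ B1) (Cmod_chain _ _ B2) (Cmod_chain _ _ B0)
    (fun x => eq_trans (f_equal RtoC (E x)) (RtoC_plus _ _)) j Hj 0) as [X Y].
  destruct b; [exact X | exact Y].
Qed.

Lemma weighted_chain (n : nat) (w Om : R -> R) :
  (forall x, continuous w x) -> weighted n w Om ->
  exists W, chain (S n) W /\ (forall x, W O x = Rabs (w x)).
Proof.
  intros Hc HM.
  destruct (chain_of_weight n (fun x => Rabs (w x)) Om) as [W [H1 [H2 _]]].
  - intros x; apply continuous_Rabs_comp, Hc.
  - intros x; apply Rabs_pos.
  - apply majorant_le with (2 := HM); intros x _.
    rewrite !Cmod_R, !Rabs_mult, Rabs_Rabsolu; apply Rle_refl.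
  - now exists W.
Qed.

Lemma trace_bounded (n : nat) (w Om : R -> R) :
  (forall x, continuous w x) -> weighted n w Om ->
  forall b j, (j <= n)%nat -> exists M, forall k, Im k <= 0 -> Cmod (trace w b j k) <= M.
Proof.
  intros Hc HM b j Hj; destruct (weighted_chain n w Om Hc HM) as [W [HW E]].
  eexists; intros k Hk; apply trace_bound with (2 := HW); auto; lia.
Qed.

(** Split off a small remainder in the weighted norm; for what is left, tails of
    higher order are available, hence a quantitative estimate. *)
Lemma trace_cont (n : nat) (w Om : R -> R) :
  (forall x, continuous w x) -> weighted n w Om ->
  forall b j k, (j <= n)%nat -> Im k <= 0 -> cont_on closed_lower (trace w b j) k.
Proof.
  intros Hc HM b j k Hj Hk eps He.
  destruct (weighted_chain n w Om Hc HM) as [W [HW E]].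
  set (c := 2 * (jet_const j * A ^ S j)).
  assert (Hcj : 0 <= c).
  { pose proof (jet_const_nonneg j); pose proof (bigamp_pow_pos u mu Hmu Hmu0 (S j) 0).
    unfold c; apply Rmult_le_pos; [lra | apply Rmult_le_pos; lra]. }
  destruct (cutoff_split n w Om (eps / 2 / (c + 1)) Hc HM)
    as [w1 [w2 [W1 [W2 [C1 [C2 [Ew [K1 [E1 [K2 [E2 B2]]]]]]]]]]].
  { apply Rdiv_lt_0_compat; lra. }
  pose proof (chain_weaken (S n) (S (S (S n))) W1 ltac:(lia) K1) as K1'.
  set (K := first_const j * (A ^ S (S j) * W1 (S (S j)) 0)).
  assert (HK : 0 <= K).
  { apply Rmult_le_pos; [apply first_const_nonneg|].
    apply Rmult_le_pos; [apply Rlt_le, (bigamp_pow_pos u mu Hmu Hmu0)|].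
    apply (chain_nonneg _ _ K1); lia. }
  exists (eps / 2 / (K + 1)); split; [apply Rdiv_lt_0_compat; lra|].
  intros k' Hk' Hd.
  pose proof (trace_plus w1 w2 w (S n) W1 W2 W C1 C2 Hc K1' K2 HW E1 E2 E Ew b j) as TP.
  rewrite (TP k), (TP k') by (assumption || lia).
  pose proof (trace_difference w1 (S (S (S n))) W1 C1 K1 E1 b j k k' ltac:(lia) Hk Hk') as T1.
  pose proof (trace_bound w2 (S n) W2 C2 K2 E2 b j k ltac:(lia) Hk) as T2.
  pose proof (trace_bound w2 (S n) W2 C2 K2 E2 b j k' ltac:(lia) Hk') as T3.
  specialize (B2 (S j) ltac:(lia)).
  replace (trace w1 b j k' + trace w2 b j k' - (trace w1 b j k + trace w2 b j k))%C
    with ((trace w1 b j k' - trace w1 b j k) + (trace w2 b j k' + - trace w2 b j k))%C by ring.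
  eapply Rle_trans; [apply Cmod_triangle|].
  assert (Cmod (trace w2 b j k' + - trace w2 b j k) <= eps / 2).
  { eapply Rle_trans; [apply Cmod_triangle|]; rewrite Cmod_opp.
    apply Rle_trans with (c * W2 (S j) 0); [unfold c; lra|].
    apply Rle_trans with (c * (eps / 2 / (c + 1))); [now apply Rmult_le_compat_l|].
    apply mult_div_succ_le; lra. }
  assert (K * Cmod (k' - k) <= eps / 2).
  { apply Rle_trans with (K * (eps / 2 / (K + 1))); [apply Rmult_le_compat_l; lra|].
    apply mult_div_succ_le; lra. }
  unfold K in *; lra.
Qed.

Lemma trace_deriv (n : nat) (w Om : R -> R) :
  (forall x, continuous w x) -> weighted n w Om ->
  forall b j k, (j < n)%nat -> Im k <= 0 -> deriv_on closed_lower (trace w b j) k (trace w b (S j) k).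
Proof.
  intros Hc HM b j k Hj Hk eps He.
  destruct (weighted_chain n w Om Hc HM) as [W [HW E]].
  (* [c] bounds the linear contribution of the small part of the source, [K] below
     the quadratic contribution of the truncated part. *)
  set (c := (first_const j + jet_const (S j)) * A ^ S (S j)).
  assert (Hcj : 0 <= c).
  { pose proof (jet_const_nonneg (S j)); pose proof (first_const_nonneg j).
    pose proof (bigamp_pow_pos u mu Hmu Hmu0 (S (S j)) 0).
    unfold c; apply Rmult_le_pos; lra. }
  destruct (cutoff_split n w Om (eps / 2 / (c + 1)) Hc HM)
    as [w1 [w2 [W1 [W2 [C1 [C2 [Ew [K1 [E1 [K2 [E2 B2]]]]]]]]]]].
  { apply Rdiv_lt_0_compat; lra. }
  pose proof (chain_weaken (S n) (S (S (S n))) W1 ltac:(lia) K1) as K1'.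
  set (K := second_const j * (A ^ S (S (S j)) * W1 (S (S (S j))) 0)).
  assert (HK : 0 <= K).
  { apply Rmult_le_pos;
      [apply ladder_const_nonneg; intros i; pose proof (first_const_nonneg i); lra|].
    apply Rmult_le_pos; [apply Rlt_le, (bigamp_pow_pos u mu Hmu Hmu0)|].
    apply (chain_nonneg _ _ K1); lia. }
  exists (eps / 2 / (K + 1)); split; [apply Rdiv_lt_0_compat; lra|].
  intros k' Hk' Hd.
  pose proof (trace_plus w1 w2 w (S n) W1 W2 W C1 C2 Hc K1' K2 HW E1 E2 E Ew b) as TP.
  rewrite (TP j k), (TP j k'), (TP (S j) k) by (assumption || lia).
  pose proof (trace_second_difference w1 (S (S (S n))) W1 C1 K1 E1 b j k k' ltac:(lia) Hk Hk') as T1.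
  pose proof (trace_difference w2 (S n) W2 C2 K2 E2 b j k k' ltac:(lia) Hk Hk') as T2.
  pose proof (trace_bound w2 (S n) W2 C2 K2 E2 b (S j) k ltac:(lia) Hk) as T3.
  specialize (B2 (S (S j)) ltac:(lia)).
  set (d := Cmod (k' - k)) in *.
  assert (Hd0 : 0 <= d) by apply Cmod_ge_0.
  match goal with |- Cmod ?z <= _ => replace z with
    ((trace w1 b j k' - trace w1 b j k - (k' - k) * trace w1 b (S j) k) +
     ((trace w2 b j k' - trace w2 b j k) + - ((k' - k) * trace w2 b (S j) k)))%C by ring end.
  eapply Rle_trans; [apply Cmod_triangle|].
  assert (S2 : Cmod (trace w2 b j k' - trace w2 b j k + - ((k' - k) * trace w2 b (S j) k))
    <= eps / 2 * d).
  { eapply Rle_trans; [apply Cmod_triangle|]; rewrite Cmod_opp, Cmod_mult; fold d.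
    apply Rle_trans with (c * W2 (S (S j)) 0 * d).
    - apply (Rmult_le_compat_l d) in T3; [|exact Hd0]; unfold c; lra.
    - apply Rmult_le_compat_r; [exact Hd0|].
      apply Rle_trans with (c * (eps / 2 / (c + 1))); [now apply Rmult_le_compat_l|].
      apply mult_div_succ_le; lra. }
  assert (S1 : K * d <= eps / 2).
  { apply Rle_trans with (K * (eps / 2 / (K + 1))); [apply Rmult_le_compat_l; lra|].
    apply mult_div_succ_le; lra. }
  apply (Rmult_le_compat_r d) in S1; [|exact Hd0].
  unfold K in *; lra.
Qed.

End Regularity.

(** * Expansion in powers of 1/k *)

(** Recursive in the derivative, so that products and derivatives stay in the
    classes by induction without Leibniz sums. *)
Fixpoint weightedC (n p : nat) (w : R -> R) : Prop :=
  (forall x, continuous w x) /\ (exists Om, weighted n w Om) /\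
  match p with
  | O => True
  | S q => exists w', (forall x, is_derive w x (w' x)) /\ weightedC n q w'
  end.

Fixpoint boundedC (p : nat) (g : R -> R) : Prop :=
  (forall x, continuous g x) /\ (exists M, forall x, 0 <= x -> Rabs (g x) <= M) /\
  match p with
  | O => True
  | S q => exists g', (forall x, is_derive g x (g' x)) /\ boundedC q g'
  end.

Lemma weightedC_continuous (n p : nat) (w : R -> R) : weightedC n p w -> forall x, continuous w x.
Proof. destruct p; intros H; apply H. Qed.

Lemma weightedC_weighted (n p : nat) (w : R -> R) : weightedC n p w -> exists Om, weighted n w Om.
Proof. destruct p; intros H; apply H. Qed.

Lemma boundedC_continuous (p : nat) (w : R -> R) : boundedC p w -> forall x, continuous w x.
Proof. destruct p; intros H; apply H. Qed.

Lemma boundedC_bounded (p : nat) (w : R -> R) :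
  boundedC p w -> exists M, forall x, 0 <= x -> Rabs (w x) <= M.
Proof. destruct p; intros H; apply H. Qed.

Lemma weightedC_pred (n p : nat) : forall w, weightedC n (S p) w -> weightedC n p w.
Proof.
  induction p as [|p IH]; intros w [C [M [w' [D H]]]]; (split; [exact C|]; split; [exact M|]).
  - exact I.
  - exists w'; split; [exact D | now apply IH].
Qed.

Lemma boundedC_pred (p : nat) : forall w, boundedC (S p) w -> boundedC p w.
Proof.
  induction p as [|p IH]; intros w [C [M [w' [D H]]]]; (split; [exact C|]; split; [exact M|]).
  - exact I.
  - exists w'; split; [exact D | now apply IH].
Qed.

Lemma continuous_Rplus (f g : R -> R) (x : R) :
  continuous f x -> continuous g x -> continuous (fun t => f t + g t) x.
Proof. exact (continuous_plus (V := R_NormedModule) f g x). Qed.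

Lemma weightedC_plus (n p : nat) : forall f g, weightedC n p f -> weightedC n p g -> weightedC n p (fun x => f x + g x).
Proof.
  assert (A : forall f g, (exists Om, weighted n f Om) -> (exists Om, weighted n g Om) ->
              exists Om, weighted n (fun x => f x + g x) Om).
  { intros f g [O1 H1] [O2 H2]; exists (fun x => O1 x + O2 x).
    apply majorant_le with (2 := majorant_plus _ _ _ _ _ H1 H2); intros x _.
    rewrite Rmult_plus_distr_l, RtoC_plus; apply Rle_refl. }
  induction p as [|p IH]; intros f g [Cf [Mf Hf]] [Cg [Mg Hg]];
    (split; [intros x; apply continuous_Rplus; [apply Cf | apply Cg]|]);
    (split; [now apply A|]); [exact I|].
  destruct Hf as [f' [Df Hf]], Hg as [g' [Dg Hg]].
  exists (fun x => f' x + g' x); split; [|now apply IH].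
  intros x; exact (is_derive_plus _ _ _ _ _ (Df x) (Dg x)).
Qed.

Lemma boundedC_plus (p : nat) : forall f g, boundedC p f -> boundedC p g -> boundedC p (fun x => f x + g x).
Proof.
  induction p as [|p IH]; intros f g [Cf [[Mf Bf] Hf]] [Cg [[Mg Bg] Hg]];
    (split; [intros x; apply continuous_Rplus; [apply Cf | apply Cg]|]);
    (split; [exists (Mf + Mg); intros x Hx; eapply Rle_trans; [apply Rabs_triang|];
             specialize (Bf x Hx); specialize (Bg x Hx); lra|]); [exact I|].
  destruct Hf as [f' [Df Hf]], Hg as [g' [Dg Hg]].
  exists (fun x => f' x + g' x); split; [|now apply IH].
  intros x; exact (is_derive_plus _ _ _ _ _ (Df x) (Dg x)).
Qed.

Lemma boundedC_const (p : nat) : forall c, boundedC p (fun _ => c).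
Proof.
  induction p as [|p IH]; intros c; (split; [intros x; apply continuous_const|]);
    (split; [exists (Rabs c); intros x _; apply Rle_refl|]); [exact I|].
  exists (fun _ => 0); split; [|apply IH].
  intros x; exact (is_derive_const (c : R_NormedModule) x).
Qed.

Lemma boundedC_mult (p : nat) : forall f g, boundedC p f -> boundedC p g -> boundedC p (fun x => f x * g x).
Proof.
  induction p as [|p IH]; intros f g Hf Hg; pose proof Hf as Hf'; pose proof Hg as Hg';
    destruct Hf as [Cf [[Mf Bf] Hf]], Hg as [Cg [[Mg Bg] Hg]];
    (split; [intros x; apply continuous_Rmult; [apply Cf | apply Cg]|]);
    (split; [exists (Mf * Mg); intros x Hx; rewrite Rabs_mult;
             apply Rmult_le_compat; auto using Rabs_pos|]); [exact I|].
  destruct Hf as [f' [Df Hf]], Hg as [g' [Dg Hg]].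
  exists (fun x => f' x * g x + f x * g' x); split.
  - intros x; now apply is_derive_Rmult.
  - apply boundedC_plus; apply IH; auto; now apply boundedC_pred.
Qed.

Lemma weightedC_mult (n p : nat) : forall f g, weightedC n p f -> boundedC p g -> weightedC n p (fun x => f x * g x).
Proof.
  induction p as [|p IH]; intros f g Hf Hg; pose proof Hf as Hf'; pose proof Hg as Hg';
    destruct Hf as [Cf [[Om Bf] Hf]], Hg as [Cg [[Mg Bg] Hg]];
    (split; [intros x; apply continuous_Rmult; [apply Cf | apply Cg]|]);
    (split; [exists (fun x => Mg * Om x); apply weighted_le with (3 := Bf);
      [apply Rle_trans with (2 := Bg 0 (Rle_refl 0)), Rabs_pos
      |intros x Hx; rewrite Rabs_mult, Rmult_comm;
       apply Rmult_le_compat_r; auto using Rabs_pos]|]); [exact I|].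
  destruct Hf as [f' [Df Hf]], Hg as [g' [Dg Hg]].
  exists (fun x => f' x * g x + f x * g' x); split.
  - intros x; now apply is_derive_Rmult.
  - apply weightedC_plus; apply IH; auto; (now apply boundedC_pred) || now apply weightedC_pred.
Qed.

Lemma weighted_majorant (n : nat) (w Om : R -> R) :
  weighted n w Om -> majorant 0 (fun x => RtoC (w x)) Om.
Proof.
  apply majorant_le; intros x Hx; rewrite !Cmod_R, Rabs_mult.
  pose proof (pow_1x_pos n x Hx); rewrite (Rabs_pos_eq ((1 + x) ^ n)) by lra.
  pose proof (Rabs_pos (w x)); nra.
Qed.

Lemma weightedC_boundedC (n p : nat) : forall w, weightedC n (S p) w -> boundedC p w.
Proof.
  induction p as [|p IH]; intros w [Cw [_ [w' [Dw Hw]]]];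
    (split; [exact Cw|]); split.
  1, 3: destruct (weightedC_weighted n _ w' Hw) as [Om HM]; apply weighted_majorant in HM;
      pose proof (majorant_nonneg _ _ _ HM) as HO;
      destruct HM as [[dOm HM] _]; exists (Rabs (w 0) + Om 0); intros x Hx;
      assert (A : Cmod (RtoC (w x) - RtoC (w 0)) <= Om 0 - Om x)
        by (apply (Cmod_increment_le (fun t => RtoC (w t)) (fun t => RtoC (w' t)) Om dOm 0 x Hx);
            intros t Ht; [apply derivC_RtoC, Dw | apply HM; lra | apply HM; lra]);
      rewrite <- RtoC_minus, Cmod_R in A; specialize (HO x Hx);
      replace (w x) with (w 0 + (w x - w 0)) by ring;
      eapply Rle_trans; [apply Rabs_triang | lra].
  - exact I.
  - exists w'; split; [exact Dw | now apply IH].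
Qed.

(** The limit exists since the derivative is integrable; a nonzero limit would
    contradict the integrability of the function. *)
Lemma weightedC_lim (n p : nat) (w : R -> R) : weightedC n (S p) w -> is_lim w p_infty 0.
Proof.
  intros [_ [[Om HM] [w' [Dw Hw]]]].
  destruct (weightedC_weighted n p w' Hw) as [Om' HM'].
  apply weighted_majorant in HM; apply weighted_majorant in HM'.
  destruct (Rtail_spec w' Om' 0 (weightedC_continuous n p w' Hw) HM') as [DT [LT _]].
  set (c := w 0 + Rtail w' 0).
  assert (E : forall x, 0 <= x -> w x = c - Rtail w' x).
  { intros x Hx.
    assert (D : forall t, is_derive (fun t => w t + Rtail w' t) t 0).
    { intros t; eapply is_derive_eq;
        [exact (is_derive_plus _ _ _ _ _ (Dw t) (DT t)) | unfold plus; simpl; ring]. }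
    enough (w x + Rtail w' x = c) by lra.
    apply Rle_antisym.
    - apply (nonincreasing (fun t => w t + Rtail w' t) (fun _ => 0)); [exact Hx | |];
        intros; [apply D | lra].
    - apply Ropp_le_cancel.
      apply (nonincreasing (fun t => - (w t + Rtail w' t)) (fun _ => - 0)); [exact Hx | |];
        intros; [apply (is_derive_opp (fun t => w t + Rtail w' t)), D | lra]. }
  assert (Hc : c = 0).
  { destruct (Req_dec c 0) as [H | Hc]; [exact H | exfalso].
    assert (Hc2 : 0 < Rabs c / 2) by (pose proof (Rabs_pos_lt c Hc); lra).
    destruct (is_lim_0_eps _ LT _ Hc2) as [B HB].
    pose proof (majorant_nonneg _ _ _ HM) as HO.
    destruct HM as [[dOm HM] _].
    set (x0 := Rmax 0 (B + 1)).
    assert (H0 : 0 <= x0) by apply Rmax_l.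
    assert (H1 : B + 1 <= x0) by apply Rmax_r.
    (* Beyond [x0] the majorant decreases at least at speed [|c|/2]; after this time
       it would be negative. *)
    set (T := Om x0 / (Rabs c / 2) + 1).
    assert (HT : 1 <= T).
    { unfold T; specialize (HO x0 H0).
      assert (0 <= Om x0 / (Rabs c / 2)) by (apply Rmult_le_pos; [exact HO|];
        apply Rlt_le, Rinv_0_lt_compat; exact Hc2); lra. }
    assert (A : Om (x0 + T) + Rabs c / 2 * (x0 + T) <= Om x0 + Rabs c / 2 * x0).
    { apply nonincreasing with (phi := fun x => Om x + Rabs c / 2 * x)
        (dphi := fun x => dOm x + Rabs c / 2 * 1); [lra | |]; intros t Ht;
        destruct (HM t ltac:(lra)) as [M1 M2].
      - apply (is_derive_plus (V := R_NormedModule) Om); [exact M1|].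
        apply (is_derive_scal (fun x => x)), (is_derive_id (K := R_AbsRing)).
      - rewrite Cmod_R, (E t ltac:(lra)) in M2; specialize (HB t ltac:(lra)).
        pose proof (Rabs_triang (c - Rtail w' t) (Rtail w' t)) as Tr.
        replace (c - Rtail w' t + Rtail w' t) with c in Tr by ring; lra. }
    specialize (HO (x0 + T) ltac:(lra)).
    assert (Rabs c / 2 * T = Om x0 + Rabs c / 2)
      by (unfold T; field; intros H; rewrite H in Hc2; lra).
    lra. }
  apply is_lim_le_le_loc with (f := fun x => -1 * Rtail w' x) (g := fun x => -1 * Rtail w' x).
  - exists 0; intros x Hx; rewrite (E x) by lra; lra.
  - now apply is_lim_0_scal.
  - now apply is_lim_0_scal.
Qed.

Fixpoint lpoly (c : nat -> C) (p : nat) (k : C) : C :=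
  match p with
  | O => c O
  | S q => lpoly c q k + c (S q) / k ^ (S q)
  end%C.

Lemma lpoly_shift (c : nat -> C) (p : nat) (k : C) :
  k <> RtoC 0 -> lpoly c (S p) k = (c O + lpoly (fun l => c (S l)) p k / k)%C.
Proof.
  intros Hk; induction p as [|p IH].
  - simpl; field; exact Hk.
  - change (lpoly c (S (S p)) k) with (lpoly c (S p) k + c (S (S p)) / k ^ (S (S p)))%C.
    rewrite IH; simpl lpoly; rewrite !Cpow_S; field; split; [now apply Cpow_nz | exact Hk].
Qed.

Lemma lpoly_scal (a : C) (c : nat -> C) (p : nat) (k : C) :
  lpoly (fun l => a * c l)%C p k = (a * lpoly c p k)%C.
Proof.
  induction p as [|p IH]; simpl; [reflexivity|].
  rewrite IH; unfold Cdiv; ring.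
Qed.

Lemma lpoly_head (c d : nat -> C) (p : nat) (k : C) :
  (forall l, c (S l) = d (S l)) -> lpoly c p k = (c O - d O + lpoly d p k)%C.
Proof.
  intros E; induction p as [|p IH]; simpl; [ring|].
  rewrite IH, E; ring.
Qed.

Section Expansion.

Context (lambda : R) (u mu : R -> R).
Context (Hlam : Rabs lambda <= 1)
        (Hu : forall x, continuous u x)
        (Hmu : forall x, is_derive mu x (- Rabs (u x)))
        (Hmu0 : is_lim mu p_infty 0).

Local Notation trace := (trace lambda u).

Lemma trace_sol (n p : nat) (w : R -> R) (k : C) :
  weightedC n p w -> Im k <= 0 ->
  exists f g, sol lambda u k (fun x => RtoC (w x)) f g /\
    trace w true 0 k = f 0 /\ trace w false 0 k = g 0.
Proof.
  intros HW Hk; destruct (weightedC_weighted n p w HW) as [Om HM].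
  pose proof (weightedC_continuous n p w HW) as Cw.
  destruct (weighted_chain n w Om Cw HM) as [W [HC E]].
  destruct (jet_spec lambda u mu Hlam Hu Hmu Hmu0 k _ (S n) W Hk (contC_RtoC w Cw) HC
    (Cmod_chain w W E) O ltac:(lia)) as [S0 _].
  exists (fst (jet lambda u k (fun x => RtoC (w x)) 0)),
    (snd (jet lambda u k (fun x => RtoC (w x)) 0)).
  split; [|split; reflexivity].
  apply sol_ext with (2 := S0); intros x; simpl; ring.
Qed.

(** Integration by parts. If [gam] is the decaying primitive of [lambda u w], then
    [(w, gam) / (2ik)] solves the system with source [w] up to a new source
    [w1 / (2ik)], where [w1 = w' - u gam]. *)
Lemma expansion_step (n p : nat) (w : R -> R) :
  weightedC n (S p) u -> weightedC n (S p) w ->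
  exists w1 v, weightedC n p w1 /\
    forall b k, Im k <= 0 -> k <> RtoC 0 ->
      trace w b 0 k = ((RtoC (pick b v) + trace w1 b 0 k) / (2 * Ci * k))%C.
Proof.
  intros HU HW.
  pose proof (weightedC_boundedC n p u HU) as BU; pose proof (weightedC_boundedC n p w HW) as BW.
  set (q := fun x => u x * w x).
  assert (Hq : boundedC p q) by now apply boundedC_mult.
  assert (Wq : exists Om, weighted n q Om).
  { destruct (boundedC_bounded p w BW) as [M B], (weightedC_weighted n _ u HU) as [Om HM].
    exists (fun x => M * Om x); apply weighted_le with (3 := HM).
    - apply Rle_trans with (2 := B 0 (Rle_refl 0)), Rabs_pos.
    - intros x Hx; unfold q; rewrite Rabs_mult, Rmult_comm.
      apply Rmult_le_compat_r; auto using Rabs_pos. }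
  destruct Wq as [Om HM]; apply weighted_majorant in HM.
  pose proof (boundedC_continuous p q Hq) as Cq.
  destruct (Rtail_spec q Om 0 Cq HM) as [D [L _]].
  set (gam := fun x => - lambda * Rtail q x).
  assert (Dg : forall x, is_derive gam x (lambda * q x)).
  { intros x; eapply is_derive_eq; [apply (is_derive_scal (Rtail q)), D | ring]. }
  assert (Bg : boundedC (S p) gam).
  { split; [intros x; exact (is_derive_continuous _ _ _ (Dg x))|]; split.
    - exists (1 * Om 0); intros x Hx; unfold gam; rewrite Rabs_mult, Rabs_Ropp.
      apply Rmult_le_compat; auto using Rabs_pos.
      eapply Rle_trans; [apply re_le_Cmod|].
      eapply Rle_trans; [apply (tail_bound _ Om 0 (contC_RtoC q Cq) HM x Hx)|].
      apply (majorant_decr _ _ _ HM); lra.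
    - exists (fun x => lambda * q x); split; [exact Dg|].
      apply boundedC_mult; [apply boundedC_const | exact Hq]. }
  pose proof HW as [Cw [_ [w' [Dw Hw']]]].
  (* Written as a product with [-1 * gam], in the form that [weightedC_mult] gives. *)
  set (w1 := fun x => w' x + u x * (-1 * gam x)).
  assert (HW1 : weightedC n p w1).
  { apply weightedC_plus; [exact Hw'|]; apply weightedC_mult; [now apply weightedC_pred|].
    apply boundedC_mult; [apply boundedC_const | now apply boundedC_pred]. }
  (* [pick true] selects the coefficient of the first component. *)
  exists w1, (w 0, gam 0); split; [exact HW1|].
  intros b k Hk Hk0.
  destruct (trace_sol n _ w k HW Hk) as [f [g [S1 [E1 E2]]]].
  destruct (trace_sol n _ w1 k HW1 Hk) as [f1 [g1 [[D1 [G1 [V1 U1]]] [E3 E4]]]].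
  assert (Hik : (2 * Ci * k)%C <> RtoC 0).
  { apply Cmult_neq_0; [apply Cmult_neq_0|exact Hk0].
    - intros H; apply RtoC_inj in H; lra.
    - exact Ci_nz. }
  assert (Vw : vanish (fun x => RtoC (w x))).
  { apply eps_is_lim_0; intros eps He.
    destruct (is_lim_0_eps _ (weightedC_lim n p w HW) eps He) as [B HB].
    exists B; intros x Hx; rewrite Cmod_R, Rabs_Rabsolu; now apply HB. }
  assert (Vg : vanish (fun x => RtoC (gam x))).
  { apply eps_is_lim_0; intros eps He.
    destruct (is_lim_0_eps _ (is_lim_0_scal (- lambda) _ L) eps He) as [B HB].
    exists B; intros x Hx; rewrite Cmod_R, Rabs_Rabsolu; now apply HB. }
  assert (S2 : sol lambda u k (fun x => RtoC (w x))
     (fun x => / (2 * Ci * k) * (RtoC (w x) + f1 x))%C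
     (fun x => / (2 * Ci * k) * (RtoC (gam x) + g1 x))%C).
  { split; [|split; [|split; apply vanish_scal; now apply vanish_plus]];
      intros x; eapply derivC_eq.
    - exact (derivC_scal _ _ _ _ (derivC_plus _ _ _ _ _ (derivC_RtoC _ _ _ (Dw x)) (D1 x))).
    - unfold w1; rewrite RtoC_plus, !RtoC_mult; field; exact (conj Hk0 Ci_nz).
    - exact (derivC_scal _ _ _ _ (derivC_plus _ _ _ _ _ (derivC_RtoC _ _ _ (Dg x)) (G1 x))).
    - unfold q; rewrite !RtoC_mult; field; exact (conj Hk0 Ci_nz). }
  destruct (sol_unique lambda u mu Hlam Hmu Hmu0 k _ _ _ _ _ Hk S1 S2 0) as [A B].
  destruct b; simpl pick; [rewrite E1, A, E3 | rewrite E2, B, E4]; field; exact (conj Hk0 Ci_nz).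
Qed.

Lemma expansion (n p : nat) : forall w,
  weightedC n p u -> weightedC n p w ->
  exists (c : bool -> nat -> C) w1, (forall b, c b O = RtoC 0) /\ weightedC n 0 w1 /\
    forall b k, Im k <= 0 -> k <> RtoC 0 ->
      trace w b 0 k = (lpoly (c b) p k + trace w1 b 0 k / (2 * Ci * k) ^ p)%C.
Proof.
  induction p as [|p IH]; intros w HU HW.
  - exists (fun _ _ => RtoC 0), w; split; [reflexivity|]; split; [exact HW|].
    intros b k _ _; simpl; field; apply C1_nz.
  - destruct (expansion_step n p w HU HW) as [w1 [v [HW1 E1]]].
    destruct (IH w1 (weightedC_pred _ _ _ HU) HW1) as [c [w2 [Hc [HW2 E2]]]].
    set (c'' := fun b l => match l with O => RtoC (pick b v) | S _ => c b l end).
    exists (fun b l => match l with O => RtoC 0 | S i => / (2 * Ci) * c'' b i end)%C, w2.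
    split; [reflexivity|]; split; [exact HW2|].
    intros b k Hk Hk0; rewrite E1, E2 by assumption.
    rewrite lpoly_shift by exact Hk0.
    rewrite lpoly_scal, (lpoly_head (c'' b) (c b)) by reflexivity.
    rewrite Hc; simpl c''; rewrite Cpow_S.
    assert (H2 : RtoC 2 <> RtoC 0) by (intros H; apply RtoC_inj in H; lra).
    pose proof Ci_nz as Hi.
    assert (Hp : ((2 * Ci * k) ^ p)%C <> RtoC 0)
      by (apply Cpow_nz; repeat apply Cmult_neq_0; assumption).
    field; auto.
Qed.

End Expansion.

(** * Complex derivatives along a half-plane *)

Lemma deriv_on_cont (D : C -> Prop) (F : C -> C) (k l : C) :
  deriv_on D F k l -> cont_on D F k.
Proof.
  intros H eps He; destruct (H 1 Rlt_0_1) as [d [Hd B]].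
  pose proof (Cmod_ge_0 l) as Hl.
  exists (Rmin d (eps / (1 + Cmod l))); split.
  - apply Rmin_glb_lt; [exact Hd | apply Rdiv_lt_0_compat; lra].
  - intros k' Dk Hk'; pose proof (Rmin_l d (eps / (1 + Cmod l)));
      pose proof (Rmin_r d (eps / (1 + Cmod l))).
    specialize (B k' Dk ltac:(lra)).
    replace (F k' - F k)%C with ((F k' - F k - (k' - k) * l) + (k' - k) * l)%C by ring.
    eapply Rle_trans; [apply Cmod_triangle|]; rewrite Cmod_mult.
    apply Rle_trans with ((1 + Cmod l) * Cmod (k' - k)); [lra|].
    apply Rle_trans with ((1 + Cmod l) * (eps / (1 + Cmod l)));
      [apply Rmult_le_compat_l; lra|].
    apply Req_le; field; lra.
Qed.

Lemma deriv_on_eq (D : C -> Prop) (F : C -> C) (k l l' : C) :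
  deriv_on D F k l -> l = l' -> deriv_on D F k l'.
Proof. now intros H <-. Qed.

Lemma deriv_on_local (D D' : C -> Prop) (F G : C -> C) (k l : C) (r : R) :
  0 < r -> F k = G k ->
  (forall k', D' k' -> Cmod (k' - k) < r -> D k' /\ F k' = G k') ->
  deriv_on D F k l -> deriv_on D' G k l.
Proof.
  intros Hr Ek E H eps He; destruct (H eps He) as [d [Hd B]].
  exists (Rmin d r); split; [now apply Rmin_glb_lt|].
  intros k' Dk Hk'; pose proof (Rmin_l d r); pose proof (Rmin_r d r).
  destruct (E k' Dk ltac:(lra)) as [Dk' Ek'].
  rewrite <- Ek, <- Ek'; apply B; [exact Dk' | lra].
Qed.

Lemma deriv_on_const (D : C -> Prop) (c k : C) : deriv_on D (fun _ => c) k (RtoC 0).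
Proof.
  intros eps He; exists 1; split; [lra|]; intros k' _ _.
  replace (c - c - (k' - k) * 0)%C with (RtoC 0) by ring; rewrite Cmod_0.
  apply Rmult_le_pos; [lra | apply Cmod_ge_0].
Qed.

Lemma deriv_on_plus (D : C -> Prop) (F G : C -> C) (k l m : C) :
  deriv_on D F k l -> deriv_on D G k m -> deriv_on D (fun z => F z + G z)%C k (l + m)%C.
Proof.
  intros HF HG eps He.
  destruct (HF (eps / 2)) as [d [Hd B]]; [lra|].
  destruct (HG (eps / 2)) as [d' [Hd' B']]; [lra|].
  exists (Rmin d d'); split; [now apply Rmin_glb_lt|].
  intros k' Dk Hk'; pose proof (Rmin_l d d'); pose proof (Rmin_r d d').
  specialize (B k' Dk ltac:(lra)); specialize (B' k' Dk ltac:(lra)).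
  replace (F k' + G k' - (F k + G k) - (k' - k) * (l + m))%C
    with ((F k' - F k - (k' - k) * l) + (G k' - G k - (k' - k) * m))%C by ring.
  eapply Rle_trans; [apply Cmod_triangle|]; lra.
Qed.

Lemma deriv_on_mult (D : C -> Prop) (F G : C -> C) (k l m : C) :
  deriv_on D F k l -> deriv_on D G k m ->
  deriv_on D (fun z => F z * G z)%C k (l * G k + F k * m)%C.
Proof.
  intros HF HG eps He.
  pose proof (deriv_on_cont _ _ _ _ HG) as CG.
  pose proof (Cmod_ge_0 (F k)) as Fk; pose proof (Cmod_ge_0 l) as Hl;
    pose proof (Cmod_ge_0 (G k)) as Gk.
  destruct (HF (eps / 3 / (1 + Cmod (G k)))) as [d1 [Hd1 B1]];
    [apply Rdiv_lt_0_compat; lra|].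
  destruct (HG (eps / 3 / (1 + Cmod (F k)))) as [d2 [Hd2 B2]];
    [apply Rdiv_lt_0_compat; lra|].
  destruct (CG (Rmin 1 (eps / 3 / (1 + Cmod l)))) as [d3 [Hd3 B3]];
    [apply Rmin_glb_lt; [lra | apply Rdiv_lt_0_compat; lra]|].
  exists (Rmin d1 (Rmin d2 d3)); split; [repeat apply Rmin_glb_lt; assumption|].
  intros k' Dk Hk'.
  pose proof (Rmin_l d1 (Rmin d2 d3)); pose proof (Rmin_r d1 (Rmin d2 d3)).
  pose proof (Rmin_l d2 d3); pose proof (Rmin_r d2 d3).
  specialize (B1 k' Dk ltac:(lra)); specialize (B2 k' Dk ltac:(lra));
    specialize (B3 k' Dk ltac:(lra)).
  pose proof (Rmin_l 1 (eps / 3 / (1 + Cmod l))).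
  pose proof (Rmin_r 1 (eps / 3 / (1 + Cmod l))).
  set (t := Cmod (k' - k)) in *; assert (Ht : 0 <= t) by apply Cmod_ge_0.
  assert (BG : Cmod (G k') <= 1 + Cmod (G k)).
  { replace (G k') with ((G k' - G k) + G k)%C by ring.
    eapply Rle_trans; [apply Cmod_triangle|]; lra. }
  match goal with |- Cmod ?z <= _ => replace z with
    ((F k' - F k - (k' - k) * l) * G k' + ((k' - k) * l * (G k' - G k) +
      F k * (G k' - G k - (k' - k) * m)))%C by ring end.
  eapply Rle_trans; [apply Cmod_triangle|].
  eapply Rle_trans; [apply Rplus_le_compat_l, Cmod_triangle|].
  rewrite !Cmod_mult; fold t.
  assert (K : forall a, 0 <= a -> eps / 3 / (1 + a) * a <= eps / 3).
  { intros a Ha; apply Rmult_le_reg_r with (1 + a); [lra|].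
    replace (eps / 3 / (1 + a) * a * (1 + a)) with (eps / 3 * a) by (field; lra); nra. }
  assert (T1 : Cmod (F k' - F k - (k' - k) * l) * Cmod (G k') <= eps / 3 * t).
  { apply Rle_trans with (eps / 3 / (1 + Cmod (G k)) * t * (1 + Cmod (G k))).
    - apply Rmult_le_compat; auto using Cmod_ge_0.
    - apply Req_le; field; lra. }
  assert (T2 : t * Cmod l * Cmod (G k' - G k) <= eps / 3 * t).
  { apply Rle_trans with (t * (eps / 3 / (1 + Cmod l) * Cmod l)).
    - assert (0 <= t * Cmod l) by (apply Rmult_le_pos; lra).
      assert (t * Cmod l * Cmod (G k' - G k) <= t * Cmod l * (eps / 3 / (1 + Cmod l)))
        by (apply Rmult_le_compat_l; lra); lra.
    - specialize (K _ Hl); nra. }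
  assert (T3 : Cmod (F k) * Cmod (G k' - G k - (k' - k) * m) <= eps / 3 * t).
  { apply Rle_trans with (Cmod (F k) * (eps / 3 / (1 + Cmod (F k)) * t)).
    - now apply Rmult_le_compat_l.
    - specialize (K _ Fk); nra. }
  lra.
Qed.

Lemma deriv_on_inv (D : C -> Prop) (k : C) :
  k <> RtoC 0 -> deriv_on D Cinv k (- / (k * k))%C.
Proof.
  intros Hk eps He.
  assert (Hm : 0 < Cmod k) by now apply Cmod_gt_0.
  exists (Rmin (Cmod k / 2) (eps * (Cmod k ^ 3 / 2))); split.
  - apply Rmin_glb_lt; [lra|]; apply Rmult_lt_0_compat; [exact He|].
    pose proof (pow_lt _ 3 Hm); lra.
  - intros k' _ H.
    pose proof (Rmin_l (Cmod k / 2) (eps * (Cmod k ^ 3 / 2)));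
      pose proof (Rmin_r (Cmod k / 2) (eps * (Cmod k ^ 3 / 2))).
    assert (Hk2 : Cmod k / 2 <= Cmod k').
    { assert (Cmod k <= Cmod (k' - k) + Cmod k'); [|lra].
      rewrite Cmod_minus_sym; replace k with ((k - k') + k')%C at 1 by ring.
      apply Cmod_triangle. }
    assert (Hk' : k' <> RtoC 0) by (apply Cmod_gt_0; lra).
    replace (/ k' - / k - (k' - k) * - / (k * k))%C
      with ((k' - k) * ((k' - k) / (k * k * k')))%C by (field; auto).
    rewrite Cmod_mult, Rmult_comm.
    apply Rmult_le_compat_r; [apply Cmod_ge_0|].
    rewrite Cmod_div, !Cmod_mult by (repeat apply Cmult_neq_0; assumption).
    set (t := Cmod (k' - k)) in *.
    assert (P : 0 < Cmod k * Cmod k) by nra.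
    apply Rmult_le_reg_r with (Cmod k * Cmod k * Cmod k'); [apply Rmult_lt_0_compat; lra|].
    replace (t / (Cmod k * Cmod k * Cmod k') * (Cmod k * Cmod k * Cmod k')) with t
      by (field; lra).
    apply Rle_trans with (eps * (Cmod k ^ 3 / 2)); [lra|].
    apply Rmult_le_compat_l; [lra|].
    simpl; nra.
Qed.

(** One may leave any point of the closed half-plane in the direction [-i]. *)
Lemma deriv_on_lower_unique (F : C -> C) (k l l' : C) :
  Im k <= 0 -> deriv_on closed_lower F k l -> deriv_on closed_lower F k l' -> l = l'.
Proof.
  intros Hk H H'.
  enough (Cmod (l - l') <= 0) as E.
  { assert (l - l' = 0)%C as E' by (apply Cmod_eq_0; pose proof (Cmod_ge_0 (l - l')); lra).
    replace l with (l - l' + l')%C by ring; rewrite E'; ring. }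
  apply Rnot_lt_le; intros Hp; set (e := Cmod (l - l')) in *.
  destruct (H (e / 3)) as [d [Hd B]]; [lra|].
  destruct (H' (e / 3)) as [d' [Hd' B']]; [lra|].
  set (t := Rmin d d' / 2).
  assert (Ht : 0 < t) by (unfold t; pose proof (Rmin_glb_lt d d' 0 Hd Hd'); lra).
  pose proof (Rmin_l d d'); pose proof (Rmin_r d d').
  set (k' := (k - RtoC t * Ci)%C).
  assert (E : Cmod (k' - k) = t).
  { unfold k'; replace (k - t * Ci - k)%C with (- (t * Ci))%C by ring.
    rewrite Cmod_opp, Cmod_mult, Cmod_Ci, Cmod_R, Rabs_pos_eq by lra; ring. }
  assert (L : closed_lower k').
  { unfold closed_lower, k', Im, Ci, RtoC, Cminus, Cplus, Copp, Cmult in *; simpl; lra. }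
  specialize (B k' L); specialize (B' k' L); rewrite E in B, B'.
  specialize (B ltac:(unfold t; lra)); specialize (B' ltac:(unfold t; lra)).
  assert (T : Cmod ((k' - k) * (l - l')) <= 2 * (e / 3 * t)).
  { replace ((k' - k) * (l - l'))%C with
      (- (F k' - F k - (k' - k) * l) + (F k' - F k - (k' - k) * l'))%C by ring.
    eapply Rle_trans; [apply Cmod_triangle|]; rewrite Cmod_opp; lra. }
  rewrite Cmod_mult, E in T; fold e in T; nra.
Qed.

Definition everywhere (_ : C) : Prop := True.

Lemma is_C_derive_intro (F : C -> C) (k l : C) :
  deriv_on everywhere F k l -> is_C_derive F k l.
Proof.
  intros H; split; [apply is_linear_scal_l|].
  intros x Hx [eps He].
  assert (E : k = x) by exact (is_filter_lim_locally_unique (K := C_AbsRing) (V := AbsRing_NormedModule C_AbsRing) k x Hx).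
  destruct (H eps He) as [d [Hd B]].
  exists (mkposreal d Hd); intros y Hy.
  change (Cmod (y - k) < d) in Hy.
  rewrite <- E; exact (B y I Hy).
Qed.

Lemma C_derive_n_chain (D : C -> Prop) (f : C -> C) (F : nat -> C -> C) (n : nat) :
  (forall k, D k -> exists r, 0 < r /\ forall k', Cmod (k' - k) < r -> D k') ->
  (forall k, D k -> f k = F O k) ->
  (forall j k, (j < n)%nat -> D k -> deriv_on everywhere (F j) k (F (S j) k)) ->
  forall j k, (j <= n)%nat -> D k -> C_derive_n f j k = F j k /\ is_C_derive_n f j k (F j k).
Proof.
  intros Op E0 H j; induction j as [|j IH]; intros k Hj Dk.
  - split; apply E0, Dk.
  - assert (A : is_C_derive (C_derive_n f j) k (F (S j) k)).
    { apply is_C_derive_intro; destruct (Op k Dk) as [r [Hr Op']].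
      apply deriv_on_local with (D := everywhere) (F := F j) (r := r); [exact Hr | | |].
      - symmetry; apply IH; [lia | exact Dk].
      - intros k' _ Hk'; split; [exact I|].
        symmetry; apply IH; [lia | now apply Op'].
      - apply H; [lia | exact Dk]. }
    split; [exact (is_C_derive_unique _ _ _ A) | exact A].
Qed.

Lemma lower_open (k : C) :
  Im k < 0 -> exists r, 0 < r /\ forall k', Cmod (k' - k) < r -> Im k' < 0.
Proof.
  intros Hk; exists (- Im k); split; [lra|]; intros k' H.
  pose proof (Rabs_Im_le (k' - k)) as B.
  change (Im (k' - k)%C) with (Im k' - Im k) in B.
  pose proof (Rle_abs (Im k' - Im k)); lra.
Qed.

Lemma punctured_open (k : C) :
  k <> RtoC 0 -> exists r, 0 < r /\ forall k', Cmod (k' - k) < r -> k' <> RtoC 0.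
Proof.
  intros Hk; exists (Cmod k); split; [now apply Cmod_gt_0|].
  intros k' H E; rewrite E in H; replace (0 - k)%C with (- k)%C in H by ring.
  rewrite Cmod_opp in H; lra.
Qed.

Lemma deriv_on_interior (F : C -> C) (k l : C) :
  Im k < 0 -> deriv_on closed_lower F k l -> deriv_on everywhere F k l.
Proof.
  intros Hk; destruct (lower_open k Hk) as [r [Hr B]].
  apply deriv_on_local with (r := r); auto.
  intros k' _ Hk'; split; [unfold closed_lower; apply Rlt_le, B, Hk' | reflexivity].
Qed.

Lemma cont_on_C_continuous_on (D : C -> Prop) (F : C -> C) :
  (forall k, D k -> cont_on D F k) -> C_continuous_on D F.
Proof.
  intros H k Dk P [[eps Heps] HP].
  assert (He2 : 0 < eps / 2) by lra.
  destruct (H k Dk (eps / 2) He2) as [d [Hd B]].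
  assert (Hd2 : 0 < d / 2) by lra.
  exists (mkposreal _ Hd2); intros y [Hy1 Hy2] Dy; apply HP.
  change (Rabs (Re y - Re k) < d / 2) in Hy1.
  change (Rabs (Im y - Im k) < d / 2) in Hy2.
  assert (Hy : Cmod (y - k) < d)
    by (eapply Rle_lt_trans; [apply Cmod_le_Re_Im|];
        change (Rabs (Re y - Re k) + Rabs (Im y - Im k) < d); lra).
  specialize (B y Dy Hy).
  split.
  - change (Rabs (Re (F y - F k)%C) < eps); pose proof (re_le_Cmod (F y - F k)); lra.
  - change (Rabs (Im (F y - F k)%C) < eps); pose proof (Rabs_Im_le (F y - F k)); lra.
Qed.

(** * Laurent polynomials and decaying remainders *)

Definition dcoef (c : nat -> C) (l : nat) : C :=
  match l with O => RtoC 0 | S i => - (RtoC (INR i) * c i) end%C.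

Lemma deriv_on_inv_pow (D : C -> Prop) (l : nat) (k : C) :
  k <> RtoC 0 ->
  deriv_on D (fun z => / z ^ l)%C k (- (RtoC (INR l) * / k ^ S l))%C.
Proof.
  intros Hk.
  assert (A : deriv_on D (fun z => (/ z) ^ l)%C k (- (RtoC (INR l) * (/ k) ^ S l))%C).
  { induction l as [|l IH].
    - eapply deriv_on_eq; [exact (deriv_on_const D (RtoC 1) k) | simpl INR; ring].
    - eapply deriv_on_eq.
      + exact (deriv_on_mult D Cinv (fun z => (/ z) ^ l)%C k _ _ (deriv_on_inv D k Hk) IH).
      + rewrite S_INR, RtoC_plus, !Cpow_S.
        replace (/ (k * k))%C with (/ k * / k)%C by (field; exact Hk); ring. }
  rewrite <- Cpow_inv by exact Hk.
  destruct (punctured_open k Hk) as [r [Hr B]].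
  apply deriv_on_local with (4 := A) (r := r); auto.
  - now rewrite Cpow_inv.
  - intros k' Dk' Hk'; split; [exact Dk' | now rewrite Cpow_inv by now apply B].
Qed.

Lemma deriv_on_lpoly (D : C -> Prop) (c : nat -> C) (p : nat) (k : C) :
  k <> RtoC 0 -> deriv_on D (lpoly c p) k (lpoly (dcoef c) (S p) k).
Proof.
  intros Hk; induction p as [|p IH].
  - eapply deriv_on_eq; [exact (deriv_on_const D (c O) k)|].
    simpl; unfold Cdiv; ring.
  - eapply deriv_on_eq.
    + exact (deriv_on_plus _ _ _ _ _ _ IH
        (deriv_on_mult _ _ _ _ _ _ (deriv_on_const D (c (S p)) k)
          (deriv_on_inv_pow D (S p) k Hk))).
    + change (lpoly (dcoef c) (S (S p)) k) with
        (lpoly (dcoef c) (S p) k + dcoef c (S (S p)) / k ^ S (S p))%C.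
      unfold dcoef at 3, Cdiv; ring.
Qed.

Fixpoint dcoef_n (j : nat) (c : nat -> C) : nat -> C :=
  match j with O => c | S i => dcoef (dcoef_n i c) end.

(** The derivatives are required at every [k <> 0] because derivatives of two
    functions can be identified only where both are differentiable; only their
    size for large [k] enters the conclusions. *)
Fixpoint decaying (n q : nat) (F : C -> C) : Prop :=
  (exists M, forall k, Im k <= 0 -> 1 <= Cmod k -> Cmod (F k) <= M / Cmod k ^ q) /\
  match n with
  | O => True
  | S i => exists F', (forall k, Im k <= 0 -> k <> RtoC 0 -> deriv_on closed_lower F k (F' k)) /\
                      decaying i q F'
  end.

Lemma decaying_pred (n q : nat) : forall F, decaying (S n) q F -> decaying n q F.
Proof.
  induction n as [|n IH]; intros F [B [F' [D H]]]; (split; [exact B|]); [exact I|].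
  exists F'; split; [exact D | now apply IH].
Qed.

Lemma decaying_weaken (n q : nat) : forall F, decaying n (S q) F -> decaying n q F.
Proof.
  assert (A : forall F, (exists M, forall k, Im k <= 0 -> 1 <= Cmod k -> Cmod (F k) <= M / Cmod k ^ S q) ->
    exists M, forall k, Im k <= 0 -> 1 <= Cmod k -> Cmod (F k) <= M / Cmod k ^ q).
  { intros F [M B]; exists M; intros k Hk Hk1.
    pose proof (pow_lt (Cmod k) q ltac:(lra)) as Hp.
    pose proof (pow_lt (Cmod k) (S q) ltac:(lra)) as Hp'.
    specialize (B k Hk Hk1).
    assert (HM : 0 <= M).
    { pose proof (Cmod_ge_0 (F k)).
      assert (0 <= M / Cmod k ^ S q * Cmod k ^ S q) by (apply Rmult_le_pos; lra).
      replace (M / Cmod k ^ S q * Cmod k ^ S q) with M in * by (field; lra); assumption. }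
    eapply Rle_trans; [exact B|].
    apply Rmult_le_compat_l; [exact HM|]; apply Rinv_le_contravar; [exact Hp|].
    simpl; nra. }
  induction n as [|n IH]; intros F [B H]; (split; [now apply A|]); [exact I|].
  destruct H as [F' [D H]]; exists F'; split; [exact D | now apply IH].
Qed.

Lemma decaying_plus (n q : nat) :
  forall F G, decaying n q F -> decaying n q G -> decaying n q (fun k => F k + G k)%C.
Proof.
  induction n as [|n IH]; intros F G [[M B] H] [[M' B'] H'];
    (split; [exists (M + M'); intros k Hk Hk1; eapply Rle_trans; [apply Cmod_triangle|];
             specialize (B k Hk Hk1); specialize (B' k Hk Hk1); unfold Rdiv in *; lra|]);
    [exact I|].
  destruct H as [F' [D H]], H' as [G' [D' H']].
  exists (fun k => F' k + G' k)%C; split; [|now apply IH].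
  intros k Hk Hk0; apply deriv_on_plus; auto.
Qed.

Lemma decaying_scal (n q : nat) (c : C) :
  forall F, decaying n q F -> decaying n q (fun k => c * F k)%C.
Proof.
  induction n as [|n IH]; intros F [[M B] H];
    (split; [exists (Cmod c * M); intros k Hk Hk1; rewrite Cmod_mult; unfold Rdiv;
             rewrite Rmult_assoc; apply Rmult_le_compat_l; [apply Cmod_ge_0 | now apply B]|]);
    [exact I|].
  destruct H as [F' [D H]].
  exists (fun k => c * F' k)%C; split; [|now apply IH].
  intros k Hk Hk0; eapply deriv_on_eq.
  - exact (deriv_on_mult _ _ _ _ _ _ (deriv_on_const _ c k) (D k Hk Hk0)).
  - cbv beta; ring.
Qed.

Lemma decaying_const (n : nat) : forall c, decaying n 0 (fun _ => c).
Proof.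
  induction n as [|n IH]; intros c;
    (split; [exists (Cmod c); intros k _ _; simpl; unfold Rdiv; rewrite Rinv_1; lra|]);
    [exact I|].
  exists (fun _ => RtoC 0); split; [|apply IH].
  intros; apply deriv_on_const.
Qed.

Lemma decaying_div (n : nat) : forall q F,
  decaying n q F -> decaying n (S q) (fun k => F k * / k)%C.
Proof.
  induction n as [|n IH]; intros q F HF; pose proof HF as [[M B] H];
    (split; [exists M; intros k Hk Hk1;
       assert (Hk0 : k <> RtoC 0) by (apply Cmod_gt_0; lra);
       rewrite Cmod_mult, Cmod_inv by exact Hk0;
       specialize (B k Hk Hk1); pose proof (pow_lt (Cmod k) q ltac:(lra));
       replace (M / Cmod k ^ S q) with (M / Cmod k ^ q * / Cmod k) by (simpl; field; lra);
       apply Rmult_le_compat_r; [apply Rlt_le, Rinv_0_lt_compat; lra | exact B]|]);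
    [exact I|].
  destruct H as [F' [D H]].
  exists (fun k => F' k * / k + (- RtoC 1) * (F k * / k * / k))%C; split.
  - intros k Hk Hk0; eapply deriv_on_eq.
    + exact (deriv_on_mult _ _ _ _ _ _ (D k Hk Hk0) (deriv_on_inv _ k Hk0)).
    + field; exact Hk0.
  - apply decaying_plus; [now apply IH|].
    apply decaying_scal, decaying_weaken, (IH (S q) (fun k => F k * / k)%C), IH.
    now apply decaying_pred.
Qed.

Lemma decaying_ext (n q : nat) : forall F G : C -> C,
  (forall k, F k = G k) -> decaying n q F -> decaying n q G.
Proof.
  induction n as [|n IH]; intros F G E [[M B] H];
    (split; [exists M; intros k; rewrite <- E; apply B|]); [exact I|].
  destruct H as [F' [D H]]; exists F'; split; [|exact H].
  intros k Hk Hk0; apply deriv_on_local with (D := closed_lower) (F := F) (r := 1); auto; lra.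
Qed.

Lemma decaying_div_pow (n p : nat) (F : C -> C) :
  decaying n 0 F -> decaying n p (fun k => F k * (/ k) ^ p)%C.
Proof.
  intros H; induction p as [|p IH].
  - apply decaying_ext with (2 := H); intros k; simpl; ring.
  - apply decaying_ext with (2 := decaying_div n p _ IH); intros k; rewrite Cpow_S; ring.
Qed.

Lemma decaying_chain (n q : nat) : forall F,
  decaying n q F ->
  exists G : nat -> C -> C, (forall k, G O k = F k) /\
    (forall j k, (j < n)%nat -> Im k <= 0 -> k <> RtoC 0 ->
       deriv_on closed_lower (G j) k (G (S j) k)) /\
    forall j, (j <= n)%nat ->
      exists M, forall k, Im k <= 0 -> 1 <= Cmod k -> Cmod (G j k) <= M / Cmod k ^ q.
Proof.
  induction n as [|n IH]; intros F [B H].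
  - exists (fun _ => F); split; [reflexivity|]; split; [intros; lia|].
    intros; exact B.
  - destruct H as [F' [D H]]; destruct (IH F' H) as [G [E [DG BG]]].
    exists (fun j => match j with O => F | S i => G i end).
    split; [reflexivity|]; split.
    + intros [|j] k Hj Hk Hk0; [rewrite E; now apply D | apply DG; auto; lia].
    + intros [|j] Hj; [exact B | apply BG; lia].
Qed.

Lemma inv_poly_lpoly (c0 : C) (c : nat -> C) (m : nat) (k : C) :
  inv_poly c0 c m k = lpoly (fun l => match l with O => c0 | S _ => c l end) m k.
Proof.
  unfold inv_poly; induction m as [|m IH].
  - rewrite sum_n_m_zero by lia; simpl; exact (Cplus_0_r c0).
  - rewrite sum_n_Sm by lia; simpl lpoly; rewrite <- IH.
    unfold plus; simpl; ring.
Qed.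

(** Two descriptions of the same function meet here: the functions [E j] are
    continuous up to the real axis, origin included, while the decomposition
    [inv_poly + Psi] controls the size of the derivatives for large [k]. They
    agree away from the origin by uniqueness of derivatives. *)
Lemma expansion_derivatives (f : C -> C) (E : nat -> C -> C) (n m q : nat)
  (c0 : C) (c : nat -> C) (Psi : C -> C) :
  (1 <= n)%nat ->
  (forall k, Im k <= 0 -> f k = E O k) ->
  (forall j k, (j < n)%nat -> Im k <= 0 -> deriv_on closed_lower (E j) k (E (S j) k)) ->
  (forall j k, (j <= n)%nat -> Im k <= 0 -> cont_on closed_lower (E j) k) ->
  decaying n q Psi ->
  (forall k, Im k <= 0 -> k <> RtoC 0 -> f k = (inv_poly c0 c m k + Psi k)%C) ->
  C_continuous_on closed_lower f /\
  C_analytic_on (fun k => Im k < 0) f /\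
  O_inv_pow q (fun k => f k - inv_poly c0 c m k)%C /\
  forall j, (1 <= j <= n)%nat -> derivative_asymptotics f (inv_poly c0 c m) j q.
Proof.
  intros Hn Ef DE CE HP Ex.
  destruct (decaying_chain n q Psi HP) as [G [EG [DG BG]]].
  set (c' := fun l => match l with O => c0 | S _ => c l end).
  set (P := fun j => lpoly (dcoef_n j c') (m + j)).
  assert (DP : forall D j k, k <> RtoC 0 -> deriv_on D (P j) k (P (S j) k)).
  { intros D j k Hk0; unfold P; rewrite <- plus_n_Sm; simpl dcoef_n.
    now apply deriv_on_lpoly. }
  assert (EP : forall k, inv_poly c0 c m k = P O k)
    by (intros k; unfold P; rewrite Nat.add_0_r; apply inv_poly_lpoly).
  assert (Main : forall j k, (j <= n)%nat -> Im k <= 0 -> k <> RtoC 0 ->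
    E j k = (P j k + G j k)%C).
  { intros j; induction j as [|j IH]; intros k Hj Hk Hk0.
    - rewrite <- Ef, Ex, EP, EG by assumption; reflexivity.
    - apply deriv_on_lower_unique with (E j) k; [exact Hk | apply DE; auto; lia |].
      destruct (punctured_open k Hk0) as [r [Hr B]].
      apply deriv_on_local with (D := closed_lower) (F := fun z => (P j z + G j z)%C) (r := r).
      + exact Hr.
      + symmetry; apply IH; auto; lia.
      + intros k' Lk' Hk'; split; [exact Lk'|].
        symmetry; apply IH; [lia | exact Lk' | now apply B].
      + apply deriv_on_plus; [now apply DP | apply DG; auto; lia]. }
  assert (DC : forall j k, (j <= n)%nat -> k <> RtoC 0 ->
     C_derive_n (inv_poly c0 c m) j k = P j k).
  { intros j k Hj Hk0.
    apply (C_derive_n_chain (fun k => k <> RtoC 0) _ P n punctured_open); auto. }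
  assert (K : forall j, (j <= n)%nat ->
    O_inv_pow q (fun k => E j k - C_derive_n (inv_poly c0 c m) j k)%C).
  { intros j Hj; destruct (BG j Hj) as [M B]; exists 1, M; split; [lra|].
    intros k Hk Hk1; assert (Hk0 : k <> RtoC 0) by (apply Cmod_gt_0; lra).
    rewrite Main, DC by assumption.
    replace (P j k + G j k - P j k)%C with (G j k) by ring; now apply B. }
  assert (DI : forall j k, (j < n)%nat -> Im k < 0 -> deriv_on everywhere (E j) k (E (S j) k)).
  { intros j k Hj Hk; apply deriv_on_interior; [exact Hk | apply DE; auto; lra]. }
  assert (DN := C_derive_n_chain (fun k => Im k < 0) f E n lower_open
    (fun k Hk => Ef k (Rlt_le _ _ Hk)) DI).
  split; [|split; [|split]].
  - apply cont_on_C_continuous_on; intros k Hk eps He.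
    destruct (CE O k ltac:(lia) Hk eps He) as [d [Hd B]]; exists d; split; [exact Hd|].
    intros k' Lk' Hk'; rewrite !Ef by assumption; now apply B.
  - intros k Hk; exists (E 1%nat k); apply (DN 1%nat k Hn Hk).
  - destruct (K O ltac:(lia)) as [M [M' [HM B]]]; exists M, M'; split; [exact HM|].
    intros k Hk Hk1; rewrite Ef by exact Hk; exact (B k Hk Hk1).
  - intros j [Hj1 Hj]; exists (E j); split; [|split].
    + intros k Hk; apply (DN j k Hj Hk).
    + apply cont_on_C_continuous_on; intros k Hk; now apply CE.
    + now apply K.
Qed.

(** * Extension of the potential to the line *)

Lemma Rmax0_lip (x y : R) : Rabs (Rmax 0 y - Rmax 0 x) <= Rabs (y - x).
Proof.
  unfold Rmax; destruct (Rle_dec 0 y), (Rle_dec 0 x); unfold Rabs;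
    repeat destruct (Rcase_abs _); lra.
Qed.

Lemma continuous_halfline (D : R -> R) (x : R) :
  continuous_on (fun x => 0 <= x) D -> continuous (fun t => D (Rmax 0 t)) x.
Proof.
  intros H P [eps HP].
  destruct (H (Rmax 0 x) (Rmax_l 0 x) P (ex_intro _ eps HP)) as [d Hd].
  exists d; intros y Hy; apply Hd; [|apply Rmax_l].
  eapply Rle_lt_trans; [exact (Rmax0_lip x y) | exact Hy].
Qed.

Lemma is_derive_of_halfline (D : R -> R) (x l : R) :
  0 < x -> is_derive_halfline D x l -> is_derive (fun t => D (Rmax 0 t)) x l.
Proof.
  intros Hx H; apply is_derive_Reals; intros eps He.
  destruct (H (fun y => Rabs (y - l) < eps)) as [d Hd].
  { exists (mkposreal eps He); intros y Hy; exact Hy. }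
  assert (Hd' : 0 < Rmin d x) by (apply Rmin_glb_lt; [apply cond_pos | exact Hx]).
  exists (mkposreal _ Hd'); intros h Hh Hh'; simpl in Hh'.
  pose proof (Rmin_l d x); pose proof (Rmin_r d x).
  assert (0 <= x + h) by (apply Rabs_def2 in Hh'; lra).
  rewrite !Rmax_right by lra.
  specialize (Hd (x + h)).
  replace (x + h - x) with h in Hd by ring.
  apply Hd; [|lra|lra].
  change (Rabs (x + h - x) < d); replace (x + h - x) with h by ring; lra.
Qed.

(** The derivative of highest order is extended by a constant, the other ones by
    integration; on [x >= 0] the primitives agree with the given functions since
    the difference is continuous with zero derivative inside. *)
Lemma halfline_extension (p : nat) : forall D : nat -> R -> R,
  (forall i x, (i < p)%nat -> 0 <= x -> is_derive_halfline (D i) x (D (S i) x)) ->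
  (forall i, (i <= p)%nat -> continuous_on (fun x => 0 <= x) (D i)) ->
  exists V : nat -> R -> R,
    (forall i x, (i <= p)%nat -> 0 <= x -> V i x = D i x) /\
    (forall i x, (i < p)%nat -> is_derive (V i) x (V (S i) x)) /\
    (forall i x, (i <= p)%nat -> continuous (V i) x).
Proof.
  induction p as [|p IH]; intros D HD HC.
  - exists (fun i x => D i (Rmax 0 x)); split; [|split].
    + intros i x _ Hx; now rewrite Rmax_right.
    + intros; lia.
    + intros i x Hi; apply continuous_halfline, HC, Hi.
  - destruct (IH (fun i => D (S i))) as [V [E [DV CV]]].
    { intros i x Hi Hx; apply HD; [lia | exact Hx]. }
    { intros i Hi; apply HC; lia. }
    set (V0 := fun x => D O 0 + RInt (V O) 0 x).
    assert (DV0 : forall x, is_derive V0 x (V O x)).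
    { intros x; eapply is_derive_eq.
      - apply (is_derive_plus (V := R_NormedModule) (fun _ => D O 0) (fun x => RInt (V O) 0 x)).
        + exact (is_derive_const (D O 0 : R_NormedModule) x).
        + apply is_derive_primitive; intros t; apply CV; lia.
      - unfold plus, zero; simpl; ring. }
    assert (E0 : forall x, 0 <= x -> V0 x = D O x).
    { intros x Hx.
      set (h := fun t => D O (Rmax 0 t) - V0 t).
      destruct (MVT_gen h 0 x (fun _ => 0)) as [c [_ Hc]].
      - rewrite Rmin_left, Rmax_right by assumption; intros t Ht.
        eapply is_derive_eq.
        + apply (is_derive_minus (V := R_NormedModule) (fun t => D O (Rmax 0 t)) V0);
            [apply is_derive_of_halfline; [lra | apply HD; [lia | lra]] | apply DV0].
        + rewrite <- (E O t) by (lia || lra).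
          unfold minus, plus, opp; simpl; ring.
      - intros t _; apply continuity_pt_filterlim.
        apply (continuous_minus (V := R_NormedModule) (fun t => D O (Rmax 0 t)) V0).
        + apply continuous_halfline, HC; lia.
        + exact (is_derive_continuous _ _ _ (DV0 t)).
      - unfold h in Hc; rewrite !Rmax_right in Hc by lra.
        assert (V0 0 = D O 0) as E00
          by (unfold V0; rewrite RInt_point; unfold zero; simpl; ring).
        lra. }
    exists (fun i => match i with O => V0 | S j => V j end); split; [|split].
    + intros [|i] x Hi Hx; [now apply E0 | apply E; [lia | exact Hx]].
    + intros [|i] x Hi; [apply DV0 | apply DV; lia].
    + intros [|i] x Hi; [exact (is_derive_continuous _ _ _ (DV0 x)) | apply CV; lia].
Qed.

Lemma ex_RInt_gen_limit (phi psi : R -> R) :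
  (forall x, continuous phi x) -> (forall x, 0 <= x -> phi x = psi x) ->
  ex_RInt_gen psi (at_point 0) (Rbar_locally p_infty) ->
  exists l : R, is_lim (fun b => RInt phi 0 b) p_infty l.
Proof.
  intros Hc E [l H]; exists l; intros P HP.
  destruct (H P HP) as [Q T HQ [B HT] HQT].
  exists (Rmax 0 B); intros b Hb.
  pose proof (Rmax_l 0 B); pose proof (Rmax_r 0 B).
  destruct (HQT 0 b HQ (HT b ltac:(lra))) as [I [HI PI]]; simpl in HI.
  replace (RInt phi 0 b) with I; [exact PI|].
  symmetry; apply is_RInt_unique.
  apply is_RInt_ext with (2 := HI); intros x Hx.
  rewrite Rmin_left in Hx by lra; symmetry; apply E; lra.
Qed.

Lemma L1_weighted (n : nat) (v d : R -> R) :
  (forall x, continuous v x) -> (forall x, 0 <= x -> v x = d x) ->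
  L1_halfline (fun x => (1 + x) ^ n * d x) -> exists Om, weighted n v Om.
Proof.
  intros Hc E H.
  set (phi := fun x => Rabs ((1 + x) ^ n * v x)).
  assert (Cphi : forall x, continuous phi x).
  { intros x; apply continuous_Rabs_comp, continuous_Rmult;
      [apply continuous_1x_pow | apply Hc]. }
  destruct (ex_RInt_gen_limit phi (fun x => Rabs ((1 + x) ^ n * d x)) Cphi) as [l Hl];
    [|exact H|].
  { intros x Hx; unfold phi; now rewrite E. }
  exists (fun x => l - RInt phi 0 x); split.
  - exists (fun x => 0 - phi x); intros x Hx; split.
    + apply (is_derive_minus (V := R_NormedModule) (fun _ => l) (fun x => RInt phi 0 x)).
      * exact (is_derive_const (l : R_NormedModule) x).
      * now apply is_derive_primitive.
    + rewrite Cmod_R; fold (phi x); lra.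
  - replace (Finite 0) with (Finite (l - l)) by (f_equal; ring).
    apply is_lim_minus with (1 := is_lim_const _ _) (2 := Hl); reflexivity.
Qed.

Lemma potential_extension (p n : nat) (u : R -> R) (Du : nat -> R -> R) :
  Cp_halfline p u Du ->
  (forall i, (i <= p)%nat -> L1_halfline (fun x => (1 + x) ^ n * Du i x)) ->
  exists v, (forall x, 0 <= x -> v x = u x) /\ weightedC n p v.
Proof.
  intros [E0 [HD HC]] HL.
  destruct (halfline_extension p Du HD HC) as [V [E [DV CV]]].
  exists (V O); split; [intros x Hx; rewrite E by (lia || lra); now apply E0|].
  assert (A : forall j i, (i + j = p)%nat -> weightedC n j (V i)).
  { intros j; induction j as [|j IH]; intros i Hij;
      (split; [intros x; apply CV; lia|]);
      (split; [apply L1_weighted with (Du i);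
         [intros x; apply CV; lia | intros x Hx; apply E; [lia | exact Hx] | apply HL; lia]|]).
    - exact I.
    - exists (V (S i)); split; [intros x; apply DV; lia | apply IH; lia]. }
  apply A; lia.
Qed.

(** * Improper integrals of complex functions *)

Lemma is_RInt_derivC (H h : R -> C) (a b : R) :
  (forall x, Rmin a b <= x <= Rmax a b -> derivC H x (h x)) -> contC h ->
  @is_RInt C_R_NormedModule h a b (H b - H a)%C.
Proof.
  intros D Ch.
  apply (is_RInt_fct_extend_pair (U := R_NormedModule) (V := R_NormedModule) h a b
    (Re (H b) - Re (H a)) (Im (H b) - Im (H a))).
  - apply (is_RInt_derive (V := R_CompleteNormedModule) (fun x => Re (H x))); intros x Hx;
      [apply D, Hx | apply Ch].
  - apply (is_RInt_derive (V := R_CompleteNormedModule) (fun x => Im (H x))); intros x Hx;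
      [apply D, Hx | apply Ch].
Qed.

Lemma locally_C_Cmod (z : C) (P : C -> Prop) :
  @locally C_R_NormedModule z P ->
  exists eps, 0 < eps /\ forall z', Cmod (z' - z) < eps -> P z'.
Proof.
  intros [[eps He] HP]; exists eps; split; [exact He|].
  intros z' Hz'; apply HP; split.
  - change (Rabs (Re (z' - z)%C) < eps); pose proof (re_le_Cmod (z' - z)); lra.
  - change (Rabs (Im (z' - z)%C) < eps); pose proof (Rabs_Im_le (z' - z)); lra.
Qed.

Lemma Cmod_locally_C (z : C) (eps : R) :
  0 < eps -> @locally C_R_NormedModule z (fun z' => Cmod (z' - z) < eps).
Proof.
  intros He; assert (He2 : 0 < eps / 2) by lra.
  exists (mkposreal _ He2); intros z' [H1 H2].
  change (Rabs (Re z' - Re z) < eps / 2) in H1.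
  change (Rabs (Im z' - Im z) < eps / 2) in H2.
  eapply Rle_lt_trans; [apply Cmod_le_Re_Im|].
  change (Rabs (Re z' - Re z) + Rabs (Im z' - Im z) < eps); lra.
Qed.

Lemma is_RInt_gen_of_primitive (H h h0 : R -> C) (x : R) :
  (forall y, derivC H y (h y)) -> contC h -> vanish H ->
  (forall y, x <= y -> h0 y = h y) ->
  @is_RInt_gen C_R_NormedModule h0 (Rbar_locally p_infty) (at_point x) (H x).
Proof.
  intros D Ch V E P HP.
  destruct (locally_C_Cmod _ _ HP) as [eps [He HP']].
  destruct (is_lim_0_eps _ V eps He) as [B HB].
  apply Filter_prod with (Q := fun b => Rmax x B < b) (R := fun y => y = x).
  - now exists (Rmax x B).
  - reflexivity.
  - intros b y Hb ->; pose proof (Rmax_l x B); pose proof (Rmax_r x B); simpl.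
    exists (H x - H b)%C; split.
    + apply (is_RInt_ext (V := C_R_NormedModule) h).
      * intros t Ht; symmetry; apply E; rewrite Rmin_right in Ht by lra; lra.
      * apply is_RInt_derivC; auto.
    + apply HP'; replace (H x - H b - H x)%C with (- H b)%C by ring.
      rewrite Cmod_opp; specialize (HB b ltac:(lra)).
      rewrite Rabs_pos_eq in HB; [exact HB | apply Cmod_ge_0].
Qed.

Lemma is_RInt_Cscal (c : C) (h : R -> C) (a b : R) (l : C) :
  @is_RInt C_R_NormedModule h a b l ->
  @is_RInt C_R_NormedModule (fun t => c * h t)%C a b (c * l)%C.
Proof.
  intros H.
  pose proof (is_RInt_fct_extend_fst (U := R_NormedModule) (V := R_NormedModule) _ _ _ _ H) as H1.
  pose proof (is_RInt_fct_extend_snd (U := R_NormedModule) (V := R_NormedModule) _ _ _ _ H) as H2.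
  apply (is_RInt_fct_extend_pair (U := R_NormedModule) (V := R_NormedModule)
    (fun t => (c * h t)%C) a b (Re (c * l)%C) (Im (c * l)%C)).
  - exact (is_RInt_minus _ _ _ _ _ _ (is_RInt_scal _ _ _ (fst c) _ H1)
             (is_RInt_scal _ _ _ (snd c) _ H2)).
  - exact (is_RInt_plus _ _ _ _ _ _ (is_RInt_scal _ _ _ (fst c) _ H2)
             (is_RInt_scal _ _ _ (snd c) _ H1)).
Qed.

Lemma is_RInt_gen_Cscal (c : C) (h : R -> C) (Fa Fb : (R -> Prop) -> Prop) (l : C)
  (HFa : Filter Fa) (HFb : Filter Fb) :
  @is_RInt_gen C_R_NormedModule h Fa Fb l ->
  @is_RInt_gen C_R_NormedModule (fun t => c * h t)%C Fa Fb (c * l)%C.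
Proof.
  intros H P HP.
  destruct (locally_C_Cmod _ _ HP) as [eps [He HP']].
  pose proof (Cmod_ge_0 c) as Hc.
  assert (He' : 0 < eps / (1 + Cmod c)) by (apply Rdiv_lt_0_compat; lra).
  destruct (H _ (Cmod_locally_C l _ He')) as [Q T HQ HT HQT].
  apply Filter_prod with (1 := HQ) (2 := HT).
  intros x y Hx Hy; destruct (HQT x y Hx Hy) as [I [HI BI]].
  exists (c * I)%C; split; [now apply is_RInt_Cscal|].
  apply HP'; replace (c * I - c * l)%C with (c * (I - l))%C by ring.
  rewrite Cmod_mult; apply Rle_lt_trans with (Cmod c * (eps / (1 + Cmod c))).
  - apply Rmult_le_compat_l; [exact Hc | now apply Rlt_le].
  - apply Rmult_lt_reg_r with (1 + Cmod c); [lra|].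
    replace (Cmod c * (eps / (1 + Cmod c)) * (1 + Cmod c)) with (Cmod c * eps)
      by (field; lra); nra.
Qed.

Lemma is_RInt_C_unique (h : R -> C) (a b : R) (I J : C) :
  @is_RInt C_R_NormedModule h a b I -> @is_RInt C_R_NormedModule h a b J -> I = J.
Proof.
  intros H1 H2.
  apply injective_projections.
  - pose proof (is_RInt_unique (V := R_CompleteNormedModule) (fun t => Re (h t)) a b (Re I)
      (is_RInt_fct_extend_fst (U := R_NormedModule) (V := R_NormedModule) _ _ _ _ H1)) as A1.
    pose proof (is_RInt_unique (V := R_CompleteNormedModule) (fun t => Re (h t)) a b (Re J)
      (is_RInt_fct_extend_fst (U := R_NormedModule) (V := R_NormedModule) _ _ _ _ H2)) as A2.
    exact (eq_trans (eq_sym A1) A2).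
  - pose proof (is_RInt_unique (V := R_CompleteNormedModule) (fun t => Im (h t)) a b (Im I)
      (is_RInt_fct_extend_snd (U := R_NormedModule) (V := R_NormedModule) _ _ _ _ H1)) as A1.
    pose proof (is_RInt_unique (V := R_CompleteNormedModule) (fun t => Im (h t)) a b (Im J)
      (is_RInt_fct_extend_snd (U := R_NormedModule) (V := R_NormedModule) _ _ _ _ H2)) as A2.
    exact (eq_trans (eq_sym A1) A2).
Qed.

Section Primitive.

Context (h H : R -> C).
Context (HI : forall x, 0 <= x ->
  @is_RInt_gen C_R_NormedModule h (Rbar_locally p_infty) (at_point x) (H x)).

Lemma improper_eps (x eps : R) :
  0 <= x -> 0 < eps ->
  exists B, forall b, B < b ->
    exists I : C, @is_RInt C_R_NormedModule h b x I /\ Cmod (I - H x) < eps.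
Proof.
  intros Hx He.
  destruct (HI x Hx _ (Cmod_locally_C (H x) _ He)) as [Q T [B HB] HT HQT].
  exists B; intros b Hb; exact (HQT b x (HB b Hb) HT).
Qed.

Lemma improper_proper (x y : R) :
  0 <= x -> 0 <= y -> @is_RInt C_R_NormedModule h x y (H y - H x)%C.
Proof.
  intros Hx Hy.
  assert (A : exists I : C, @is_RInt C_R_NormedModule h x y I /\
     forall eps, 0 < eps -> Cmod (I - (H y - H x)) < 2 * eps).
  { assert (X : forall eps, 0 < eps -> exists I : C, @is_RInt C_R_NormedModule h x y I /\
        Cmod (I - (H y - H x)) < 2 * eps).
    { intros eps He.
      destruct (improper_eps x eps Hx He) as [B1 H1], (improper_eps y eps Hy He) as [B2 H2].
      set (b := Rmax B1 B2 + 1); pose proof (Rmax_l B1 B2); pose proof (Rmax_r B1 B2).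
      destruct (H1 b ltac:(unfold b; lra)) as [I1 [J1 K1]].
      destruct (H2 b ltac:(unfold b; lra)) as [I2 [J2 K2]].
      exists (- I1 + I2)%C; split.
      - exact (is_RInt_Chasles h x b y (- I1)%C I2 (is_RInt_swap _ _ _ _ J1) J2).
      - replace (- I1 + I2 - (H y - H x))%C with ((I2 - H y) + - (I1 - H x))%C by ring.
        eapply Rle_lt_trans; [apply Cmod_triangle|]; rewrite Cmod_opp; lra. }
    destruct (X 1 Rlt_0_1) as [I [J _]]; exists I; split; [exact J|].
    intros eps He; destruct (X eps He) as [I' [J' K']].
    now rewrite (is_RInt_C_unique _ _ _ _ _ J J'). }
  destruct A as [I [J K]].
  replace (H y - H x)%C with I; [exact J|].
  enough (I - (H y - H x) = 0)%C as E
    by (replace I with (I - (H y - H x) + (H y - H x))%C by ring; rewrite E; ring).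
  apply Cmod_eq_0; apply Rle_antisym; [|apply Cmod_ge_0].
  apply Rnot_lt_le; intros L; specialize (K _ (Rmult_lt_0_compat _ _ L (Rinv_0_lt_compat 2 Rlt_0_2))).
  lra.
Qed.

Lemma improper_vanish : vanish H.
Proof.
  apply eps_is_lim_0; intros eps He.
  destruct (improper_eps 0 eps (Rle_refl 0) He) as [B HB].
  exists (Rmax 0 B); intros b Hb; pose proof (Rmax_l 0 B); pose proof (Rmax_r 0 B).
  destruct (HB b ltac:(lra)) as [I [J K]].
  pose proof (improper_proper b 0 ltac:(lra) (Rle_refl 0)) as J'.
  rewrite (is_RInt_C_unique _ _ _ _ _ J J') in K.
  replace (H 0 - H b - H 0)%C with (- H b)%C in K by ring.
  rewrite Cmod_opp in K; rewrite Rabs_pos_eq; [exact K | apply Cmod_ge_0].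
Qed.

(** Only integrability of [h] is known, and only on [x >= 0]; extending [h] by 0
    gives an indefinite integral on a neighbourhood of 0. *)
Lemma improper_cont : contC (fun x => H (Rmax 0 x)).
Proof.
  set (h' := fun t => if Rlt_dec t 0 then RtoC 0 else h t).
  set (J := fun z => (H (Rmax 0 z) - H 0)%C).
  assert (A : forall z, @is_RInt C_R_NormedModule h' 0 z (J z)).
  { intros z; unfold J; destruct (Rle_lt_dec 0 z) as [L | L].
    - rewrite Rmax_right by exact L.
      apply (is_RInt_ext (V := C_R_NormedModule) h);
        [|now apply improper_proper; [apply Rle_refl|]].
      intros t Ht; rewrite Rmin_left in Ht by exact L.
      unfold h'; destruct (Rlt_dec t 0); [lra | reflexivity].
    - rewrite Rmax_left by lra.
      apply (is_RInt_ext (V := C_R_NormedModule) (fun _ => RtoC 0)).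
      + intros t Ht; rewrite Rmax_left in Ht by lra.
        unfold h'; destruct (Rlt_dec t 0); [reflexivity | lra].
      + replace (H 0 - H 0)%C with (scal (z - 0) (RtoC 0 : C_R_NormedModule)).
        * apply (is_RInt_const (V := C_R_NormedModule)).
        * unfold scal; simpl; unfold prod_scal, scal; simpl; unfold mult; simpl.
          unfold RtoC, Cminus, Cplus, Copp; simpl; f_equal; ring. }
  assert (CJ : forall z, continuous (U := C_R_NormedModule) J z).
  { intros z; apply (continuous_RInt_1 (V := C_R_NormedModule) h' 0 z J).
    exists (mkposreal 1 Rlt_0_1); intros y _; apply A. }
  apply contC_ext with (fun z => J z + H 0)%C; [intros x; unfold J; ring|].
  apply contC_plus; [|apply contC_const].
  intros z; specialize (CJ z); split.
  - exact (continuous_comp J fst z CJ (continuous_fst (fst (J z)) (snd (J z)))).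
  - exact (continuous_comp J snd z CJ (continuous_snd (fst (J z)) (snd (J z)))).
Qed.

Lemma improper_derive (h1 : R -> C) (x : R) :
  0 < x -> contC h1 -> (forall y, 0 <= y -> h1 y = h y) -> derivC H x (h1 x).
Proof.
  intros Hx C1 E.
  assert (A : forall z, 0 <= z -> @is_RInt C_R_NormedModule h1 0 z (H z - H 0)%C).
  { intros z Hz; apply (is_RInt_ext (V := C_R_NormedModule) h);
      [|now apply improper_proper; [apply Rle_refl|]].
    intros t Ht; rewrite Rmin_left in Ht by exact Hz; symmetry; apply E; lra. }
  assert (L : forall P : R -> Prop, (forall z, 0 <= z -> P z) -> locally x P).
  { intros P HP; exists (mkposreal x Hx); intros z Hz; apply HP.
    apply Rabs_def2 in Hz; unfold minus, plus, opp in Hz; simpl in Hz; lra. }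
  assert (D : derivC (fun z => H z - H 0)%C x (h1 x)).
  { split.
    - apply (is_derive_RInt (V := R_NormedModule) (fun t => Re (h1 t))
        (fun z => Re (H z - H 0)%C) 0 x); [apply L; intros z Hz | apply C1].
      exact (is_RInt_fct_extend_fst (U := R_NormedModule) (V := R_NormedModule) _ _ _ _ (A z Hz)).
    - apply (is_derive_RInt (V := R_NormedModule) (fun t => Im (h1 t))
        (fun z => Im (H z - H 0)%C) 0 x); [apply L; intros z Hz | apply C1].
      exact (is_RInt_fct_extend_snd (U := R_NormedModule) (V := R_NormedModule) _ _ _ _ (A z Hz)). }
  apply derivC_ext with (fun z => (H z - H 0) + H 0)%C; [intros; ring|].
  eapply derivC_eq; [exact (derivC_plus _ _ _ _ _ D (derivC_const (H 0) x)) | ring].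
Qed.

End Primitive.

(** * The Volterra equation *)

Lemma entry_kernel (c : C) (lambda : R) (u : R -> R) (x : R) (A : M2) :
  let B := exp_hat_sigma3 c (Mmul (Umat lambda u x) A) in
  entry B 0 0 = (RtoC (u x) * entry A 1 0)%C /\
  entry B 0 1 = (Cexp (2 * c) * (RtoC (u x) * entry A 1 1))%C /\
  entry B 1 0 = (Cexp (- (2 * c)) * (RtoC (lambda * u x) * entry A 0 0))%C /\
  entry B 1 1 = (RtoC (lambda * u x) * entry A 0 1)%C.
Proof.
  assert (E1 : (Cexp c * Cexp (- c))%C = RtoC 1)
    by (rewrite <- Cexp_add, <- Cexp_0; f_equal; ring).
  assert (E2 : (Cexp (- c) * Cexp (- - c))%C = RtoC 1)
    by (rewrite <- Cexp_add, <- Cexp_0; f_equal; ring).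
  assert (E3 : (Cexp c * Cexp (- - c))%C = Cexp (2 * c))
    by (rewrite <- Cexp_add; f_equal; ring).
  assert (E4 : (Cexp (- c) * Cexp (- c))%C = Cexp (- (2 * c)))
    by (rewrite <- Cexp_add; f_equal; ring).
  rewrite <- E3, <- E4.
  destruct A as [[a00 [a01 t0]] [[a10 [a11 t1]] t2]].
  unfold entry, exp_hat_sigma3, Mmul, Umat, exp_sigma3, mat2, Mmult.
  cbv [coeff_mat mk_matrix mk_Tn coeff_Tn]; simpl.
  unfold sum_n, sum_n_m, Iter.iter_nat, Iter.iter, mult, plus, zero; simpl.
  repeat split.
  - transitivity (Cexp c * Cexp (- c) * (RtoC (u x) * a10))%C; [ring | rewrite E1; ring].
  - ring.
  - ring.
  - transitivity (Cexp (- c) * Cexp (- - c) * (RtoC (lambda * u x) * a01))%C;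
      [ring | rewrite E2; ring].
Qed.

Lemma Cconj_RtoC (r : R) : Cconj (RtoC r) = RtoC r.
Proof. unfold Cconj, RtoC; simpl; f_equal; ring. Qed.

Lemma Cconj_Ci : Cconj Ci = (- Ci)%C.
Proof. unfold Cconj, Ci, Copp; simpl; f_equal; ring. Qed.

Lemma contC_conj (f : R -> C) : contC f -> contC (fun x => Cconj (f x)).
Proof.
  intros H x; destruct (H x) as [H1 H2]; split; [exact H1|].
  exact (continuous_opp (V := R_NormedModule) (fun t => Im (f t)) x H2).
Qed.

Section Volterra.

Context (lambda : R) (u v mu : R -> R).
Context (Hlam : Rabs lambda <= 1)
        (Hv : forall x, continuous v x)
        (Hmu : forall x, is_derive mu x (- Rabs (v x)))
        (Hmu0 : is_lim mu p_infty 0)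
        (Huv : forall x, 0 <= x -> v x = u x).

Definition jost (k : C) (f g : R -> C) : Prop :=
  sol lambda v k (fun x => RtoC (v x * -1)) f g.

Lemma jost_contC (k : C) (f g : R -> C) : jost k f g -> contC f /\ contC g.
Proof.
  intros [D [E _]]; split; [exact (derivC_contC _ _ D) | exact (derivC_contC _ _ E)].
Qed.

(** [offdiag k x f] is a primitive of the off-diagonal integrand
    [offdiag k x (v (1 + g))]; its value at [x] is [f x]. *)
Definition offdiag (k : C) (x : R) (f : R -> C) (y : R) : C :=
  (Cexp (2 * Ci * k * RtoC x) * (Cexp (- (2 * Ci * k) * RtoC y) * f y))%C.

Lemma jost_primitive (k : C) (f g : R -> C) (x : R) :
  Im k <= 0 -> jost k f g ->
  let H := offdiag k x f in
  let h := offdiag k x (fun y => RtoC (v y) * (RtoC 1 + g y))%C in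
  (forall y, derivC H y (h y)) /\ contC h /\ vanish H /\ H x = f x.
Proof.
  intros Hk J H h; destruct (jost_contC k f g J) as [Cf Cg].
  destruct J as [D [_ [V _]]]; split; [|split; [|split]].
  - intros y; eapply derivC_eq.
    + exact (derivC_scal _ _ _ _ (derivC_mult _ _ _ _ _ (derivC_Cexp _ y) (D y))).
    + unfold h, offdiag; rewrite RtoC_mult; ring.
  - apply contC_mult; [apply contC_const|].
    apply contC_mult; [apply contC_Cexp|].
    apply contC_mult; [apply contC_RtoC, Hv|].
    apply contC_plus; [apply contC_const | exact Cg].
  - apply vanish_scal, vanish_le with (fun y => exp (2 * Im k * x) * Cmod (f y)) x.
    + intros y Hy; rewrite Cmod_mult, Cmod_Cexp_line_opp.
      apply Rmult_le_compat_r; [apply Cmod_ge_0 | now apply exp_line_decr].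
    + apply is_lim_0_scal, V.
  - unfold H, offdiag; rewrite Cmult_assoc, <- Cexp_add.
    replace (2 * Ci * k * x + - (2 * Ci * k) * x)%C with (RtoC 0) by ring.
    rewrite Cexp_0; ring.
Qed.

(** The first column for [Im k >= 0] is obtained from the second one at the
    conjugate point, which is a symmetry of the equation since [u] is real. *)
Lemma volterra_exists (F G : C -> R -> C) :
  (forall k, Im k <= 0 -> jost k (F k) (G k)) ->
  volterra_solution lambda u (fun x k =>
    mat2 (Cconj (RtoC 1 + G (Cconj k) x)) (F k x)
         (RtoC lambda * Cconj (F (Cconj k) x)) (RtoC 1 + G k x))%C.
Proof.
  intros HJ x k i j Hx Hi Hj Hk.
  destruct j as [|[|j]]; [| | lia].
  - assert (Hk' : Im (Cconj k) <= 0)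
      by (unfold col_domain, Cconj, Im in *; simpl; lra).
    set (kb := Cconj k) in *.
    pose proof (HJ kb Hk') as J; destruct (jost_contC _ _ _ J) as [Cf Cg].
    destruct i as [|[|i]]; [| | lia].
    + change (entry (mat2 _ _ _ _) 0 0 - entry I2 0 0)%C
        with (Cconj (RtoC 1 + G kb x) - RtoC 1)%C.
      replace (Cconj (RtoC 1 + G kb x) - RtoC 1)%C with (Cconj (G kb x))
        by (rewrite Cplus_conj, Cconj_RtoC; ring).
      destruct J as [_ [D [_ V]]].
      apply (is_RInt_gen_of_primitive (fun y => Cconj (G kb y))
        (fun y => Cconj (RtoC (lambda * v y) * F kb y))).
      * intros y; now apply derivC_conj.
      * apply contC_conj, contC_mult; [apply contC_lam_u, Hv | exact Cf].
      * now apply vanish_conj.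
      * intros y Hy; destruct (entry_kernel (- Ci * k * RtoC (y - x)) lambda u y
          (mat2 (Cconj (RtoC 1 + G kb y)) (F k y)
             (RtoC lambda * Cconj (F kb y)) (RtoC 1 + G k y))%C) as [E _].
        rewrite E, <- Huv by lra.
        rewrite Cmult_conj, Cconj_RtoC, RtoC_mult.
        change (entry (mat2 _ _ _ _) 1 0) with (RtoC lambda * Cconj (F kb y))%C; ring.
    + change (entry (mat2 _ _ _ _) 1 0 - entry I2 1 0)%C
        with (RtoC lambda * Cconj (F kb x) - RtoC 0)%C.
      destruct (jost_primitive kb _ _ x Hk' J) as [D [Ch [V Ex]]].
      set (H1 := offdiag kb x (F kb)) in *.
      set (h1 := offdiag kb x (fun y => RtoC (v y) * (RtoC 1 + G kb y))%C) in *.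
      replace (RtoC lambda * Cconj (F kb x) - RtoC 0)%C with (RtoC lambda * Cconj (H1 x))%C
        by (rewrite Ex; ring).
      apply (is_RInt_gen_of_primitive (fun y => RtoC lambda * Cconj (H1 y))%C
        (fun y => RtoC lambda * Cconj (h1 y))%C).
      * intros y; apply derivC_scal, derivC_conj, D.
      * apply contC_mult; [apply contC_const | now apply contC_conj].
      * now apply vanish_scal, vanish_conj.
      * intros y Hy; destruct (entry_kernel (- Ci * k * RtoC (y - x)) lambda u y
          (mat2 (Cconj (RtoC 1 + G kb y)) (F k y)
             (RtoC lambda * Cconj (F kb y)) (RtoC 1 + G k y))%C) as [_ [_ [E _]]].
        rewrite E, <- Huv by lra.
        change (entry (mat2 _ _ _ _) 0 0) with (Cconj (RtoC 1 + G kb y)).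
        unfold h1, offdiag; rewrite (Cmult_assoc (Cexp _) (Cexp _)), <- Cexp_add.
        rewrite Cmult_conj, <- Cexp_conj, Cmult_conj, Cconj_RtoC, RtoC_mult.
        replace (Cconj (2 * Ci * kb * x + - (2 * Ci * kb) * y))
          with (- (2 * (- Ci * k * RtoC (y - x))))%C; [ring|].
        unfold kb; rewrite RtoC_minus; apply injective_projections;
          unfold Cconj, Cplus, Cminus, Copp, Cmult, Ci, RtoC; simpl; ring.
  - unfold col_domain in Hk.
    pose proof (HJ k Hk) as J; destruct (jost_contC _ _ _ J) as [Cf Cg].
    destruct i as [|[|i]]; [| | lia].
    + change (entry (mat2 _ _ _ _) 0 1 - entry I2 0 1)%C with (F k x - RtoC 0)%C.
      destruct (jost_primitive k _ _ x Hk J) as [D [Ch [V Ex]]].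
      set (H1 := offdiag k x (F k)) in *.
      set (h1 := offdiag k x (fun y => RtoC (v y) * (RtoC 1 + G k y))%C) in *.
      replace (F k x - RtoC 0)%C with (H1 x) by (rewrite Ex; ring).
      apply (is_RInt_gen_of_primitive H1 h1); try assumption.
      intros y Hy; destruct (entry_kernel (- Ci * k * RtoC (y - x)) lambda u y
          (mat2 (Cconj (RtoC 1 + G (Cconj k) y)) (F k y)
             (RtoC lambda * Cconj (F (Cconj k) y)) (RtoC 1 + G k y))%C) as [_ [E _]].
      rewrite E, <- Huv by lra.
      change (entry (mat2 _ _ _ _) 1 1) with (RtoC 1 + G k y)%C.
      unfold h1, offdiag; rewrite (Cmult_assoc (Cexp (2 * Ci * k * x)) (Cexp _)), <- Cexp_add; f_equal; f_equal.
      rewrite RtoC_minus; ring.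
    + change (entry (mat2 _ _ _ _) 1 1 - entry I2 1 1)%C with (RtoC 1 + G k x - RtoC 1)%C.
      replace (RtoC 1 + G k x - RtoC 1)%C with (G k x) by ring.
      destruct J as [_ [D [_ V]]].
      apply (is_RInt_gen_of_primitive (G k) (fun y => RtoC (lambda * v y) * F k y)%C);
        try assumption.
      * apply contC_mult; [apply contC_lam_u, Hv | exact Cf].
      * intros y Hy; destruct (entry_kernel (- Ci * k * RtoC (y - x)) lambda u y
          (mat2 (Cconj (RtoC 1 + G (Cconj k) y)) (F k y)
             (RtoC lambda * Cconj (F (Cconj k) y)) (RtoC 1 + G k y))%C) as [_ [_ [_ E]]].
        rewrite E, <- Huv by lra; reflexivity.
Qed.

Lemma is_RInt_gen_C_ext (h1 h2 : R -> C) (x : R) (l1 l2 : C) :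
  (forall y, h1 y = h2 y) -> l1 = l2 ->
  @is_RInt_gen C_R_NormedModule h1 (Rbar_locally p_infty) (at_point x) l1 ->
  @is_RInt_gen C_R_NormedModule h2 (Rbar_locally p_infty) (at_point x) l2.
Proof.
  intros E <- H; apply (is_RInt_gen_ext (V := C_R_NormedModule) h1); [|exact H].
  apply filter_forall; intros ab y _; apply E.
Qed.

(** Nothing is known of [X] beyond the convergence of the integrals. They give in
    turn: [q - 1] and [phi = exp (-2ikx) p] are tails of convergent integrals,
    hence continuous and vanishing at infinity; the integrands are then continuous
    and the differential system holds for [x > 0]; [q] is bounded near infinity,
    so [p] itself vanishes there. Uniqueness for the system gives equality for
    [x > 0], and continuity at 0. *)
Lemma volterra_unique (X : R -> C -> M2) (k : C) (f g : R -> C) :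
  volterra_solution lambda u X -> Im k <= 0 -> jost k f g ->
  entry (X 0 k) 0 1 = f 0 /\ entry (X 0 k) 1 1 = (RtoC 1 + g 0)%C.
Proof.
  intros HX Hk HJ; destruct (jost_contC _ _ _ HJ) as [Cf Cg].
  destruct HJ as [Df [Dg [Vf Vg]]].
  set (p := fun y => entry (X y k) 0 1); set (q := fun y => entry (X y k) 1 1).
  set (e := fun y => Cexp (- (2 * Ci * k) * RtoC y)).
  set (e' := fun y => Cexp (2 * Ci * k * RtoC y)).
  assert (Ee : forall y, (e' y * e y)%C = RtoC 1)
    by (intros y; unfold e, e'; rewrite <- Cexp_add, <- Cexp_0; f_equal; ring).
  set (phi := fun y => (e y * p y)%C).
  assert (Ep : forall y, p y = (e' y * phi y)%C)
    by (intros y; unfold phi; rewrite Cmult_assoc, Ee; ring).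
  set (q1 := fun y => (q y - RtoC 1)%C).
  assert (I1 : forall x, 0 <= x -> @is_RInt_gen C_R_NormedModule
     (fun y => e y * (RtoC (u y) * q y))%C (Rbar_locally p_infty) (at_point x) (phi x)).
  { intros x Hx; pose proof (HX x k 0%nat 1%nat Hx ltac:(lia) ltac:(lia) Hk) as A.
    apply (is_RInt_gen_Cscal (e x)) in A; try typeclasses eauto.
    apply is_RInt_gen_C_ext with (3 := A).
    - intros y; destruct (entry_kernel (- Ci * k * RtoC (y - x)) lambda u y (X y k))
        as [_ [E _]]; rewrite E, Cmult_assoc; f_equal.
      unfold e; rewrite <- Cexp_add; f_equal; rewrite RtoC_minus; ring.
    - change (entry I2 0 1) with (RtoC 0); unfold phi, p; ring. }
  assert (I2' : forall x, 0 <= x -> @is_RInt_gen C_R_NormedModule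
     (fun y => RtoC (lambda * u y) * p y)%C (Rbar_locally p_infty) (at_point x) (q1 x)).
  { intros x Hx; pose proof (HX x k 1%nat 1%nat Hx ltac:(lia) ltac:(lia) Hk) as A.
    apply is_RInt_gen_C_ext with (3 := A).
    - intros y; apply (entry_kernel (- Ci * k * RtoC (y - x)) lambda u y (X y k)).
    - reflexivity. }
  pose proof (improper_vanish _ _ I1) as Vphi; pose proof (improper_vanish _ _ I2') as Vq.
  pose proof (improper_cont _ _ I1) as Cphi; pose proof (improper_cont _ _ I2') as Cq.
  assert (D1 : forall x, 0 < x -> derivC phi x (e x * (RtoC (v x) * q x))%C).
  { intros x Hx.
    set (h1 := fun y => (e y * (RtoC (v y) * (q1 (Rmax 0 y) + RtoC 1)))%C).
    eapply derivC_eq; [apply (improper_derive _ _ I1 h1 x Hx)|].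
    - apply contC_mult; [apply contC_Cexp|]; apply contC_mult; [now apply contC_RtoC|].
      apply contC_plus; [exact Cq | apply contC_const].
    - intros y Hy; unfold h1, q1; rewrite Huv, Rmax_right by exact Hy; ring.
    - unfold h1, q1; rewrite Rmax_right by lra; ring. }
  assert (D2 : forall x, 0 < x -> derivC q1 x (RtoC (lambda * v x) * p x)%C).
  { intros x Hx.
    set (h1 := fun y => (RtoC (lambda * v y) * (e' y * phi (Rmax 0 y)))%C).
    eapply derivC_eq; [apply (improper_derive _ _ I2' h1 x Hx)|].
    - apply contC_mult; [apply contC_lam_u, Hv|].
      apply contC_mult; [apply contC_Cexp | exact Cphi].
    - intros y Hy; unfold h1; rewrite Ep, Huv, Rmax_right by exact Hy; ring.
    - unfold h1; rewrite Rmax_right by lra; rewrite Ep; ring. }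
  assert (Dp : forall x, 0 < x -> derivC p x (2 * Ci * k * p x + RtoC (v x) * q x)%C).
  { intros x Hx; apply derivC_ext with (1 := fun y => eq_sym (Ep y)).
    eapply derivC_eq; [exact (derivC_mult _ _ _ _ _ (derivC_Cexp _ x) (D1 x Hx))|].
    rewrite (Ep x); fold (e' x).
    replace (e' x * (e x * (v x * q x)))%C with (e' x * e x * (v x * q x))%C by ring.
    rewrite Ee; ring. }
  assert (Vp : vanish p).
  { destruct (is_lim_0_eps _ Vq 1 Rlt_0_1) as [B HB].
    set (x1 := Rmax 1 (B + 1)).
    assert (1 <= x1) by apply Rmax_l; assert (B + 1 <= x1) by apply Rmax_r.
    assert (Bq : forall y, x1 <= y -> Cmod (q y) <= 2).
    { intros y Hy; specialize (HB y ltac:(lra)).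
      rewrite Rabs_pos_eq in HB by apply Cmod_ge_0.
      replace (q y) with (q1 y + RtoC 1)%C by (unfold q1; ring).
      eapply Rle_trans; [apply Cmod_triangle|]; rewrite Cmod_1; lra. }
    apply vanish_le with (fun x => 2 * mu x) x1; [|now apply is_lim_0_scal].
    intros x Hx.
    assert (Bphi : Cmod (phi x) <= exp (2 * Im k * x) * (2 * mu x)).
    { apply le_of_lim_0 with (e := fun y => Cmod (phi y)) (x0 := x); [|exact Vphi].
      intros y Hy.
      assert (A : Cmod (phi y - phi x) <=
          exp (2 * Im k * x) * (2 * mu x) - exp (2 * Im k * x) * (2 * mu y)).
      { apply (Cmod_increment_le phi (fun t => e t * (RtoC (v t) * q t))%C
          (fun t => exp (2 * Im k * x) * (2 * mu t))
          (fun t => exp (2 * Im k * x) * (2 * - Rabs (v t))) x y Hy); intros t Ht.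
        - apply D1; lra.
        - apply (is_derive_scal (fun t => 2 * mu t)), (is_derive_scal mu), Hmu.
        - rewrite !Cmod_mult; unfold e; rewrite Cmod_Cexp_line_opp, Cmod_R.
          pose proof (exp_line_decr k x t Hk ltac:(lra)); pose proof (exp_pos (2 * Im k * t)).
          pose proof (Bq t ltac:(lra)); pose proof (Rabs_pos (v t)).
          pose proof (Cmod_ge_0 (q t)).
          apply Rle_trans with (exp (2 * Im k * x) * (Rabs (v t) * 2)); [|lra].
          apply Rmult_le_compat; [lra | apply Rmult_le_pos; lra | lra |].
          apply Rmult_le_compat_l; lra. }
      pose proof (exp_pos (2 * Im k * x)); pose proof (mu_nonneg v mu Hmu Hmu0 y).
      assert (Cmod (phi x) <= Cmod (phi y - phi x) + Cmod (phi y)).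
      { rewrite Cmod_minus_sym; replace (phi x) with ((phi x - phi y) + phi y)%C at 1 by ring.
        apply Cmod_triangle. }
      nra. }
    rewrite Ep, Cmod_mult; unfold e'; rewrite Cmod_Cexp_line.
    pose proof (exp_pos (- (2 * Im k) * x)).
    apply Rle_trans with (exp (- (2 * Im k) * x) * (exp (2 * Im k * x) * (2 * mu x))); [nra|].
    rewrite <- Rmult_assoc, <- exp_plus.
    replace (- (2 * Im k) * x + 2 * Im k * x) with 0 by ring.
    rewrite exp_0; lra. }
  assert (Z : forall x, 0 < x -> (p x - f x)%C = RtoC 0 /\ (q1 x - g x)%C = RtoC 0).
  { intros x Hx.
    apply (system_zero lambda v mu Hlam Hmu Hmu0 k (fun x => p x - f x)%C
      (fun x => q1 x - g x)%C x Hk); [| | | |apply Rle_refl].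
    - intros y Hy; eapply derivC_eq;
        [exact (derivC_minus _ _ _ _ _ (Dp y ltac:(lra)) (Df y))|].
      unfold q1; rewrite RtoC_mult; ring.
    - intros y Hy; eapply derivC_eq;
        [exact (derivC_minus _ _ _ _ _ (D2 y ltac:(lra)) (Dg y))|].
      ring.
    - now apply vanish_minus.
    - now apply vanish_minus. }
  assert (Z0 : forall t : R -> C, contC t -> (forall x, 0 < x -> t x = RtoC 0) -> t 0 = RtoC 0).
  { intros t Ct Zt; apply Cmod_eq_0; apply Rle_antisym; [|apply Cmod_ge_0].
    apply Rnot_lt_le; intros L.
    destruct (eps_contC t 0 _ Ct L) as [d [Hd B]].
    specialize (B (d / 2)); rewrite Zt in B by lra.
    replace (RtoC 0 - t 0)%C with (- t 0)%C in B by ring; rewrite Cmod_opp in B.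
    rewrite Rminus_0_r, Rabs_pos_eq in B by lra; specialize (B ltac:(lra)); lra. }
  split.
  - pose proof (Z0 (fun y => e' y * phi (Rmax 0 y) - f y)%C) as A; cbv beta in A.
    rewrite Rmax_right, <- Ep in A by apply Rle_refl.
    replace (entry (X 0 k) 0 1) with ((p 0 - f 0) + f 0)%C by (unfold p; ring).
    rewrite A; [ring | |].
    + apply contC_minus; [|exact Cf]; apply contC_mult; [apply contC_Cexp | exact Cphi].
    + intros x Hx; rewrite Rmax_right, <- Ep by lra; apply Z, Hx.
  - pose proof (Z0 (fun y => q1 (Rmax 0 y) - g y)%C) as A; cbv beta in A.
    rewrite Rmax_right in A by apply Rle_refl.
    replace (entry (X 0 k) 1 1) with ((q1 0 - g 0) + (RtoC 1 + g 0))%C by (unfold q1, q; ring).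
    rewrite A; [ring | |].
    + apply contC_minus; [exact Cq | exact Cg].
    + intros x Hx; rewrite Rmax_right by lra; apply Z, Hx.
Qed.

Lemma jost_conj (k : C) (f g : R -> C) :
  jost k f g ->
  jost (- Cconj k)%C (fun x => Cconj (f x)) (fun x => Cconj (g x)).
Proof.
  intros [Df [Dg [Vf Vg]]]; split; [|split; [|split; now apply vanish_conj]];
    intros x; eapply derivC_eq.
  - exact (derivC_conj _ _ _ (Df x)).
  - unfold Cminus; rewrite !Cplus_conj, !Cmult_conj, Cconj_Ci, !Cconj_RtoC.
    replace (Cconj (- RtoC (v x * -1)))%C with (- RtoC (v x * -1))%C; [ring|].
    rewrite <- RtoC_opp, Cconj_RtoC; reflexivity.
  - exact (derivC_conj _ _ _ (Dg x)).
  - rewrite Cmult_conj, Cconj_RtoC; reflexivity.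
Qed.

(** The terms with [u] cancel because [u] is real: what remains is constant on the
    real axis and, if [lambda = 1], nonincreasing in [x] in the lower half-plane,
    with limit 1 at infinity. *)
Lemma jost_energy (k : C) (f g : R -> C) :
  jost k f g ->
  exists N : R -> R,
    (forall x, is_derive N x (4 * lambda * Im k * Cmod (f x) ^ 2)) /\
    is_lim N p_infty 0 /\
    (forall x, Cmod (RtoC 1 + g x) ^ 2 - lambda * Cmod (f x) ^ 2 = 1 + N x).
Proof.
  intros [Df [Dg [Vf Vg]]].
  set (N := fun x => 2 * Re (g x) + (Re (g x) ^ 2 + Im (g x) ^ 2 +
                     - lambda * (Re (f x) ^ 2 + Im (f x) ^ 2))).
  exists N; split; [|split].
  - intros x; destruct (Df x) as [F1 F2], (Dg x) as [G1 G2].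
    eapply is_derive_eq.
    + exact (is_derive_plus _ _ _ _ _ (is_derive_scal _ _ 2 _ G1)
        (is_derive_plus _ _ _ _ _
          (is_derive_plus _ _ _ _ _ (is_derive_sqr _ _ _ G1) (is_derive_sqr _ _ _ G2))
          (is_derive_scal _ _ (- lambda) _
            (is_derive_plus _ _ _ _ _ (is_derive_sqr _ _ _ F1) (is_derive_sqr _ _ _ F2))))).
    + rewrite Cmod2_alt; unfold plus; simpl.
      unfold Re, Im, Ci, RtoC, Cmult, Cplus, Cminus, Copp; simpl; ring.
  - apply is_lim_ext with (fun x => 2 * Re (g x) + (Cmod (g x) ^ 2 + - lambda * Cmod (f x) ^ 2)).
    + intros x; unfold N; now rewrite !Cmod2_alt.
    + apply is_lim_0_plus; [apply is_lim_0_scal, vanish_Re, Vg|].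
      apply is_lim_0_plus; [apply is_lim_0_sqr, Vg | apply is_lim_0_scal, is_lim_0_sqr, Vf].
  - intros x; unfold N; rewrite !Cmod2_alt.
    unfold Re, Im, RtoC, Cplus; simpl; ring.
Qed.

Lemma jost_determinant (k : R) (f g : R -> C) :
  jost (RtoC k) f g -> Cmod (RtoC 1 + g 0) ^ 2 - lambda * Cmod (f 0) ^ 2 = 1.
Proof.
  intros J; destruct (jost_energy _ _ _ J) as [N [D [L E]]]; rewrite E.
  assert (D0 : forall x, is_derive N x 0).
  { intros x; eapply is_derive_eq; [apply D | unfold Im, RtoC; simpl; ring]. }
  enough (0 <= N 0 /\ 0 <= -1 * N 0) by lra.
  split.
  - apply nonneg_of_decreasing_to_0 with (fun _ => 0) 0; [intros; apply D0 | intros; lra | exact L | lra].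
  - apply (nonneg_of_decreasing_to_0 (fun x => -1 * N x) (fun _ => -1 * 0) 0).
    + intros x _; apply (is_derive_scal N), D0.
    + intros; lra.
    + now apply is_lim_0_scal.
    + lra.
Qed.

Lemma jost_nonzero (k : C) (f g : R -> C) :
  lambda = 1 -> Im k <= 0 -> jost k f g -> (RtoC 1 + g 0)%C <> RtoC 0.
Proof.
  intros Hl Hk J; destruct (jost_energy _ _ _ J) as [N [D [L E]]]; intros Z.
  specialize (E 0); rewrite Z, Cmod_0, Hl in E.
  assert (0 <= N 0).
  { apply (nonneg_of_decreasing_to_0 N _ 0 (fun x _ => D x)); [|exact L | lra].
    intros x _; rewrite Hl; pose proof (pow2_ge_0 (Cmod (f x))); nra. }
  pose proof (pow2_ge_0 (Cmod (f 0))); nra.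
Qed.

End Volterra.

Lemma trace_decaying (lambda : R) (u mu : R -> R)
  (Hlam : Rabs lambda <= 1) (Hu : forall x, continuous u x)
  (Hmu : forall x, is_derive mu x (- Rabs (u x))) (Hmu0 : is_lim mu p_infty 0)
  (n : nat) (w Om : R -> R) (b : bool) :
  (forall x, continuous w x) -> weighted n w Om ->
  forall i j, (i + j <= n)%nat -> decaying i 0 (trace lambda u w b j).
Proof.
  intros Cw HM; induction i as [|i IH]; intros j Hij;
    (split; [destruct (trace_bounded lambda u mu Hlam Hu Hmu Hmu0 n w Om Cw HM b j ltac:(lia))
               as [M B]; exists M; intros k Hk _; simpl; unfold Rdiv; rewrite Rinv_1, Rmult_1_r;
             now apply B|]).
  - exact I.
  - exists (trace lambda u w b (S j)); split; [|apply IH; lia].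
    intros k Hk _; apply (trace_deriv lambda u mu Hlam Hu Hmu Hmu0 n w Om Cw HM); auto; lia.
Qed.

(** * The spectral functions *)

Theorem theorem3p5 (lambda : R) (m n : nat) (u : R -> R)
  (Hlambda : lambda = 1 \/ lambda = -1)
  (Hm : (1 <= m)%nat) (Hn : (1 <= n)%nat)
  (Hu : exists Du : nat -> R -> R,
      Cp_halfline (m + 1) u Du /\
      forall i : nat, (i <= m + 1)%nat ->
        L1_halfline (fun x => (1 + x) ^ n * Du i x)) :
  (* the spectral functions exist *)
  (exists a b : C -> C, spectral_functions lambda u a b) /\
  forall a b : C -> C, spectral_functions lambda u a b ->
    (* (a) *)
    (C_continuous_on closed_lower a /\ C_continuous_on closed_lower b /\
     C_analytic_on (fun k => Im k < 0) a /\ C_analytic_on (fun k => Im k < 0) b) /\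
    (* (b), (c) *)
    (exists ca cb : nat -> C,
      (O_inv_pow (m + 1) (fun k => a k - inv_poly (RtoC 1) ca m k)%C /\
       O_inv_pow (m + 1) (fun k => b k - inv_poly (RtoC 0) cb m k)%C) /\
      (forall j : nat, (1 <= j <= n)%nat ->
         derivative_asymptotics a (inv_poly (RtoC 1) ca m) j (m + 1) /\
         derivative_asymptotics b (inv_poly (RtoC 0) cb m) j (m + 1))) /\
    (* (d) *)
    (forall k : C, Im k <= 0 ->
       a k = Cconj (a (- Cconj k)%C) /\ b k = Cconj (b (- Cconj k)%C)) /\
    (* (e) *)
    (forall k : R,
       Cmod (a (RtoC k)) ^ 2 - lambda * Cmod (b (RtoC k)) ^ 2 = 1) /\
    (* (f) *)
    (lambda = 1 -> forall k : C, Im k <= 0 -> a k <> RtoC 0).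
Proof.
  assert (Hlam : Rabs lambda <= 1)
    by (destruct Hlambda as [-> | ->]; unfold Rabs; destruct (Rcase_abs _); lra).
  destruct Hu as [Du [HC HL]].
  destruct (potential_extension _ _ _ _ HC HL) as [v [Huv HW]]; clear HC HL Du.
  rewrite Nat.add_1_r in *.
  pose proof (weightedC_continuous _ _ _ HW) as Hv.
  destruct (weightedC_weighted _ _ _ HW) as [Om HOm].
  (* From here on [v] replaces [u]: the Volterra equation only involves [x >= 0]. *)
  set (mu := Rtail (fun x => Rabs (v x))).
  destruct (Rtail_spec (fun x => Rabs (v x)) Om 0) as [Hmu [Hmu0 _]].
  { intros x; apply continuous_Rabs_comp, Hv. }
  { apply majorant_le with (2 := weighted_majorant _ _ _ HOm).
    intros x _; rewrite !Cmod_R, Rabs_Rabsolu; apply Rle_refl. }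
  fold mu in Hmu, Hmu0.
  set (w := fun x => v x * -1).
  assert (HWw : weightedC n (S m) w) by (apply weightedC_mult; [exact HW | apply boundedC_const]).
  pose proof (weightedC_continuous _ _ _ HWw) as Cw.
  destruct (weightedC_weighted _ _ _ HWw) as [Th HTh].
  set (F := fun k => fst (jet lambda v k (fun x => RtoC (w x)) 0)).
  set (G := fun k => snd (jet lambda v k (fun x => RtoC (w x)) 0)).
  assert (HJ : forall k, Im k <= 0 -> jost lambda v k (F k) (G k)).
  { intros k Hk.
    destruct (weighted_chain n w Th Cw HTh) as [W [HWc E]].
    destruct (jet_spec lambda v mu Hlam Hv Hmu Hmu0 k _ (S n) W Hk (contC_RtoC w Cw) HWc
      (Cmod_chain w W E) O ltac:(lia)) as [S0 _].
    apply sol_ext with (2 := S0); intros x; unfold w; simpl source; simpl INR; ring. }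
  split.
  { exists (fun k => RtoC 1 + G k 0)%C, (fun k => F k 0); eexists; split.
    - exact (volterra_exists lambda u v Hv Huv F G HJ).
    - intros k _; split; reflexivity. }
  intros a b [X [HX Hab]].
  assert (Hb : forall k, Im k <= 0 -> b k = F k 0).
  { intros k Hk; destruct (Hab k Hk) as [-> _].
    apply (volterra_unique lambda u v mu Hlam Hv Hmu Hmu0 Huv X k _ _ HX Hk (HJ k Hk)). }
  assert (Ha : forall k, Im k <= 0 -> a k = (RtoC 1 + G k 0)%C).
  { intros k Hk; destruct (Hab k Hk) as [_ ->].
    apply (volterra_unique lambda u v mu Hlam Hv Hmu Hmu0 Huv X k _ _ HX Hk (HJ k Hk)). }
  destruct (expansion lambda v mu Hlam Hv Hmu Hmu0 n (S m) w HW HWw)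
    as [c [w1 [Hc [HW1 Ex]]]].
  destruct (weightedC_weighted _ _ _ HW1) as [Th1 HTh1].
  pose proof (weightedC_continuous _ _ _ HW1) as Cw1.
  (* The coefficient of [1/k^(m+1)] belongs to the remainder. *)
  set (Psi := fun i k => ((c i (S m) + / (2 * Ci) ^ S m * trace lambda v w1 i 0 k) * (/ k) ^ S m)%C).
  assert (DPsi : forall i, decaying n (S m) (Psi i)).
  { intros i; apply decaying_div_pow, decaying_plus; [apply decaying_const|].
    apply decaying_scal.
    apply (trace_decaying lambda v mu Hlam Hv Hmu Hmu0 n w1 Th1 i Cw1 HTh1); lia. }
  assert (H2i : (2 * Ci)%C <> RtoC 0)
    by (apply Cmult_neq_0; [intros H; apply RtoC_inj in H; lra | exact Ci_nz]).
  assert (EPsi : forall i c0 k, Im k <= 0 -> k <> RtoC 0 ->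
    (c0 + trace lambda v w i 0 k)%C = (inv_poly c0 (c i) m k + Psi i k)%C).
  { intros i c0 k Hk Hk0; rewrite Ex, inv_poly_lpoly by assumption.
    rewrite (lpoly_head (fun l => match l with O => c0 | S _ => c i l end) (c i)), Hc
      by reflexivity.
    change (lpoly (c i) (S m) k) with (lpoly (c i) m k + c i (S m) / k ^ S m)%C.
    unfold Psi.
    rewrite Cpow_inv, (Cpow_mult_l (2 * Ci)) by exact Hk0.
    field; split; apply Cpow_nz; assumption. }
  set (Ea := fun j k => match j with
    | O => (RtoC 1 + trace lambda v w false O k)%C | S _ => trace lambda v w false j k end).
  pose proof (trace_deriv lambda v mu Hlam Hv Hmu Hmu0 n w Th Cw HTh) as TD.
  pose proof (trace_cont lambda v mu Hlam Hv Hmu Hmu0 n w Th Cw HTh) as TC.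
  destruct (expansion_derivatives a Ea n m (S m) (RtoC 1) (c false) (Psi false) Hn)
    as [A1 [A2 [A3 A4]]].
  { exact Ha. }
  { intros [|j] k Hj Hk; [|now apply TD].
    eapply deriv_on_eq; [exact (deriv_on_plus _ _ _ _ _ _ (deriv_on_const _ (RtoC 1) k) (TD false O k Hj Hk))|].
    unfold Ea; ring. }
  { intros [|j] k Hj Hk; [|now apply TC].
    intros eps He; destruct (TC false O k Hj Hk eps He) as [d [Hd B]].
    exists d; split; [exact Hd|]; intros k' Lk' Hk'; unfold Ea.
    replace (1 + trace lambda v w false 0 k' - (1 + trace lambda v w false 0 k))%C
      with (trace lambda v w false 0 k' - trace lambda v w false 0 k)%C by ring.
    now apply B. }
  { apply DPsi. }
  { intros k Hk Hk0; rewrite Ha by exact Hk; exact (EPsi false (RtoC 1) k Hk Hk0). }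
  destruct (expansion_derivatives b (trace lambda v w true) n m (S m) (RtoC 0) (c true)
    (Psi true) Hn Hb (TD true) (TC true) (DPsi true)) as [B1 [B2 [B3 B4]]].
  { intros k Hk Hk0; rewrite Hb, <- (EPsi true) by assumption.
    unfold trace, pick; fold (F k); ring. }
  split; [exact (conj A1 (conj B1 (conj A2 B2)))|].
  split; [exists (c false), (c true); split;
    [exact (conj A3 B3) | intros j Hj; exact (conj (A4 j Hj) (B4 j Hj))]|].
  assert (Im_conj : forall k, Im k <= 0 -> Im (- Cconj k)%C <= 0)
    by (intros k Hk; unfold Im, Cconj, Copp in *; simpl; lra).
  split; [|split].
  - intros k Hk; rewrite !Ha, !Hb by auto.
    destruct (sol_unique lambda v mu Hlam Hmu Hmu0 _ _ _ _ _ _ (Im_conj k Hk)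
      (HJ _ (Im_conj k Hk)) (jost_conj lambda v k _ _ (HJ k Hk)) 0) as [-> ->].
    rewrite Cplus_conj, Cconj_RtoC, !Cconj_conj; split; reflexivity.
  - intros k; assert (Hk : Im (RtoC k) <= 0) by (unfold Im, RtoC; simpl; lra).
    rewrite Ha, Hb by exact Hk.
    exact (jost_determinant lambda v k _ _ (HJ _ Hk)).
  - intros Hl k Hk; rewrite Ha by exact Hk.
    exact (jost_nonzero lambda v k _ _ Hl Hk (HJ k Hk)).
Qed.
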